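(* Let $\zeta(\mathbf{r},t)$ be the free surface elevation, $\phi(\mathbf{r},z,t)$ the velocity potential, with $\Delta\phi=0$ in the region $z<\zeta(\mathbf{r},t)$, and let $\boldsymbol{\xi}_i(\mathbf{r},z)=(\boldsymbol{\xi}_i^{(\mathbf{r})},\xi_i^{(z)})$, $i=1,2,\dots$, be prescribed divergence-free three-dimensional vector fields. Write $\widehat{f}$ for the evaluation of $f$ on $z=\zeta$. The stochastic classical water wave equations $$\mathrm{d}\zeta = \widehat{\partial_z\phi}\,dt - \widehat{\nabla_{\mathbf{r}}\phi}\cdot\nabla_{\mathbf{r}}\zeta\,dt + \sum_{i=1}^\infty \Big( \widehat{\xi_i^{(z)}} - \widehat{\boldsymbol{\xi}_i^{(\mathbf{r})}}\cdot\nabla_{\mathbf{r}}\zeta \Big)\circ dW_t^i ,$$ $$\mathrm{d}\widehat\phi + \tfrac12 |\widehat{\nabla_{\mathbf{r}}\phi}|^2\,dt - \tfrac12 (\widehat{\partial_z\phi})^2\,dt + \widehat{\partial_z\phi}\,(\widehat{\nabla_{\mathbf{r}}\phi}\cdot \nabla_{\mathbf{r}}\zeta) \,dt + g\zeta \,dt + \sum_{i=1}^\infty \Big( \widehat{\boldsymbol{\xi}_i^{(\mathbf{r})}}\cdot \widehat{\nabla_{\mathbf{r}}\phi} + \widehat{\partial_z\phi}\,\big(\widehat{\boldsymbol{\xi}_i^{(\mathbf{r})}}\cdot \nabla_{\mathbf{r}}\zeta\big) \Big) \circ dW_t^i = 0$$ have a Hamiltonian structure with canonically conjugate variables $(\zeta,\widehat\phi)$;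 that is, they can be expressed as $$\mathrm{d}\zeta = \frac{\delta H}{\delta\widehat\phi}\,dt + \sum_{i=1}^\infty \frac{\delta H_i}{\delta\widehat\phi}\circ dW_t^i ,\qquad \mathrm{d}\widehat\phi = - \frac{\delta H}{\delta\zeta}\,dt - \sum_{i=1}^\infty \frac{\delta H_i}{\delta\zeta}\circ dW_t^i ,$$ where the family of Hamiltonians is given by $$H = \int \int_{-\infty}^{\zeta} \tfrac12|\nabla\phi|^2 \,dz\,d^2r +\tfrac12 g \int\zeta^2\,d^2r , \qquad H_i = \int \int_{-\infty}^{\zeta} \boldsymbol{\xi}_i\cdot\nabla\phi \,dz\,d^2r ,\quad i=1,2,\dots .$$
   Context: Coordinates are $(x,y,z)=(\mathbf{r},z)$, with $\mathbf{r}=(x,y)$ horizontal and $z$ vertical; $\nabla=(\partial_x,\partial_y,\partial_z)$, $\nabla_{\mathbf{r}}=(\partial_x,\partial_y)$, and $d^2r$ integrals are over the horizontal domain. At time $t$ the fluid occupies the (simply connected) region $-\infty<z<\zeta(\mathbf{r},t)$. The constant $g$ is the acceleration due to gravity, $W_t^i$ are independent Brownian motions, $\circ\, dW_t^i$ denotes Stratonovich integration, and $\mathrm{d}$ denotes the stochastic differential in time at fixed spatial position. Evaluation on the free surface: for a function $f(\mathbf{r},z,t)$, $\widehat f(\mathbf{r},t):=f(\mathbf{r},\zeta(\mathbf{r},t),t)$. Thus $\widehat{\nabla_{\mathbf{r}}\phi}$ means differentiate first, then evaluate at $z=\zeta$. The fluid velocity is $\mathbf{u}=\nabla\phi$ with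 $\Delta\phi=0$. The fields $\boldsymbol{\xi}_i$ are independent of $\phi$ and $\zeta$, satisfy $\nabla\cdot\boldsymbol{\xi}_i=0$, and need not be irrotational. $H$ and $H_i$ are regarded as functionals of the pair $(\zeta,\widehat\phi)$: given $\zeta$ and surface data $\widehat\phi$, $\phi$ is the harmonic function in $z<\zeta$ with trace $\widehat\phi$ on $z=\zeta$. Variational derivatives are with respect to the $L^2(d^2r)$ pairing, e.g. $\frac{d}{d\epsilon}\big|_{\epsilon=0}H(\zeta+\epsilon\,\delta\zeta,\widehat\phi)=\int \frac{\delta H}{\delta\zeta}\,\delta\zeta\,d^2r$. The derivative with respect to $\widehat\phi$ is taken with $\zeta$ fixed. The derivative with respect to $\zeta$ is taken with the surface trace $\widehat\phi$ fixed (so that $\phi$ in the interior changes with $\zeta$). Standing assumptions: all functions are smooth enough, and decay enough, for the integrals and the integrations by parts to make sense. The normal components of $\nabla\phi$ and of $\boldsymbol{\xi}_i$ vanish on all boundaries of the fluid region other than the free surface (including as $z\to-\infty$ and laterally), so that Green's identities and the divergence theorem produce contributions only from the free surface. *)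

(* Defs.v *)
From HB Require Import structures.
From mathcomp Require Import all_boot all_order all_algebra.
From mathcomp Require Import all_classical all_reals all_analysis.
Set Implicit Arguments.
Unset Strict Implicit.
Unset Printing Implicit Defensive.
Import Order.TTheory GRing.Theory Num.Theory numFieldNormedType.Exports.
Local Open Scope classical_set_scope.
Local Open Scope ring_scope.

(* A horizontal point is r = (x, y) : R * R, a point of
   space is p = (r, z) : R * R * R. *)

Section calculus.
Context {R : realType}.

(* C^k on an open set U; values outside U are irrelevant. *)
Fixpoint Ck {V : normedModType R} (k : nat) (U : set V) (f : V -> R) : Prop :=
  if k is k'.+1 then
    (forall x, U x -> differentiable f x) /\ (forall v, Ck k' U ('D_v f))
  else forall x, U x -> {for x, continuous f}.

Definition dot2 (a b : R * R) : R := a.1 * b.1 + a.2 * b.2.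
Definition dot3 (a b : R * R * R) : R := dot2 a.1 b.1 + a.2 * b.2.

Definition ex : R * R * R := ((1, 0), 0).
Definition ey : R * R * R := ((0, 1), 0).
Definition ez : R * R * R := ((0, 0), 1).

Definition grad2 (f : R * R -> R) (r : R * R) : R * R :=
  ('D_((1 : R), (0 : R)) f r, 'D_((0 : R), (1 : R)) f r).
Definition gradr (f : R * R * R -> R) (p : R * R * R) : R * R :=
  ('D_ex f p, 'D_ey f p).
Definition dz (f : R * R * R -> R) (p : R * R * R) : R := 'D_ez f p.
Definition grad (f : R * R * R -> R) (p : R * R * R) : R * R * R :=
  (gradr f p, dz f p).

Definition div (v : R * R * R -> R * R * R) (p : R * R * R) : R :=
  'D_ex (fun q => (v q).1.1) p + 'D_ey (fun q => (v q).1.2) p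
  + 'D_ez (fun q => (v q).2) p.
Definition laplacian (f : R * R * R -> R) : R * R * R -> R := div (grad f).

Definition Ck_field (k : nat) (U : set (R * R * R))
    (v : R * R * R -> R * R * R) : Prop :=
  [/\ Ck k U (fun p => (v p).1.1), Ck k U (fun p => (v p).1.2)
    & Ck k U (fun p => (v p).2)].

Definition area := (@lebesgue_measure R \x @lebesgue_measure R)%E.
Definition volume := (area \x @lebesgue_measure R)%E.

End calculus.

Section water_waves.
Context {R : realType}.
Implicit Types (D : set (R * R)) (zeta f eta kappa : R * R -> R).
Implicit Types (phi chi : R * R * R -> R) (v xi : R * R * R -> R * R * R).

Definition fluid D zeta : set (R * R * R) :=
  [set p | D p.1 /\ p.2 < zeta p.1].

(* Functions on the fluid that are C^k up to the free surface are represented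
   by functions that are C^k on the whole column over D; only their values at
   z <= zeta matter. *)
Definition column D : set (R * R * R) := [set p | D p.1].

Definition hat {V : Type} zeta (F : R * R * R -> V) (r : R * R) : V :=
  F (r, zeta r).

(* Decay at infinity is imposed through the energy space: grad phi and
   phi / (1 + |p|^2)^(1/2) are square integrable.  The weight admits
   potentials which tend to a constant as z -> -oo, as they do over a bounded
   D. *)
Definition energy_density phi (p : R * R * R) : R :=
  dot3 (grad phi p) (grad phi p) + phi p ^+ 2 / (1 + dot3 p p).
Definition finite_energy D zeta phi : Prop :=
  volume.-integrable (fluid D zeta) (EFin \o energy_density phi).

Definition square_integrable D zeta v : Prop :=
  volume.-integrable (fluid D zeta) (EFin \o (fun p => dot3 (v p) (v p))).

(* The normal component of v vanishes on every boundary of the fluid other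
   than the free surface (lateral walls, infinity), in the usual weak sense,
   which needs no regularity of the boundary of D: div (chi v) has integral
   zero for every finite energy chi vanishing near the free surface.  For
   D = setT and v solenoidal and square integrable this always holds. *)
Definition no_flux D zeta v : Prop :=
  forall chi, Ck 1 (column D) chi -> finite_energy D zeta chi ->
  (exists2 delta : R, 0 < delta &
    forall p, D p.1 -> zeta p.1 - delta < p.2 -> chi p = 0) ->
  \int[volume]_(p in fluid D zeta)
    (dot3 (v p) (grad chi p) + chi p * div v p) = 0.

Definition is_potential D zeta f phi : Prop :=
  [/\ Ck 2 (column D) phi,
      forall p, fluid D zeta p -> laplacian phi p = 0,
      forall r, D r -> hat zeta phi r = f r,
      finite_energy D zeta phi
    & no_flux D zeta (grad phi)].

(* The harmonic function with trace f on z = zeta; its values in the fluid do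
   not depend on the choice. *)
Definition potential D zeta f : R * R * R -> R :=
  xget (cst 0) [set phi | is_potential D zeta f phi].

Definition hamiltonian D (g : R) zeta f : R :=
  \int[volume]_(p in fluid D zeta)
    (2^-1 * dot3 (grad (potential D zeta f) p) (grad (potential D zeta f) p))
  + 2^-1 * g * \int[area]_(r in D) (zeta r ^+ 2).

Definition noise_hamiltonian D xi zeta f : R :=
  \int[volume]_(p in fluid D zeta) dot3 (xi p) (grad (potential D zeta f) p).

Definition test_function D eta : Prop :=
  (forall k, Ck k setT eta) /\
  exists K, [/\ compact K, K `<=` D & forall r, ~ K r -> eta r = 0].

(* Among continuous G there is at most one such function on D. *)
Definition is_vderiv D (F : (R * R -> R) -> R) f (G : R * R -> R) : Prop :=
  (forall r, D r -> {for r, continuous G}) /\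
  forall eta, test_function D eta ->
    is_derive (0 : R) (1 : R) (fun e : R => F (fun r => f r + e * eta r))
      (\int[area]_(r in D) (G r * eta r)).
Definition vderiv D (F : (R * R -> R) -> R) f : R * R -> R :=
  xget (cst 0) [set G | is_vderiv D F f G].

(* The Dirichlet problem for the data (zeta + e eta, f + e kappa) is solvable
   for small e, the solution is C^2 jointly in e and the position, and its
   e-derivative is dominated in the energy space. *)
Definition smooth_variation D zeta f eta kappa : Prop :=
  exists (e0 : R) (Phi : R * (R * R * R) -> R) (b : R * R * R -> R),
  [/\ 0 < e0,
      Ck 2 [set q | `|q.1| < e0 /\ column D q.2] Phi,
      forall e, `|e| < e0 ->
        is_potential D (fun r => zeta r + e * eta r)
          (fun r => f r + e * kappa r) (fun p => Phi (e, p)),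
      volume.-integrable (fluid D zeta) (EFin \o b)
    & forall e p, `|e| < e0 -> fluid D zeta p ->
        energy_density
          (fun q => 'D_((1 : R), (0 : R * R * R)) Phi (e, q)) p <= b p].

(* Smoothness and decay required of the state (zeta, phi) at one instant. *)
Definition regular_state D zeta phi : Prop :=
  [/\ Ck 1 D zeta,
      exists M : R, forall r, D r -> dot2 (grad2 zeta r) (grad2 zeta r) <= M,
      area.-integrable D (EFin \o (fun r => zeta r ^+ 2)),
      is_potential D zeta (hat zeta phi) phi
    & forall eta kappa, test_function D eta -> test_function D kappa ->
        smooth_variation D zeta (hat zeta phi) eta kappa].

Definition zeta_drift zeta phi (r : R * R) : R :=
  hat zeta (dz phi) r - dot2 (hat zeta (gradr phi) r) (grad2 zeta r).
Definition zeta_noise xi zeta (r : R * R) : R :=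
  (hat zeta xi r).2 - dot2 (hat zeta xi r).1 (grad2 zeta r).
Definition phi_drift (g : R) zeta phi (r : R * R) : R :=
  2^-1 * dot2 (hat zeta (gradr phi) r) (hat zeta (gradr phi) r)
  - 2^-1 * hat zeta (dz phi) r ^+ 2
  + hat zeta (dz phi) r * dot2 (hat zeta (gradr phi) r) (grad2 zeta r)
  + g * zeta r.
Definition phi_noise xi zeta phi (r : R * R) : R :=
  dot2 (hat zeta xi r).1 (hat zeta (gradr phi) r)
  + hat zeta (dz phi) r * dot2 (hat zeta xi r).1 (grad2 zeta r).

End water_waves.

Section stochastic.
Context {d : measure_display} {Omega : measurableType d} {R : realType}.
Context (P : probability Omega R).

(* The independence clause, over all pairs (i, k), contains both the
   independence of the increments and that of the W i. *)
Definition brownian_family (W : nat -> R -> {RV P >-> R}) : Prop :=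
  [/\ forall i, {ae P, forall w, W i 0 w = 0},
      forall i, {ae P, forall w, {within `[0, +oo[, continuous (W i ^~ w)}},
      forall i (s t : R) (B : set R), 0 <= s -> s < t -> measurable B ->
        P [set w | B (W i t w - W i s w)] = normal_prob 0 (Num.sqrt (t - s)) B
    & forall (m n : nat) (t : nat -> R) (B : nat -> nat -> set R),
        0 <= t 0%N -> (forall k, t k < t k.+1) ->
        (forall i k, measurable (B i k)) ->
        P [set w | forall i k, (i < m)%N -> (k < n)%N ->
                     B i k (W i (t k.+1) w - W i (t k) w)]
        = (\prod_(i < m) \prod_(k < n)
            P [set w | B i k (W i (t k.+1) w - W i (t k) w)%R])%E].

(* P [|X| > e] < e; the covering set A spares measurability assumptions on X. *)
Definition prob_small (e : R) (X : Omega -> R) : Prop :=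
  exists A : set Omega,
    [/\ measurable A, (P A < e%:E)%E & [set w | e < `|X w|] `<=` A].

Definition cvg_in_prob (X : nat -> Omega -> R) (Y : Omega -> R) : Prop :=
  forall e : R, 0 < e -> \forall n \near \oo,
    prob_small e (fun w => X n w - Y w).

Definition stratonovich_sum (Y W : R -> Omega -> R) (s : seq R) (w : Omega) : R :=
  \sum_(k < size s)
    (Y (nth 0 (0 :: s) k) w + Y (nth 0 s k) w) / 2
    * (W (nth 0 s k) w - W (nth 0 (0 :: s) k) w).

(* I = int_0^t Y o dW: limit in probability of the trapezoidal sums over the
   partitions 0 < s_0 < ... < s_(n-1) = t, as the mesh tends to 0. *)
Definition is_stratonovich (Y W : R -> Omega -> R) (t : R) (I : Omega -> R) : Prop :=
  forall e : R, 0 < e -> exists2 delta : R, 0 < delta &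
    forall s : seq R, itv_partition 0 t s ->
      (forall k, (k < size s)%N -> nth 0 s k - nth 0 (0 :: s) k < delta) ->
      prob_small e (fun w => stratonovich_sum Y W s w - I w).

(* dX = b dt + sum_i sigma_i o dW^i on [0, T], in integrated form; the series
   converges in probability. *)
Definition solves_sde (W : nat -> R -> {RV P >-> R}) (T : R)
    (X b : R -> Omega -> R) (sigma : nat -> R -> Omega -> R) : Prop :=
  forall t, 0 <= t <= T ->
  exists (I : nat -> {RV P >-> R}) (S : {RV P >-> R}),
  [/\ forall i, is_stratonovich (sigma i) (fun s w => W i s w) t (I i),
      cvg_in_prob (fun n w => \sum_(i < n) I i w) S
    & {ae P, forall w,
        lebesgue_measure.-integrable `[0, t] (EFin \o (b ^~ w)) /\
        X t w = X 0 w + \int[lebesgue_measure]_(s in `[0, t]) b s w + S w}].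

Section equations.
Context (W : nat -> R -> {RV P >-> R}) (T : R) (D : set (R * R)) (g : R).
Context (xi : nat -> R * R * R -> R * R * R).
Context (zeta : R -> Omega -> R * R -> R) (phi : R -> Omega -> R * R * R -> R).

Let phihat t w := hat (zeta t w) (phi t w).

Definition stochastic_water_waves : Prop :=
  forall r, D r ->
    solves_sde W T (fun t w => zeta t w r)
      (fun t w => zeta_drift (zeta t w) (phi t w) r)
      (fun i t w => zeta_noise (xi i) (zeta t w) r) /\
    solves_sde W T (fun t w => phihat t w r)
      (fun t w => - phi_drift g (zeta t w) (phi t w) r)
      (fun i t w => - phi_noise (xi i) (zeta t w) (phi t w) r).

Definition vderiv_zeta (H : (R * R -> R) -> (R * R -> R) -> R) t w : R * R -> R :=
  vderiv D (fun z => H z (phihat t w)) (zeta t w).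
Definition vderiv_phihat (H : (R * R -> R) -> (R * R -> R) -> R) t w : R * R -> R :=
  vderiv D (fun f => H (zeta t w) f) (phihat t w).

Definition canonical_hamiltonian_form : Prop :=
  forall r, D r ->
    solves_sde W T (fun t w => zeta t w r)
      (fun t w => vderiv_phihat (hamiltonian D g) t w r)
      (fun i t w => vderiv_phihat (noise_hamiltonian D (xi i)) t w r) /\
    solves_sde W T (fun t w => phihat t w r)
      (fun t w => - vderiv_zeta (hamiltonian D g) t w r)
      (fun i t w => - vderiv_zeta (noise_hamiltonian D (xi i)) t w r).

Definition has_vderivs (H : (R * R -> R) -> (R * R -> R) -> R) t w : Prop :=
  is_vderiv D (fun z => H z (phihat t w)) (zeta t w) (vderiv_zeta H t w) /\
  is_vderiv D (fun f => H (zeta t w) f) (phihat t w) (vderiv_phihat H t w).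

End equations.
End stochastic.

(* Main.v *)
Require Import Defs.
From HB Require Import structures.
From mathcomp Require Import all_boot all_order all_algebra.
From mathcomp Require Import all_classical all_reals all_analysis.
From mathcomp Require Import ring lra.
From mathcomp Require Import measurable_realfun lebesgue_integral_fubini.
Set Implicit Arguments.
Unset Strict Implicit.
Unset Printing Implicit Defensive.
Import Order.TTheory GRing.Theory Num.Theory numFieldNormedType.Exports.
Local Open Scope classical_set_scope.
Local Open Scope ring_scope.

(* [area] and [volume] are measures on products of [measurableTypeR R]; the
   sigma-algebra inferred on [R * R] is convertible to theirs but carries another
   display, which unification does not see through. *)
Notation R2 R := (measurableTypeR R * measurableTypeR R)%type.
Notation R3 R := (R2 R * measurableTypeR R)%type.
Notation measurable1 U := (@measurable _ (measurableTypeR _) U).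
Notation measurable2 U := (@measurable _ (R2 _) U).
Notation measurable3 U := (@measurable _ (R3 _) U).
Notation measurable_fun2 U f := (@measurable_fun _ _ (R2 _) _ U f).
Notation measurable_fun3 U f := (@measurable_fun _ _ (R3 _) _ U f).

(** * Measurability, Fubini and positivity for [area] and [volume] *)

Section vol.
Context {R : realType}.
Local Notation mu := (@lebesgue_measure R).

(** Two obstacles shape the proof. The boundary of [D] has no regularity, and [no_flux] only tests
    functions that vanish near the free surface. Green's formula with a surface term is therefore
    recovered by cutting [chi] off in a layer of thickness [delta] under the surface: the gradient
    of the cutoff is a vertical approximate identity that picks up the surface flux, and a Poincaré
    inequality across the layer absorbs its size [1 / delta]. The other obstacle is that both the
    domain and the harmonic potential depend on [zeta]. Along the variation [zeta + e * eta],
    [f + e * kappa], the displaced domain contributes [eta] times the surface value of the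
    integrand. The change of potential is a function on the fixed fluid, and Green's formula turns
    its integral into one over the surface; as its trace is prescribed on the displaced surface, on
    the old one it is [e * (kappa - eta * dz phi)] up to [o(e)]. The coefficients of the equations
    are the sums of these two contributions. Since [potential] is a choice, uniqueness of the
    gradient has to be proved before it can be replaced by a smooth family. *)

Lemma areaX (A B : set R) : measurable A -> measurable B ->
  area (A `*` B) = (mu A * mu B)%E.
Proof.
move=> mA mB.
exact: (@product_measure1E _ _ _ _ R mu mu A B mA mB).
Qed.

Let area_measure : {measure set (measurableTypeR R * measurableTypeR R)%type -> \bar R} :=
  lebesgue_integral_fubini.lebesgue_integral_fubini_product_measure1__canonical__measure_function_Measure mu mu.

Lemma area_sigma_finite : sigma_finite setT area_measure.
Proof.
have /sigma_finiteP[F [TF ndF Foo]] := sigma_finiteT mu.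
exists (fun n => F n `*` F n).
 rewrite -setXTT TF predeqE => -[x y]; split.
    move=> [/= [n _ Fnx] [k _ Gky]]; exists (maxn n k) => //; split.
    - by move: x Fnx; exact/subsetPset/ndF/leq_maxl.
    - by move: y Gky; exact/subsetPset/ndF/leq_maxr.
  by move=> [n _ []/= ? ?]; split; exists n.
move=> k; have [? ?] := Foo k; split; first exact: measurableX.
rewrite [X in (X < _)%E](areaX _ _)// lte_mul_pinfty// ge0_fin_numE//.
Qed.


(** Fubini's theorem for [volume] takes [area] as one factor, which must then be bundled as a
    sigma-finite measure. *)
Definition area_sfm : {sigma_finite_measure set (measurableTypeR R * measurableTypeR R)%type -> \bar R} :=
  HB.pack (Measure.sort area_measure) (Measure.class area_measure) (Measure_isSigmaFinite.Build _ _ _ area_measure area_sigma_finite).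

Local Notation mR := (measurableTypeR R).

Lemma tonelli_volume (f : R * R * R -> R) : measurable_fun3 setT f ->
  (forall x, 0 <= f x) ->
  (\int[volume]_p (f p)%:E = \int[area]_r \int[mu]_z (f (r, z))%:E)%E.
Proof.
move=> mf f0.
apply: (@fubini_tonelli1 _ _ _ _ R area_sfm mu (EFin \o f)).
  exact/measurable_EFinP.
by move=> x; rewrite lee_fin.
Qed.

Lemma fubini_volume (f : R * R * R -> R) : volume.-integrable setT (EFin \o f) ->
  (\int[volume]_p (f p)%:E = \int[area]_r \int[mu]_z (f (r, z))%:E)%E.
Proof.
move=> H; apply/esym.
exact: (@integral12_prod_meas1 _ _ _ _ R area_sfm mu _ H). Qed.

Lemma tonelli_volume_in (f : R * R * R -> R) (A : set (R * R * R)) :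
  measurable3 A -> measurable_fun3 A f -> (forall p, A p -> 0 <= f p) ->
  (\int[volume]_(p in A) (f p)%:E = \int[area]_r \int[mu]_z ((f \_ A) (r, z))%:E)%E.
Proof.
move=> mA mf f0. rewrite integral_mkcond restrict_EFin.
rewrite [LHS]tonelli_volume //.
by apply/(measurable_restrictT _ mA).
move=> x. rewrite patchE; case: ifPn => //. rewrite inE. apply f0.
Qed.

Lemma fubini_volume_in (f : R * R * R -> R) (A : set (R * R * R)) :
  measurable3 A -> volume.-integrable A (EFin \o f) ->
  (\int[volume]_(p in A) (f p)%:E = \int[area]_r \int[mu]_z ((f \_ A) (r, z))%:E)%E.
Proof.
move=> mA mf. rewrite integral_mkcond restrict_EFin.
rewrite [LHS]fubini_volume //.
rewrite -restrict_EFin.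
by rewrite -integrable_mkcond.
Qed.

Lemma volumeX (A B C : set R) : measurable A -> measurable B -> measurable C ->
  volume (A `*` B `*` C) = (mu A * mu B * mu C)%E.
Proof.
move=> mA mB mC.
have H := @product_measure1E _ _ _ _ R area_sfm mu (A `*` B) C (measurableX mA mB) mC.
rewrite [LHS]H; congr (_ * _)%E.
exact: (@product_measure1E _ _ _ _ R mu mu A B mA mB).
Qed.

Definition obox (a b : R * R * R) : set (R * R * R) :=
  `]a.1.1, b.1.1[ `*` `]a.1.2, b.1.2[ `*` `]a.2, b.2[.

Definition ratr3 (q : rat * rat * rat) : R * R * R :=
  (ratr q.1.1, ratr q.1.2, ratr q.2).

Lemma measurable_obox (a b : R * R * R) : measurable3 (obox a b).
Proof. by apply: measurableX; [apply: measurableX|]. Qed.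

Lemma open_obox_rat (U : set (R * R * R)) (p : R * R * R) : open U -> U p ->
  exists q : (rat * rat * rat) * (rat * rat * rat),
    obox (ratr3 q.1) (ratr3 q.2) p /\ obox (ratr3 q.1) (ratr3 q.2) `<=` U.
Proof.
move=> oU Up.
have : nbhs p U by exact: open_nbhs_nbhs.
move=> /nbhs_ballP[e /= e0 eU].
have rat1 (x : R) : exists q : rat * rat,
    [/\ x - e < ratr q.1, ratr q.1 < x, x < ratr q.2 & ratr q.2 < x + e].
  have [q1] : exists q, ratr q \in `]x - e, x[ by apply: rat_in_itvoo; lra.
  have [q2] : exists q, ratr q \in `]x, x + e[ by apply: rat_in_itvoo; lra.
  rewrite !in_itv /= => /andP[? ?] /andP[? ?].
  by exists (q1, q2).
have [q1 [a1 a2 a3 a4]] := rat1 p.1.1.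
have [q2 [b1 b2 b3 b4]] := rat1 p.1.2.
have [q3 [c1 c2 c3 c4]] := rat1 p.2.
exists ((q1.1, q2.1, q3.1), (q1.2, q2.2, q3.2)); split.
  by rewrite /obox /=; do !split => /=; rewrite in_itv /=; apply/andP.
move=> x; rewrite /obox /= !in_itv /= => -[[/andP[? ?] /andP[? ?]] /andP[? ?]].
by apply: eU; do !split; rewrite /= /ball /= ltr_distlC; apply/andP; split; lra.
Qed.

Lemma open_measurable3 (U : set (R * R * R)) : open U -> measurable3 U.
Proof.
move=> oU.
(* The sigma-algebra is generated by products, not by open sets, so [U] is written as a countable
   union of boxes with rational corners. *)
have -> : U = \bigcup_(q : (rat * rat * rat) * (rat * rat * rat))
    (if pselect (obox (ratr3 q.1) (ratr3 q.2) `<=` U)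
     then obox (ratr3 q.1) (ratr3 q.2) else set0).
  apply/seteqP; split => [p Up|p [q _]].
    have [q [qp qU]] := open_obox_rat oU Up.
    by exists q => //; case: pselect.
  by case: pselect => // h; exact: h.
apply: countable_bigcupT_measurable => // q.
by case: pselect => [?|?]; [exact: measurable_obox|exact: measurable0].
Qed.

(** [U] is the section at height 0 of the open cylinder over it, which is already known to be
    measurable. *)
Lemma open_measurable2 (U : set (R * R)) : open U -> measurable2 U.
Proof.
move=> oU.
have mU : measurable3 (U `*` (setT : set R)).
  apply: open_measurable3; rewrite (_ : _ `*` _ = fst @^-1` U).
    by apply: open_comp => // x _; exact: cvg_fst.
  by apply/seteqP; split => x; [case|].
have mp : @measurable_fun _ _ (R2 R) (R3 R) setT (fun r => (r, 0 : R)).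
  by apply: measurable_fun_pair; [exact: measurable_id|exact: measurable_cst].
have := mp measurableT _ mU; rewrite setTI.
by congr measurable; apply/seteqP; split => [x []|x].
Qed.

Lemma continuous_measurable_fun3 (U : set (R * R * R)) (f : R * R * R -> R) :
  open U -> (forall p, U p -> {for p, continuous f}) -> measurable_fun3 U f.
Proof.
move=> oU cf; apply: (measurability _ (RGenOpens.measurableE R)).
move=> _ [_ [a [b ->] <-]].
  apply: (@open_measurable3 (U `&` f @^-1` `]a, b[)).
rewrite openE => p [Up fp] /=.
rewrite /interior; apply: filterI; first exact: open_nbhs_nbhs.
by apply: (cf p Up); apply: open_nbhs_nbhs; split => //; exact: interval_open.
Qed.

Lemma continuous_measurable_fun2 (U : set (R * R)) (f : R * R -> R) :
  open U -> (forall p, U p -> {for p, continuous f}) -> measurable_fun2 U f.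
Proof.
move=> oU cf; apply: (measurability _ (RGenOpens.measurableE R)).
move=> _ [_ [a [b ->] <-]].
  apply: (@open_measurable2 (U `&` f @^-1` `]a, b[)).
rewrite openE => p [Up fp] /=.
rewrite /interior; apply: filterI; first exact: open_nbhs_nbhs.
by apply: (cf p Up); apply: open_nbhs_nbhs; split => //; exact: interval_open.
Qed.

Lemma open_volume_gt0 (U : set (R * R * R)) (p : R * R * R) :
  open U -> U p -> (0 < volume U)%E.
Proof.
move=> oU Up; have [q [qp qU]] := open_obox_rat oU Up.
apply: (@lt_le_trans _ _ (volume (obox (ratr3 q.1) (ratr3 q.2)))); last first.
  by apply: le_measure => //; rewrite inE; [exact: measurable_obox|exact: open_measurable3].
move: qp; rewrite /obox /= !in_itv /= => -[[/andP[a b] /andP[c d]] /andP[e f]].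
rewrite volumeX // !lebesgue_measure_itv /= !lte_fin.
rewrite (lt_trans a b) (lt_trans c d) (lt_trans e f) -!EFinD -!EFinM lte_fin.
by rewrite !mulr_gt0 // subr_gt0; [exact: lt_trans a b|exact: lt_trans c d|exact: lt_trans e f].
Qed.

(** The cylinder of height one over [U] is open, and its volume is the area of [U]. *)
Lemma open_area_gt0 (U : set (R * R)) (p : R * R) :
  open U -> U p -> (0 < area U)%E.
Proof.
move=> oU Up.
have oU3 : open (U `*` `]0 : R, 1[).
  rewrite (_ : _ `*` _ = (fst @^-1` U) `&` (snd @^-1` `]0 : R, 1[)); last first.
    by apply/seteqP; split => x; case.
  apply: openI; first by apply: open_comp => // x _; exact: cvg_fst.
  by apply: open_comp => [x _|]; [exact: cvg_snd|exact: interval_open].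
have /(open_volume_gt0 oU3) : (U `*` `]0 : R, 1[) (p, 2^-1).
  by split => //=; rewrite in_itv /=; apply/andP; split; lra.
have -> : volume (U `*` `]0 : R, 1[) = (area U * mu (`]0%R, 1%R[%classic : set R))%E.
  by apply: (@product_measure1E _ _ _ _ R area_sfm mu) => //; exact: open_measurable2.
by rewrite lebesgue_measure_itv /= lte_fin ltr01 oppr0 adde0 mule1.
Qed.

End vol.

(** * Integrals of real-valued functions *)

Section real_integral.
Context d (T : measurableType d) {R : realType}.
Variable mu : {measure set T -> \bar R}.
Implicit Types (A B : set T) (f g : T -> R).

Lemma integrable_le A f g : measurable A -> measurable_fun A f ->
  (forall x, A x -> `|f x| <= g x) -> mu.-integrable A (EFin \o g) ->
  mu.-integrable A (EFin \o f).
Proof.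
move=> mA mf fg; apply: le_integrable => //; first exact/measurable_EFinP.
by move=> x Ax /=; rewrite lee_fin (le_trans (fg _ Ax)) // ler_norm.
Qed.

Lemma eq_integrable_EFin A f g : measurable A -> (forall x, A x -> f x = g x) ->
  mu.-integrable A (EFin \o f) -> mu.-integrable A (EFin \o g).
Proof.
by move=> mA fg; apply: eq_integrable => // x; rewrite inE => /fg /= ->.
Qed.

Lemma integrableD_EFin A f g : measurable A -> mu.-integrable A (EFin \o f) ->
  mu.-integrable A (EFin \o g) ->
  mu.-integrable A (EFin \o (fun x => f x + g x)).
Proof. by move=> mA fi gi; exact: (integrableD mA fi gi). Qed.

Lemma integrableB_EFin A f g : measurable A -> mu.-integrable A (EFin \o f) ->
  mu.-integrable A (EFin \o g) ->
  mu.-integrable A (EFin \o (fun x => f x - g x)).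
Proof. by move=> mA fi gi; exact: (integrableB mA fi gi). Qed.

Lemma integrableZ_EFin A k f : measurable A -> mu.-integrable A (EFin \o f) ->
  mu.-integrable A (EFin \o (fun x => k * f x)).
Proof. by move=> mA fi; exact: (integrableZl mA k fi). Qed.

Lemma integrable_measurable A f :
  mu.-integrable A (EFin \o f) -> measurable_fun A f.
Proof. by move=> /integrableP[/measurable_EFinP]. Qed.

Lemma le_norm_Rintegral A f g : measurable A -> measurable_fun A f ->
  (forall x, A x -> `|f x| <= g x) -> mu.-integrable A (EFin \o g) ->
  `|\int[mu]_(x in A) f x| <= \int[mu]_(x in A) g x.
Proof.
move=> mA mf fg gi; have fi := integrable_le mA mf fg gi.
apply: le_trans (le_normr_Rintegral mA fi) _.
by apply: le_Rintegral => //; exact: integrable_norm.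
Qed.

Lemma Rintegral_subset A B f : B `<=` A -> (forall x, A x -> ~ B x -> f x = 0) ->
  \int[mu]_(x in A) f x = \int[mu]_(x in B) f x.
Proof.
move=> BA f0; rewrite (Rintegral_mkcond _ A) (Rintegral_mkcond _ B).
apply: eq_Rintegral => x _; rewrite !patchE.
case: (boolP (x \in A)) => [|/negP]; rewrite inE => Ax;
  case: (boolP (x \in B)) => [|/negP]; rewrite inE => Bx //; first exact: f0.
by have := BA _ Bx.
Qed.

Lemma integrable_subset A B f : measurable A -> measurable B -> B `<=` A ->
  (forall x, A x -> ~ B x -> f x = 0) ->
  mu.-integrable B (EFin \o f) -> mu.-integrable A (EFin \o f).
Proof.
move=> mA mB BA f0.
rewrite (integrable_mkcond _ mA) (integrable_mkcond _ mB).
apply: eq_integrable => // x _; rewrite !patchE /=.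
case: (boolP (x \in A)) => [|/negP]; rewrite inE => Ax;
  case: (boolP (x \in B)) => [|/negP]; rewrite inE => Bx //; first by rewrite f0.
by have := BA _ Bx.
Qed.

Lemma measurable_fun_zero_outside A B f : measurable A -> measurable B -> B `<=` A ->
  (forall x, A x -> ~ B x -> f x = 0) -> measurable_fun B f -> measurable_fun A f.
Proof.
move=> mA mB BA f0 mf.
apply: (@eq_measurable_fun _ _ _ _ _ (f \_ B)).
  move=> x; rewrite inE patchE => Ax.
  by case: ifPn => // /negP; rewrite inE => Bx; rewrite f0.
by apply: measurable_funTS; exact/(measurable_restrictT _ mB).
Qed.

(** Dominated convergence for the restrictions of [f]; the sets [S n] will be ever thinner strips
    under the surface. *)
Lemma shrinking_integral_cvg0 A f (S : nat -> set T) : measurable A ->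
  (forall n, measurable (S n)) -> (forall n, S n `<=` A) ->
  (forall x, A x -> \forall n \near \oo, ~ S n x) ->
  mu.-integrable A (EFin \o f) ->
  (fun n => \int[mu]_(x in S n) f x) @ \oo --> (0 : R).
Proof.
move=> mA mS SA S0 fi.
have mf := integrable_measurable fi.
pose f_ n := (f \_ (S n)).
have E n : \int[mu]_(x in S n) f x = \int[mu]_(x in A) f_ n x.
  rewrite Rintegral_mkcond (Rintegral_mkcond _ A); apply: eq_Rintegral => x _.
  rewrite /f_ !patchE; case: (boolP (x \in S n)) => [|/negP]; rewrite inE => Sx;
    case: (boolP (x \in A)) => [|/negP]; rewrite inE => Ax //.
  by have := SA _ _ Sx.
have mf_ n : measurable_fun A (f_ n).
  apply: measurable_funTS; apply/(measurable_restrictT _ (mS n)).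
  exact: measurable_funS mf.
have [] := @dominated_convergence _ _ _ mu A mA (fun n => EFin \o f_ n)
  (cst 0%E) (EFin \o (Num.norm \o f)) _ _ _ _ _.
- by move=> n; exact/measurable_EFinP.
- exact: measurable_cst.
- apply/aeW => x Ax; apply: cvg_near_cst; near=> n.
  rewrite /f_ /= patchE ifF //; apply/negbTE/negP; rewrite inE.
  by near: n; exact: S0.
- exact: integrable_norm.
- apply/aeW => x n Ax; rewrite /f_ /= patchE lee_fin; case: ifPn => // _.
  by rewrite normr0.
move=> _ _ /=; rewrite integral0 => /fine_cvg.
rewrite (_ : fine \o _ = (fun n => \int[mu]_(x in S n) f x)) //.
by apply/funext => n /=; rewrite E.
Unshelve. all: by end_near. Qed.

End real_integral.

(** * Kernels concentrated near the surface *)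

Section column_integrals.
Context {R : realType}.
Local Notation mu := (@lebesgue_measure R).
Implicit Types (D K : set (R * R)) (F k : R * R * R -> R).

Lemma open_column D : open D -> open (column D).
Proof. by move=> oD; apply: open_comp => // x _; exact: cvg_fst. Qed.

Lemma measurable_column D : open D -> measurable3 (column D).
Proof. by move=> oD; apply: open_measurable3; exact: open_column. Qed.

Lemma measurable_fun_horizontal D (a : R * R -> R) :
  open D -> measurable_fun2 D a -> measurable_fun3 (column D) (fun p => a p.1).
Proof.
move=> oD ma.
apply: (@measurable_comp _ _ _ (R3 R) (R2 R) _ D (a : R * R -> R) (column D) fst) => //.
- exact: open_measurable2.
- by move=> _ [p Dp <-].
- by apply: measurable_funTS; exact: measurable_fst.
Qed.

(** Tonelli reduces the norm of [k] to its vertical masses, which vanish off [K]. *)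
Lemma kernel_L1 D K k (A : R) : open D -> measurable2 K -> K `<=` D ->
  (area K < +oo)%E ->
  measurable_fun3 (column D) k -> 0 <= A ->
  (forall p, D p.1 -> k p != 0 -> K p.1) ->
  (forall r, K r -> (\int[mu]_z (`|k (r, z)|)%:E <= A%:E)%E) ->
  volume.-integrable (column D) (EFin \o k) /\
  \int[volume]_(p in column D) `|k p| <= A * fine (area K).
Proof.
move=> oD mK KD Kfin mk A0 kK kA.
have mC := measurable_column oD.
have mnk : measurable_fun3 (column D) (fun p => `|k p|) by exact: measurableT_comp.
have bound : (\int[volume]_(p in column D) (`|k p|)%:E <= (A * fine (area K))%:E)%E.
  rewrite tonelli_volume_in //.
  apply: (@le_trans _ _ (\int[area]_(r in K) (cst A r)%:E)%E).
    rewrite [leRHS]integral_mkcond.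
    apply: ge0_le_integral => //.
    - by move=> r _; apply: integral_ge0 => z _; rewrite lee_fin patchE; case: ifPn.
    - apply: (@measurable_fun_fubini_tonelli_F _ _ _ _ R mu
        (EFin \o ((fun p => `|k p|) \_ (column D)))).
        apply/measurable_EFinP.
        exact/(measurable_restrictT _ mC).
      by move=> x /=; rewrite lee_fin patchE; case: ifPn.
    - apply/(measurable_restrictT _ mK).
      by apply/measurable_EFinP; exact: measurable_cst.
    - move=> r _; rewrite patchE; case: ifPn => [|/negP]; rewrite inE => Kr.
        apply: le_trans (kA _ Kr); rewrite le_eqVlt; apply/orP; left; apply/eqP.
        apply: eq_integral => z _; rewrite patchE ifT // inE.
        exact: (KD _ Kr).
      rewrite integral0_eq // => z _; rewrite patchE; case: ifPn => //.
      rewrite inE => Dr; apply/eqP; rewrite eqe normr_eq0; apply/negPn/negP => k0.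
      exact/Kr/(kK _ Dr k0).
  have -> : (\int[area]_(r in K) (cst A r)%:E = A%:E * area K)%E.
    by rewrite -integral_cst.
  by rewrite EFinM fineK // ge0_fin_numE.
split.
  apply/integrableP; split; first exact/measurable_EFinP.
  by apply: le_lt_trans bound _; rewrite ltry.
rewrite /Rintegral -lee_fin fineK //.
by rewrite ge0_fin_numE ?integral_ge0 // (le_lt_trans bound) // ltry.
Qed.


(** The kernel [k] acts as [a] times a vertical Dirac mass placed where [F] is close to [Fh]. It
    serves twice: with the trace times the derivative of the cutoff, for Green's formula, and with
    the difference of the indicators of two fluids, for a moving surface. *)
Lemma kernel_estimate D K F k (Fh a : R * R -> R) (A B eps : R) :
  open D -> measurable2 K -> K `<=` D -> (area K < +oo)%E ->
  measurable_fun3 (column D) F -> measurable_fun3 (column D) k ->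
  measurable_fun2 D Fh -> measurable_fun2 D a -> 0 <= A -> 0 <= eps ->
  (forall p, D p.1 -> k p != 0 -> K p.1 /\ `|F p - Fh p.1| <= eps) ->
  (forall r, K r -> `|Fh r| <= B) -> (forall r, K r -> `|a r| <= A) ->
  (forall r, K r -> (\int[mu]_z (`|k (r, z)|)%:E <= A%:E)%E) ->
  (forall r, K r -> (\int[mu]_z (k (r, z))%:E = (a r)%:E)%E) ->
  (forall r, D r -> ~ K r -> a r = 0) ->
  [/\ volume.-integrable (column D) (EFin \o (fun p => k p * F p)),
     area.-integrable D (EFin \o (fun r => a r * Fh r)) &
     `|\int[volume]_(p in column D) (k p * F p) - \int[area]_(r in D) (a r * Fh r)|
       <= eps * (A * fine (area K))].
Proof.
move=> oD mK KD Kfin mF mk mFh ma A0 eps0 kF Fhb aA kA ka a0.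
have mC := measurable_column oD; have mD := open_measurable2 oD.
have [ki kL] := kernel_L1 oD mK KD Kfin mk A0 (fun p Dp kp => (kF p Dp kp).1) kA.
have nki : volume.-integrable (column D) (EFin \o (fun p => `|k p|)).
  exact: integrable_norm.
have kKz r z : D r -> ~ K r -> k (r, z) = 0.
  move=> Dr Kr; apply/eqP/negPn/negP => k0; exact/Kr/(kF (r, z) Dr k0).1.
have mkFh : measurable_fun3 (column D) (fun p => k p * Fh p.1).
  by apply: measurable_funM => //; exact: measurable_fun_horizontal.
have kFhi : volume.-integrable (column D) (EFin \o (fun p => k p * Fh p.1)).
  apply: (integrable_le mC mkFh _ (integrableZ_EFin B mC nki)).
  move=> p Dp; rewrite normrM mulrC.
  have [->|k0] := eqVneq (k p) 0; first by rewrite normr0 !mulr0.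
  by rewrite ler_wpM2r // Fhb //; exact: (kF p Dp k0).1.
have kdi : volume.-integrable (column D) (EFin \o (fun p => eps * `|k p|)).
  exact: integrableZ_EFin.
have dle p : column D p -> `|k p * F p - k p * Fh p.1| <= eps * `|k p|.
  move=> Dp; rewrite -mulrBr normrM mulrC.
  have [->|k0] := eqVneq (k p) 0; first by rewrite normr0 !mulr0.
  by rewrite ler_wpM2r //; exact: (kF p Dp k0).2.
have mkF : measurable_fun3 (column D) (fun p => k p * F p) by exact: measurable_funM.
have md : measurable_fun3 (column D) (fun p => k p * F p - k p * Fh p.1).
  exact: measurable_funB.
have di := integrable_le mC md dle kdi.
have kFi : volume.-integrable (column D) (EFin \o (fun p => k p * F p)).
  apply: eq_integrable_EFin (integrableD_EFin mC di kFhi) => // p _ /=.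
  by rewrite subrK.
have aFhi : area.-integrable D (EFin \o (fun r => a r * Fh r)).
  apply: (integrable_subset mD mK KD).
    by move=> r Dr Kr; rewrite a0 // mul0r.
  apply: (measurable_bounded_integrable mK Kfin).
    by apply: measurable_funS mD KD _; exact: measurable_funM.
  exists (A * B); split; first exact: num_real.
  move=> M AM r Kr /=; rewrite normrM (le_trans _ (ltW AM)) //.
  by rewrite ler_pM // ?aA ?Fhb.
split => //.
(* Integrating vertically first, [k] tested against a function of [r] alone gives [a] exactly; the
   only error is that of replacing [F] by [Fh]. *)
have <- : \int[volume]_(p in column D) (k p * Fh p.1) = \int[area]_(r in D) (a r * Fh r).
  congr fine; rewrite fubini_volume_in // [RHS]integral_mkcond.
  apply: eq_integral => r _; rewrite patchE; case: ifPn => [|/negP]; rewrite inE => Dr; last first.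
    by rewrite integral0_eq // => z _; rewrite patchE ifF //; apply/negbTE/negP; rewrite inE.
  have [Kr|Kr] := pselect (K r); last first.
    rewrite a0 // mul0r integral0_eq // => z _; rewrite patchE; case: ifPn => // _.
    by rewrite kKz // mul0r.
  transitivity (\int[mu]_z ((k (r, z))%:E * (Fh r)%:E))%E.
    by apply: eq_integral => z _; rewrite patchE ifT ?inE.
  rewrite integralZr //; first by rewrite ka.
  apply/integrableP; split; last by apply: le_lt_trans (kA _ Kr) _; rewrite ltry.
  apply/measurable_EFinP.
  have /measurable_fun_pair2 -/(_ r) : measurable_fun3 setT (k \_ (column D)).
    exact/(measurable_restrictT _ mC).
  by apply: eq_measurable_fun => z _; rewrite patchE ifT // inE.
rewrite -RintegralB //.
apply: le_trans (le_norm_Rintegral mC md dle kdi) _.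
by rewrite RintegralZl // ler_wpM2l.
Qed.

End column_integrals.

(** * Derivatives along affine paths and basic facts on [Ck] *)

Section paths.
Context {R : realType} {V : normedModType R}.
Implicit Types (f : V -> R) (U : set V).

(** Affineness of [gam] is stated as a functional equation, so that it applies directly to paths
    written as pairs. *)
Lemma is_derive_path f (gam : R -> V) (v : V) (t : R) :
  (forall h, gam (h + t) = h *: v + gam t) -> derivable f (gam t) v ->
  is_derive t 1 (f \o gam) ('D_v f (gam t)).
Proof.
move=> gamE fv.
have E : (fun h : R => h^-1 *: ((f \o gam) (h *: (1 : R) + t) - (f \o gam) t))
       = (fun h => h^-1 *: (f (h *: v + gam t) - f (gam t))).
  by apply/funext => h; rewrite /= [h *: 1]mulr1 gamE.
by split; rewrite /derivable /derive /= E.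
Qed.

Lemma Ck_differentiable k U f x : Ck k.+1 U f -> U x -> differentiable f x.
Proof. by case=> + _; exact. Qed.

Lemma Ck_continuous k U f x : Ck k U f -> U x -> {for x, continuous f}.
Proof.
case: k => [|k]; first exact.
by move=> Cf Ux; apply: differentiable_continuous; exact: Ck_differentiable Cf Ux.
Qed.

Lemma CkW k U f : Ck k.+1 U f -> Ck k U f.
Proof.
elim: k f => [|k IH] f Cf; first by move=> x; exact: Ck_continuous Cf.
by case: Cf => df Cdf; split => // v; exact: IH.
Qed.

Lemma open_setI_preimage {T W : topologicalType} (A : set T) (B : set W) (f : T -> W) :
  open A -> (forall x, A x -> {for x, continuous f}) -> open B ->
  open (A `&` f @^-1` B).
Proof.
move=> oA cf oB; rewrite openE => x [Ax Bfx]; rewrite /interior; apply: filterI.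
  exact: open_nbhs_nbhs.
by apply: (cf x Ax); exact: open_nbhs_nbhs.
Qed.

Lemma continuous_pair_at {T U W : topologicalType} (f : T -> U) (g : T -> W) (x : T) :
  {for x, continuous f} -> {for x, continuous g} ->
  {for x, continuous (fun y => (f y, g y))}.
Proof. by move=> cf cg; exact: (cvg_pair cf cg). Qed.

Lemma continuous_mulr_at {T : topologicalType} (f g : T -> R) x :
  {for x, continuous f} -> {for x, continuous g} -> {for x, continuous (fun y => f y * g y)}.
Proof. by move=> cf cg; exact: (cvgM cf cg). Qed.

Lemma continuous_addr_at {T : topologicalType} (f g : T -> R) x :
  {for x, continuous f} -> {for x, continuous g} -> {for x, continuous (fun y => f y + g y)}.
Proof. by move=> cf cg; exact: (cvgD cf cg). Qed.

Lemma continuous_subr_at {T : topologicalType} (f g : T -> R) x :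
  {for x, continuous f} -> {for x, continuous g} -> {for x, continuous (fun y => f y - g y)}.
Proof. by move=> cf cg; exact: (cvgB cf cg). Qed.

Lemma continuous_cst_at {T : topologicalType} (c : R) (x : T) : {for x, continuous (fun=> c)}.
Proof. exact: cvg_cst. Qed.

End paths.

(** * The Poincaré inequality in a strip under the surface *)

Section poincare.
Context {R : realType}.
Local Notation mu := (@lebesgue_measure R).

Lemma poincare_itv (u du : R -> R) (b delta : R) : 0 < delta ->
  (forall z, is_derive z (1 : R) u (du z)) -> continuous du -> u b = 0 ->
  (\int[mu]_(z in `](b - delta)%R, b[) (u z ^+ 2)%:E <=
   (delta ^+ 2)%:E * \int[mu]_(z in `](b - delta)%R, b[) (du z ^+ 2)%:E)%E.
Proof.
move=> d0 uP cdu ub.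
have cu : continuous u.
  by move=> z; apply: differentiable_continuous; apply/derivable1_diffP; case: (uP z).
have int_cont (f : R -> R) x y : continuous f ->
    mu.-integrable `[x, y] (EFin \o f).
  move=> cf; apply: continuous_compact_integrable; first exact: segment_compact.
  exact: continuous_subspaceT.
have cdu2 : continuous (fun z => du z ^+ 2) by move=> z; apply: continuousM; exact: cdu.
pose J := \int[mu]_(z in `[b - delta, b]) (du z ^+ 2).
have J0 : 0 <= J by apply: Rintegral_ge0 => z _; exact: sqr_ge0.
have pw z : z \in `]b - delta, b[ -> u z ^+ 2 <= delta * J.
  rewrite in_itv /= => /andP[bz zb].
  have bz0 : 0 < b - z by lra.
  have ftc : \int[mu]_(t in `[z, b]) du t = - u z.
    have Fb : derivable_oo_LRcontinuous u z b.
      split; first by move=> t _; case: (uP t).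
        by apply: cvg_at_right_filter; exact: cu.
      by apply: cvg_at_left_filter; exact: cu.
    rewrite /Rintegral (continuous_FTC2 zb _ Fb) ?ub ?sub0e //.
      exact: continuous_subspaceT.
    by move=> t _; rewrite derive1E; case: (uP t).
  pose I2 := \int[mu]_(t in `[z, b]) (du t ^+ 2).
  (* As [u] vanishes at [b], the mean of [du] over [[z, b]] is [- c]. Expanding the integral of
     [(du + c) ^+ 2], which is nonnegative, yields the Cauchy-Schwarz bound on [u z ^+ 2]. *)
  pose c := u z / (b - z).
  have i2 := int_cont _ z b cdu2.
  have mI : measurable1 [set` `[z, b]] by exact: measurable_itv.
  have i1 := integrableZ_EFin (2 * c) mI (int_cont _ z b cdu).
  have i0 : mu.-integrable `[z, b] (EFin \o cst (c ^+ 2)).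
    by apply: int_cont => t; exact: cvg_cst.
  have : 0 <= \int[mu]_(t in `[z, b]) (du t ^+ 2 + 2 * c * du t + c ^+ 2).
    apply: Rintegral_ge0 => t _.
    by rewrite (_ : _ + _ = (du t + c) ^+ 2) ?sqr_ge0 //; ring.
  rewrite RintegralD //; last exact: integrableD_EFin.
  rewrite RintegralD // RintegralZl //; last exact: int_cont.
  have -> : \int[mu]_(t in `[z, b]) (c ^+ 2) = c ^+ 2 * (b - z).
    rewrite Rintegral_cst //; congr (_ * _).
    by have := lebesgue_measure_itv `[z, b]; rewrite /= lte_fin zb => ->.
  rewrite ftc.
  rewrite (_ : _ + _ = I2 - u z ^+ 2 / (b - z)); last first.
    by rewrite /c -/I2; field; rewrite gt_eqF.
  rewrite subr_ge0 ler_pdivrMr // => h.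
  have I2J : I2 <= J.
    rewrite /I2 /J /Rintegral fine_le //.
    - exact/integrable_fin_num/int_cont.
    - exact/integrable_fin_num/int_cont.
    apply: ge0_subset_integral => //.
    - by apply/measurable_EFinP; apply: measurable_funTS; exact: continuous_measurable_fun.
    - by move=> t _; rewrite lee_fin sqr_ge0.
    by move=> t /=; rewrite !in_itv /= => /andP[? ->]; rewrite andbT; lra.
  apply: le_trans h _; rewrite mulrC ler_pM //; first exact: ltW.
    by apply: Rintegral_ge0 => t _; exact: sqr_ge0.
  by lra.
apply: (@le_trans _ _ (\int[mu]_(z in `](b - delta)%R, b[) (cst (delta * J)%:E z))%E).
  apply: ge0_le_integral => //.
  - by move=> z _; rewrite lee_fin sqr_ge0.
  - apply/measurable_EFinP; apply: measurable_funTS; apply: continuous_measurable_fun.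
    by move=> z; apply: continuousM; exact: cu.
have -> : (\int[mu]_(z in `](b - delta)%R, b[) (cst (delta * J)%:E z) = (delta * J * delta)%:E)%E.
  rewrite (integral_cst mu _ (delta * J)%:E) //.
  have := lebesgue_measure_itv `]b - delta, b[; rewrite /= lte_fin ltrBlDr ltrDl d0 => ->.
  by rewrite -EFinD -EFinM; congr (_ * _)%:E; ring.
have -> : (\int[mu]_(z in `](b - delta)%R, b[) (du z ^+ 2)%:E = J%:E)%E.
  rewrite /J /Rintegral fineK; last by apply: integrable_fin_num => //; exact: int_cont.
  rewrite [RHS]integral_itv_bndoo //.
  by apply/measurable_EFinP; apply: measurable_funTS; exact: continuous_measurable_fun.
by rewrite -EFinM lee_fin le_eqVlt; apply/orP; left; apply/eqP; ring.
Qed.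


Definition strip (D : set (R * R)) (zeta : R * R -> R) (delta : R) : set (R * R * R) :=
  [set p | D p.1 /\ zeta p.1 - delta < p.2 < zeta p.1].

Lemma continuous_depth D (zeta : R * R -> R) p : (forall r, D r -> {for r, continuous zeta}) ->
  column D p -> {for p, continuous (fun q => zeta q.1 - q.2)}.
Proof.
move=> cz Dp; apply: (@continuousB _ _ _ (zeta \o fst) snd); last exact: cvg_snd.
by apply: continuous_comp; [exact: cvg_fst|exact: cz].
Qed.

Lemma open_fluid D (zeta : R * R -> R) : open D ->
  (forall r, D r -> {for r, continuous zeta}) -> open (fluid D zeta).
Proof.
move=> oD cz.
rewrite (_ : fluid _ _ = column D `&` (fun q => zeta q.1 - q.2) @^-1` `]0, +oo[).
  apply: open_setI_preimage; first exact: open_column.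
    by move=> p Dp; exact: continuous_depth Dp.
  exact: interval_open.
by apply/seteqP; split => p [Dp] /=; rewrite in_itv /= andbT subr_gt0.
Qed.

Lemma open_strip D (zeta : R * R -> R) delta : open D ->
  (forall r, D r -> {for r, continuous zeta}) -> open (strip D zeta delta).
Proof.
move=> oD cz.
rewrite (_ : strip _ _ _ = column D `&` (fun q => zeta q.1 - q.2) @^-1` `]0, delta[).
  apply: open_setI_preimage; first exact: open_column.
    by move=> p Dp; exact: continuous_depth Dp.
  exact: interval_open.
by apply/seteqP; split => p [Dp] /=; rewrite in_itv /= => /andP[? ?]; split => //;
  apply/andP; split; lra.
Qed.

Lemma is_derive_vertical D (chi : R * R * R -> R) r z : Ck 1 (column D) chi -> D r ->
  is_derive z (1 : R) (fun z => chi (r, z)) (dz chi (r, z)).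
Proof.
move=> Cchi Dr; apply: (@is_derive_path _ _ chi (fun z => (r, z)) ez z).
  by move=> h; rewrite /ez; congr (_, _) => /=; rewrite ?[_ *: 1]mulr1 // scaler0 add0r.
by apply: diff_derivable; exact: (Ck_differentiable Cchi).
Qed.

(** The one-dimensional inequality on each vertical segment, for [chi] minus its surface value, then
    Tonelli. The integrals are extended ones because integrability of the left-hand side will be
    deduced from this bound. *)
Lemma poincare_strip D (zeta : R * R -> R) chi delta : open D ->
  (forall r, D r -> {for r, continuous zeta}) -> Ck 1 (column D) chi -> 0 < delta ->
  (\int[volume]_(p in strip D zeta delta) ((chi p - hat zeta chi p.1) ^+ 2)%:E <=
   (delta ^+ 2)%:E * \int[volume]_(p in strip D zeta delta) (dz chi p ^+ 2)%:E)%E.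
Proof.
move=> oD cz Cchi d0.
have oS : open (strip D zeta delta) by exact: open_strip.
have mS := open_measurable3 oS.
have SD : strip D zeta delta `<=` column D by move=> p [].
have cdz p : column D p -> {for p, continuous (dz chi)}.
  by case: Cchi => _ /(_ ez); exact.
have mdz : measurable_fun3 (strip D zeta delta) (fun p => dz chi p ^+ 2).
  apply: continuous_measurable_fun3 => // p /SD Dp.
  by apply: continuousM; exact: cdz.
have mh : measurable_fun2 D (hat zeta chi).
  apply: continuous_measurable_fun2 => // r Dr.
  apply: (@continuous_comp _ _ _ (fun r => (r, zeta r)) chi).
    by apply: continuous_pair_at; [exact: cvg_id|exact: cz].
  exact: (Ck_continuous Cchi).
have mchi : measurable_fun3 (strip D zeta delta) (fun p => (chi p - hat zeta chi p.1) ^+ 2).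
  apply: measurable_funX; apply: measurable_funB.
    by apply: continuous_measurable_fun3 => // p /SD Dp; exact: (Ck_continuous Cchi).
  apply: measurable_funS SD _; first exact: measurable_column.
  exact: measurable_fun_horizontal.
have inner (g : R * R * R -> R) r : D r ->
    (\int[mu]_z ((g \_ (strip D zeta delta)) (r, z))%:E =
     \int[mu]_(z in `](zeta r - delta)%R, zeta r[) (g (r, z))%:E)%E.
  move=> Dr; rewrite [RHS]integral_mkcond; apply: eq_integral => z _.
  rewrite !patchE; case: (boolP (z \in _)) => [|/negP]; rewrite inE /= in_itv /= => zz.
    by rewrite ifT // inE.
  by rewrite ifF //; apply/negbTE/negP; rewrite inE => -[].
have outer (g : R * R * R -> R) r : ~ D r ->
    (\int[mu]_z ((g \_ (strip D zeta delta)) (r, z))%:E = 0)%E.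
  move=> Dr; apply: integral0_eq => z _; rewrite patchE ifF //.
  by apply/negbTE/negP; rewrite inE => -[].
have mint (g : R * R * R -> R) : measurable_fun3 (strip D zeta delta) g -> (forall p, 0 <= g p) ->
    @measurable_fun _ _ (R2 R) _ setT (fun r => \int[mu]_z ((g \_ (strip D zeta delta)) (r, z))%:E)%E.
  move=> mg g0.
  apply: (@measurable_fun_fubini_tonelli_F _ _ _ _ R mu (EFin \o (g \_ (strip D zeta delta)))).
    apply/measurable_EFinP.
    exact/(measurable_restrictT _ mS).
  by move=> x /=; rewrite lee_fin patchE; case: ifPn.
rewrite !tonelli_volume_in //; last 2 first.
  by move=> p _; exact: sqr_ge0.
  by move=> p _; exact: sqr_ge0.
have mint1 := mint _ mchi (fun p => sqr_ge0 _).
have mint2 := mint _ mdz (fun p => sqr_ge0 _).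
rewrite -ge0_integralZl //; last 2 first.
- move=> r _; apply: integral_ge0 => z _; rewrite lee_fin patchE; case: ifPn => // _.
  exact: sqr_ge0.
- by rewrite lee_fin sqr_ge0.
apply: ge0_le_integral => //.
- move=> r _; apply: integral_ge0 => z _; rewrite lee_fin patchE; case: ifPn => // _.
  exact: sqr_ge0.
- exact: measurable_funeM.
move=> r _; have [Dr|Dr] := pselect (D r); last by rewrite !outer // mule0.
rewrite !inner //.
apply: (@poincare_itv (fun z => chi (r, z) - chi (r, zeta r)) (fun z => dz chi (r, z))) => //.
- move=> z; have dchi := @is_derive_vertical D chi r z Cchi Dr.
  have := is_deriveB dchi (is_derive_cst (chi (r, zeta r)) z 1).
  by rewrite subr0.
- move=> z; apply: (@continuous_comp _ _ _ (fun z => (r, z)) (dz chi)).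
    by apply: continuous_pair_at; [exact: cvg_cst|exact: cvg_id].
  exact: cdz.
- by rewrite subrr.
Qed.

End poincare.

(** * Uniformity over compact sets of the horizontal plane *)

Section compactness.
Context {R : realType}.
Implicit Types (D K : set (R * R)) (zeta : R * R -> R).

(** In the parameters [e] and [z - zeta r], the surface is the single point [(0, 0)]. Compactness of
    [K] then makes one neighbourhood of that point work for every [r]. *)
Lemma compact_uniform_trace D K zeta (G : R * (R * R * R) -> R) (eps : R) :
  K `<=` D -> compact K -> (forall r, D r -> {for r, continuous zeta}) ->
  (forall r, D r -> {for (0, (r, zeta r)), continuous G}) -> 0 < eps ->
  exists2 rho : R, 0 < rho & forall e r z, `|e| < rho -> K r -> `|z - zeta r| < rho ->
    `|G (e, (r, z)) - G (0, (r, zeta r))| <= eps.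
Proof.
move=> KD /compact_near_coveringP cK cz cG eps0.
have : \forall es \near nbhs ((0 : R), (0 : R)), K `<=` (fun r =>
  `|G (es.1, (r, zeta r + es.2)) - G (0, (r, zeta r))| <= eps).
  apply: cK => r0 Kr0; have Dr0 := KD _ Kr0.
  pose x0 : R * R * (R * R) := (r0, (0, 0)).
  pose A1 (x : R * R * (R * R)) := G (x.2.1, (x.1, zeta x.1 + x.2.2)).
  pose A2 (x : R * R * (R * R)) := G (0, (x.1, zeta x.1)).
  have cfst : {for x0, continuous (fun x : R * R * (R * R) => zeta x.1)}.
    by apply: (@continuous_comp _ _ _ fst zeta); [exact: cvg_fst|exact: cz].
  have c21 : {for x0, continuous (fun x : R * R * (R * R) => x.2.1)}.
    by apply: (@continuous_comp _ _ _ snd fst); [exact: cvg_snd|exact: cvg_fst].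
  have c22 : {for x0, continuous (fun x : R * R * (R * R) => x.2.2)}.
    by apply: (@continuous_comp _ _ _ snd snd); exact: cvg_snd.
  have c1 : {for x0, continuous A1}.
    apply: (@continuous_comp _ _ _
      (fun x : R * R * (R * R) => (x.2.1, (x.1, zeta x.1 + x.2.2))) G).
      apply: continuous_pair_at => //; apply: continuous_pair_at; first exact: cvg_fst.
      exact: continuousD.
    by rewrite /= addr0; exact: cG.
  have c2 : {for x0, continuous A2}.
    apply: (@continuous_comp _ _ _ (fun x : R * R * (R * R) => (0, (x.1, zeta x.1))) G).
      apply: continuous_pair_at; first exact: cvg_cst.
      by apply: continuous_pair_at => //; exact: cvg_fst.
    exact: cG.
  have cA : {for x0, continuous (fun x => A1 x - A2 x)} by exact: continuousB.
  have A0 : A1 x0 - A2 x0 = 0 by rewrite /A1 /A2 /= addr0 subrr.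
  have /cvgr_dist_le /(_ eps eps0) := cA.
  by apply: filterS => x; rewrite A0 sub0r normrN.
move=> /nbhs_ballP[rho /= rho0 rhoP]; exists rho => // e r z er Kr zr.
have hb : ball ((0 : R), (0 : R)) rho (e, z - zeta r).
  by split; rewrite /= -ball_normE /ball_ /= sub0r normrN.
have := rhoP _ hb r Kr.
by rewrite /= (_ : zeta r + (z - zeta r) = z) //; ring.
Qed.

Lemma compact_bounded_fun K (f : R * R -> R) :
  compact K -> (forall r, K r -> {for r, continuous f}) ->
  exists2 B : R, 0 <= B & forall r, K r -> `|f r| <= B.
Proof.
move=> /compact_near_coveringP cK cf.
have : \forall M \near +oo_R, K `<=` (fun r => `|f r| <= M).
  apply: cK => r0 Kr0.
  have /cvgr_dist_le /(_ 1 ltr01) h := cf r0 Kr0.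
  exists ([set r | `|f r0 - f r| <= 1], [set M | `|f r0| + 1 <= M]) => /=.
    by split => //; apply: nbhs_pinfty_ge; exact: num_real.
  move=> [r M] [/= h1]; apply: le_trans.
  have := ler_distD (f r0) (f r) 0; rewrite !subr0 distrC => /le_trans; apply.
  by rewrite addrC lerD2l.
case=> M [_ MP]; exists (Num.max 0 (M + 1)); first by rewrite le_max lexx.
move=> r Kr; rewrite le_max; apply/orP; right.
by apply: MP Kr; rewrite ltrDl ltr01.
Qed.

Lemma compact_measurable2 K : compact K -> measurable2 K.
Proof.
move=> cK; rewrite -(setCK K); apply: (@measurableC _ (R2 R)).
apply: open_measurable2; apply: closed_openC; exact: compact_closed.
Qed.

Lemma compact_area_fin K : compact K -> (area K < +oo)%E.
Proof.
move=> cK.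
have [B1 B10 B1P] := @compact_bounded_fun K fst cK (fun r _ => cvg_fst).
have [B2 B20 B2P] := @compact_bounded_fun K snd cK (fun r _ => cvg_snd).
have mB : measurable2 (`[- B1, B1] `*` `[- B2, B2]) by apply: measurableX.
apply: (@le_lt_trans _ _ (area (`[- B1, B1] `*` `[- B2, B2]))).
  apply: le_measure; rewrite ?inE //; first exact: compact_measurable2.
  move=> r Kr; split; rewrite /= in_itv /= -ler_norml; [exact: B1P|exact: B2P].
rewrite areaX // !lebesgue_measure_itv /=.
by do 2 case: ifP => _; rewrite ?mule0 ?mul0e // -!EFinD -EFinM ltry.
Qed.

End compactness.

(** * Sums, products and compositions of differentiable functions *)

Section Ck_algebra.
Context {R : realType} {V : normedModType R}.
Implicit Types (f g : V -> R) (U : set V).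

Lemma continuous_at_congr U f g x : open U -> U x -> (forall y, U y -> f y = g y) ->
  {for x, continuous g} -> {for x, continuous f}.
Proof.
move=> oU Ux fg cg; rewrite /prop_for /continuous_at fg //.
apply: cvg_trans cg; apply: near_eq_cvg; near=> y.
by apply/esym/fg; near: y; exact: open_nbhs_nbhs.
Unshelve. all: by end_near. Qed.

Lemma Ck1_mul U f g : open U -> Ck 1 U f -> Ck 1 U g -> Ck 1 U (fun x => f x * g x).
Proof.
move=> oU Cf Cg; have df x := Ck_differentiable Cf (x := x).
have dg x := Ck_differentiable Cg (x := x).
split => [x Ux|v x Ux]; first exact: differentiableM (df x Ux) (dg x Ux).
apply: (@continuous_at_congr _ _ (fun x => f x * 'D_v g x + g x * 'D_v f x) _ oU Ux).
  move=> y Uy; rewrite deriveM; try by apply: diff_derivable; auto.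
  by [].
case: (Cf) => _ /(_ v) cf; case: (Cg) => _ /(_ v) cg.
apply: continuousD; apply: continuousM.
- exact: Ck_continuous Cf Ux.
- exact: cg.
- exact: Ck_continuous Cg Ux.
- exact: cf.
Qed.

Lemma Ck1_add U f g : open U -> Ck 1 U f -> Ck 1 U g -> Ck 1 U (fun x => f x + g x).
Proof.
move=> oU Cf Cg; have df x := Ck_differentiable Cf (x := x).
have dg x := Ck_differentiable Cg (x := x).
split => [x Ux|v x Ux]; first exact: differentiableD (df x Ux) (dg x Ux).
apply: (@continuous_at_congr _ _ (fun x => 'D_v f x + 'D_v g x) _ oU Ux).
  by move=> y Uy; rewrite deriveD //; apply: diff_derivable; auto.
by case: (Cf) => _ /(_ v) cf; case: (Cg) => _ /(_ v) cg; apply: continuousD; auto.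
Qed.

Lemma derive_comp1 (h : R -> R) f x v : differentiable f x -> derivable h (f x) 1 ->
  differentiable (h \o f) x /\ 'D_v (h \o f) x = 'D_v f x * 'D_1 h (f x).
Proof.
move=> df dh; have dh' : differentiable h (f x) by exact/derivable1_diffP.
have dhf : differentiable (h \o f) x by exact: differentiable_comp.
split => //; rewrite (deriveE v dhf) diff_comp //= diff1E // -(deriveE v df).
by rewrite derive1E.
Qed.

End Ck_algebra.

(** * A cutoff function of one variable *)

Section cutoff.
Context {R : realType}.
Local Notation mu := (@lebesgue_measure R).

(** The variations below are proved in this form, in which the errors of several approximations can
    simply be added. *)
Lemma is_derive_estimate (F : R -> R) (x L : R) :
  (forall eps, 0 < eps -> exists2 rho, 0 < rho &
    forall h, `|h| < rho -> `|F (h + x) - F x - h * L| <= eps * `|h|) ->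
  is_derive x (1 : R) F L.
Proof.
move=> FP.
have FL : h^-1 *: (F (h *: (1 : R) + x) - F x) @[h --> 0^'] --> L.
  apply/cvgrPdist_le => eps eps0; have [rho rho0 rhoP] := FP _ eps0.
  near=> h.
  have h0 : h != 0 by near: h; exact: nbhs_dnbhs_neq.
  have hr : `|h| < rho by near: h; apply: dnbhs0_lt.
  rewrite [h *: _]mulr1.
  rewrite (_ : L - _ = - (h^-1 * (F (h + x) - F x - h * L))).
    rewrite normrN normrM normfV mulrC ler_pdivrMr ?normr_gt0 //; exact: rhoP.
  by rewrite /GRing.scale /=; field.
by split; [apply/cvg_ex; exists L|exact/cvg_lim].
Unshelve. all: by end_near. Qed.

Definition pospart (x : R) : R := Num.max x 0.

Lemma pospartP x : (0 <= x /\ pospart x = x) \/ (x <= 0 /\ pospart x = 0).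
Proof. by rewrite /pospart; case: (leP x 0) => h; [right|left; split=> //; exact: ltW]. Qed.

Lemma continuous_pospart : continuous pospart.
Proof. by move=> x; apply: (@continuous_max _ _ (id : R -> R) (cst 0)); [exact: cvg_id|exact: cvg_cst]. Qed.

Lemma is_derive_pospart_sqr (x : R) :
  is_derive x (1 : R) (fun y => pospart y ^+ 2) (2 * pospart x).
Proof.
apply: is_derive_estimate => eps eps0; exists eps => // h he.
apply: (@le_trans _ _ (`|h| * `|h|)); last by rewrite ler_wpM2r // ltW.
rewrite -normrM ger0_norm -?expr2 ?sqr_ge0 //.
case: (pospartP (h + x)) => -[h1 ->]; case: (pospartP x) => -[h2 ->];
  rewrite ler_norml; apply/andP; split; nra.
Qed.

(* A C^1 spline: 0 on ]-oo, 1], 1 on [2, +oo[, with a tent as derivative. *)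
Definition cutoff (s : R) : R :=
  2 * (pospart (s - 1) ^+ 2 - 2 * pospart (s - 3 / 2) ^+ 2 + pospart (s - 2) ^+ 2).

Definition dcutoff (s : R) : R :=
  4 * (pospart (s - 1) - 2 * pospart (s - 3 / 2) + pospart (s - 2)).

Lemma is_derive_affine (h : R -> R) (a b s dh : R) : is_derive (a * s + b) (1 : R) h dh ->
  is_derive s (1 : R) (fun y => h (a * y + b)) (dh * a).
Proof.
move=> hP; apply: (@is_derive1_comp _ h (fun y => a * y + b) s dh a) => //.
by apply: is_derive_eq; rewrite addr0 scaler1.
Qed.

Lemma is_derive_cutoff (s : R) : is_derive s (1 : R) cutoff (dcutoff s).
Proof.
have P (c : R) : is_derive s (1 : R) (fun y => pospart (y - c) ^+ 2) (2 * pospart (s - c)).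
  have := @is_derive_affine (fun y => pospart y ^+ 2) 1 (- c) s _ (is_derive_pospart_sqr _).
  rewrite mulr1 mul1r; congr (is_derive _ _ _ _).
  by apply/funext => y; rewrite mul1r.
have := P 1; have := P (3 / 2); have := P 2 => P2 P32 P1.
have H := is_deriveZ 2 (is_deriveD (is_deriveB P1 (is_deriveZ 2 P32)) P2).
apply: (is_derive_eq H); rewrite /dcutoff /GRing.scale /=; ring.
Qed.

Lemma continuous_dcutoff : continuous dcutoff.
Proof.
have P (c : R) : continuous (fun y => pospart (y - c)).
  move=> s; apply: (@continuous_comp _ _ _ (fun y => y - c) pospart).
    by apply: continuousB; [exact: cvg_id|exact: cvg_cst].
  exact: continuous_pospart.
move=> s; suff : {for s, continuous (fun s : R =>
  4 * (pospart (s - 1) - 2 * pospart (s - 3 / 2) + pospart (s - 2)))} by [].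
apply: continuous_mulr_at; first exact: continuous_cst_at.
apply: continuous_addr_at; last exact: P.
apply: continuous_subr_at; first exact: P.
by apply: continuous_mulr_at; [exact: continuous_cst_at|exact: P].
Qed.

Lemma cutoff_le1 s : s <= 1 -> cutoff s = 0 /\ dcutoff s = 0.
Proof.
move=> s1; rewrite /cutoff /dcutoff.
case: (pospartP (s - 1)) => -[h1 ->]; case: (pospartP (s - 3 / 2)) => -[h2 ->];
  case: (pospartP (s - 2)) => -[h3 ->]; split; nra.
Qed.

Lemma cutoff_ge2 s : 2 <= s -> cutoff s = 1 /\ dcutoff s = 0.
Proof.
move=> s1; rewrite /cutoff /dcutoff.
case: (pospartP (s - 1)) => -[h1 ->]; case: (pospartP (s - 3 / 2)) => -[h2 ->];
  case: (pospartP (s - 2)) => -[h3 ->]; split; nra.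
Qed.

Lemma cutoff_bounds s : 0 <= cutoff s <= 1.
Proof.
rewrite /cutoff; case: (pospartP (s - 1)) => -[h1 ->];
  case: (pospartP (s - 3 / 2)) => -[h2 ->]; case: (pospartP (s - 2)) => -[h3 ->];
  apply/andP; split; nra.
Qed.

Lemma dcutoff_bounds s : 0 <= dcutoff s <= 2.
Proof.
rewrite /dcutoff; case: (pospartP (s - 1)) => -[h1 ->];
  case: (pospartP (s - 3 / 2)) => -[h2 ->]; case: (pospartP (s - 2)) => -[h3 ->];
  apply/andP; split; lra.
Qed.

(** The integrand is an approximate identity, supported between [delta] and [2 * delta] below [b];
    its mass is the total rise of [cutoff]. *)
Lemma integral_dcutoff (b delta : R) : 0 < delta ->
  (\int[mu]_z (dcutoff ((b - z) / delta) / delta)%:E = 1)%E.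
Proof.
move=> d0.
have dz z : is_derive z (1 : R) (fun z => - cutoff ((b - z) / delta)) (dcutoff ((b - z) / delta) / delta).
  have := @is_derive_affine cutoff (- delta^-1) (b / delta) z _ (is_derive_cutoff _).
  rewrite (_ : - delta^-1 * z + b / delta = (b - z) / delta); last by field; rewrite gt_eqF.
  move=> /is_deriveN; rewrite mulrN opprK; congr (is_derive _ _ _ _).
  by apply/funext => y /=; congr (- cutoff _); field; rewrite gt_eqF.
have cF : continuous (fun z => - cutoff ((b - z) / delta)).
  by move=> z; apply: differentiable_continuous; apply/derivable1_diffP; case: (dz z).
have -> : (\int[mu]_z (dcutoff ((b - z) / delta) / delta)%:E =
    \int[mu]_(z in `[(b - 2 * delta)%R, b]) (dcutoff ((b - z) / delta) / delta)%:E)%E.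
  rewrite [RHS]integral_mkcond; apply: eq_integral => z _; rewrite patchE.
  case: ifPn => // /negP; rewrite inE /= in_itv /= => /negP; rewrite negb_and -!ltNge.
  move=> /orP[zb|zb].
    by rewrite (cutoff_ge2 _).2 ?mul0r // ler_pdivlMr //; lra.
  by rewrite (cutoff_le1 _).2 ?mul0r // ler_pdivrMr //; lra.
rewrite (@continuous_FTC2 _ _ (fun z => - cutoff ((b - z) / delta))).
- rewrite subrr mul0r (cutoff_le1 _).1 // (cutoff_ge2 _).1; last by rewrite ler_pdivlMr //; lra.
  by rewrite -EFinD; congr EFin; ring.
- by lra.
- apply: continuous_subspaceT => z.
  suff : {for z, continuous (fun z : R => dcutoff ((b - z) / delta) / delta)} by [].
  apply: continuous_mulr_at; last exact: continuous_cst_at.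
  apply: (@continuous_comp _ _ _ (fun z : R => (b - z) / delta) dcutoff).
    apply: continuous_mulr_at; last exact: continuous_cst_at.
    by apply: continuous_subr_at; [exact: continuous_cst_at|exact: cvg_id].
  exact: continuous_dcutoff.
- split; first by move=> t _; case: (dz t).
    by apply: cvg_at_right_filter; exact: cF.
  by apply: cvg_at_left_filter; exact: cF.
- by move=> t _; rewrite derive1E; case: (dz t).
Qed.

End cutoff.

(** * Energy densities and the layer under the surface *)

Section green.
Context {R : realType}.
Local Notation mu := (@lebesgue_measure R).
Implicit Types (D K : set (R * R)) (zeta : R * R -> R) (chi : R * R * R -> R).

Lemma dot2D (a b c : R * R) : dot2 a (b + c) = dot2 a b + dot2 a c.
Proof. by rewrite /dot2 /=; ring. Qed.

Lemma dot3_ge0 (a : R * R * R) : 0 <= dot3 a a.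
Proof. by rewrite /dot3 /dot2; nra. Qed.

Lemma normr_dot3 (a b : R * R * R) : `|dot3 a b| <= dot3 a a + dot3 b b.
Proof.
case: a b => [[a1 a2] a3] [[b1 b2] b3]; rewrite /dot3 /dot2 /= ler_norml.
have := sqr_ge0 (a1 - b1); have := sqr_ge0 (a2 - b2); have := sqr_ge0 (a3 - b3).
have := sqr_ge0 (a1 + b1); have := sqr_ge0 (a2 + b2); have := sqr_ge0 (a3 + b3).
have := sqr_ge0 a1; have := sqr_ge0 a2; have := sqr_ge0 a3.
have := sqr_ge0 b1; have := sqr_ge0 b2; have := sqr_ge0 b3.
by rewrite !expr2 => *; apply/andP; split; lra.
Qed.

Lemma dot3D_le (a b : R * R * R) :
  dot3 (a + b) (a + b) <= 2 * dot3 a a + 2 * dot3 b b.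
Proof.
case: a b => [[a1 a2] a3] [[b1 b2] b3]; rewrite /dot3 /dot2 /=.
have := sqr_ge0 (a1 - b1); have := sqr_ge0 (a2 - b2); have := sqr_ge0 (a3 - b3).
by rewrite !expr2 => *; lra.
Qed.

Lemma energy_density_ge0 chi p : 0 <= energy_density chi p.
Proof.
rewrite /energy_density addr_ge0 ?dot3_ge0 // divr_ge0 ?sqr_ge0 //.
by rewrite addr_ge0 ?dot3_ge0.
Qed.

Lemma grad_le_energy chi p : dot3 (grad chi p) (grad chi p) <= energy_density chi p.
Proof.
rewrite /energy_density lerDl divr_ge0 ?sqr_ge0 //.
by rewrite addr_ge0 ?dot3_ge0.
Qed.

(** Zero down to depth [delta], as [no_flux] requires of its test functions, and one from depth
    [2 * delta] on. *)
Definition layer zeta (delta : R) (p : R * R * R) : R :=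
  cutoff ((zeta p.1 - p.2) / delta).

Lemma derive_depth D zeta (delta : R) (p v : R * R * R) : Ck 1 D zeta -> D p.1 ->
  differentiable (fun q : R * R * R => (zeta q.1 - q.2) / delta) p /\
  'D_v (fun q : R * R * R => (zeta q.1 - q.2) / delta) p =
    ('D_(v.1) zeta p.1 - v.2) / delta.
Proof.
move=> Cz Dp; have dz := Ck_differentiable Cz Dp.
have d1 : differentiable (fun q : R * R * R => zeta q.1) p.
  apply: (@differentiable_comp _ _ _ _ fst zeta) => //.
  by apply: linear_differentiable => q; exact: cvg_fst.
have d2 : differentiable (fun q : R * R * R => q.2) p.
  by apply: (@linear_differentiable _ _ _ snd) => q; exact: cvg_snd.
have d12 := differentiableB d1 d2.
have E : (fun q : R * R * R => (zeta q.1 - q.2) / delta) =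
    delta^-1 *: ((fun q : R * R * R => zeta q.1) - (fun q => q.2)).
  by apply/funext => q; rewrite mulrC.
split; first by rewrite E; exact: differentiableZ.
rewrite E deriveZ; last exact: diff_derivable.
rewrite deriveB; try exact: diff_derivable.
rewrite mulrC; congr (_ * _); congr (_ - _).
(* The difference quotient of the vertical coordinate at [p] along [v] is convertible to that of the
   identity at [p.2] along [v.2]. *)
rewrite -[RHS](@derive_id _ _ p.2 v.2).
by [].
Qed.

Lemma derive_layer D zeta (delta : R) (p v : R * R * R) : Ck 1 D zeta -> D p.1 ->
  differentiable (layer zeta delta) p /\
  'D_v (layer zeta delta) p =
    dcutoff ((zeta p.1 - p.2) / delta) / delta * ('D_(v.1) zeta p.1 - v.2).
Proof.
move=> Cz Dp; have [d1 d2] := derive_depth delta v Cz Dp.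
have dc := is_derive_cutoff ((zeta p.1 - p.2) / delta).
have [d3 d4] := @derive_comp1 _ _ cutoff _ p v d1 (@ex_derive _ _ _ _ _ _ _ dc).
split => //; rewrite [LHS]d4 d2 derive_val; ring.
Qed.

Lemma Ck_layer D zeta (delta : R) : open D -> Ck 1 D zeta ->
  Ck 1 (column D) (layer zeta delta).
Proof.
move=> oD Cz; split => [p Dp|v p Dp].
  by have [] := derive_layer delta 0 Cz Dp.
apply: (@continuous_at_congr _ _ _ _
    (fun p => dcutoff ((zeta p.1 - p.2) / delta) / delta * ('D_(v.1) zeta p.1 - v.2)) _ (open_column oD) Dp).
  by move=> q Dq; have [] := derive_layer delta v Cz Dq.
have cz : {for p, continuous (fun q : R * R * R => zeta q.1)}.
  by apply: (@continuous_comp _ _ _ fst zeta); [exact: cvg_fst|exact: Ck_continuous Cz Dp].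
apply: continuous_mulr_at.
  apply: continuous_mulr_at; last exact: continuous_cst_at.
  apply: (@continuous_comp _ _ _ (fun q : R * R * R => (zeta q.1 - q.2) / delta) dcutoff).
    apply: continuous_mulr_at; last exact: continuous_cst_at.
    by apply: continuous_subr_at => //; exact: cvg_snd.
  exact: continuous_dcutoff.
apply: continuous_subr_at; last exact: continuous_cst_at.
apply: (@continuous_comp _ _ _ fst ('D_(v.1) zeta)); first exact: cvg_fst.
by case: Cz => _ /(_ v.1) /(_ _ Dp).
Qed.


Lemma continuous_dot3 {T : topologicalType} (a b : T -> R * R * R) x :
  {for x, continuous (fun y => (a y).1.1)} -> {for x, continuous (fun y => (a y).1.2)} ->
  {for x, continuous (fun y => (a y).2)} ->
  {for x, continuous (fun y => (b y).1.1)} -> {for x, continuous (fun y => (b y).1.2)} ->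
  {for x, continuous (fun y => (b y).2)} ->
  {for x, continuous (fun y => dot3 (a y) (b y))}.
Proof.
move=> a1 a2 a3 b1 b2 b3; apply: continuous_addr_at; last exact: continuous_mulr_at.
by apply: continuous_addr_at; exact: continuous_mulr_at.
Qed.

Lemma continuous_dot3_grad D (v : R * R * R -> R * R * R) chi p :
  Ck_field 0 (column D) v -> Ck 1 (column D) chi -> column D p ->
  {for p, continuous (fun q => dot3 (v q) (grad chi q))}.
Proof.
move=> [v1 v2 v3] [_ Cchi] Dp.
by apply: continuous_dot3; [exact: v1|exact: v2|exact: v3|exact: Cchi..].
Qed.

Lemma Ck_field_grad k D chi : Ck k.+1 (column D) chi -> Ck_field k (column D) (grad chi).
Proof. by case=> _ Cchi; split; exact: Cchi. Qed.

Lemma CkW_field k D v : Ck_field k.+1 (column D) v -> Ck_field k (column D) v.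
Proof. by case=> *; split; exact: CkW. Qed.

Lemma continuous_energy_density D chi p : Ck 1 (column D) chi -> column D p ->
  {for p, continuous (energy_density chi)}.
Proof.
move=> Cchi Dp; apply: continuous_addr_at.
  exact: continuous_dot3_grad (Ck_field_grad Cchi) Cchi Dp.
have c11 : {for p, continuous (fun q : R * R * R => q.1.1)}.
  by apply: (@continuous_comp _ _ _ fst fst); exact: cvg_fst.
have c12 : {for p, continuous (fun q : R * R * R => q.1.2)}.
  by apply: (@continuous_comp _ _ _ fst snd); [exact: cvg_fst|exact: cvg_snd].
have c2 : {for p, continuous (fun q : R * R * R => q.2)} by exact: cvg_snd.
apply: (@continuous_mulr_at _ _ (fun q => chi q ^+ 2) (fun q => (1 + dot3 q q)^-1)).
  by apply: continuous_mulr_at; exact: Ck_continuous Cchi Dp.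
apply: continuousV.
  by rewrite gt_eqF // ltr_wpDr // dot3_ge0.
by apply: continuous_addr_at; [exact: continuous_cst_at|exact: continuous_dot3].
Qed.

Lemma continuous_hat D zeta chi r : (forall r, D r -> {for r, continuous zeta}) ->
  Ck 0 (column D) chi -> D r -> {for r, continuous (hat zeta chi)}.
Proof.
move=> cz Cchi Dr; apply: (@continuous_comp _ _ _ (fun r => (r, zeta r)) chi).
  by apply: continuous_pair_at; [exact: cvg_id|exact: cz].
exact: Cchi.
Qed.

Lemma continuous_horizontal D (a : R * R -> R) (p : R * R * R) :
  {for p.1, continuous a} -> {for p, continuous (fun q : R * R * R => a q.1)}.
Proof. by move=> ca; apply: (@continuous_comp _ _ _ fst a) => //; exact: cvg_fst. Qed.

Lemma strip_fluid D zeta delta : strip D zeta delta `<=` fluid D zeta.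
Proof. by move=> p [Dp /andP[]]. Qed.

Lemma poincare_strip_Rintegral D zeta chi delta : open D ->
  (forall r, D r -> {for r, continuous zeta}) -> Ck 1 (column D) chi ->
  finite_energy D zeta chi -> 0 < delta ->
  volume.-integrable (strip D zeta delta)
    (EFin \o (fun p => (chi p - hat zeta chi p.1) ^+ 2)) /\
  \int[volume]_(p in strip D zeta delta) ((chi p - hat zeta chi p.1) ^+ 2) <=
    delta ^+ 2 * \int[volume]_(p in strip D zeta delta) energy_density chi p.
Proof.
move=> oD cz Cchi fe d0.
have mF := open_measurable3 (open_fluid oD cz).
have mS : measurable3 (strip D zeta delta) by apply: open_measurable3; exact: open_strip.
have ei := integrableS mF mS (@strip_fluid D zeta delta) fe.
have := poincare_strip oD cz Cchi d0.
set I := (X in (X <= _)%E) => le1.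
have le2 : (I <= (delta ^+ 2 * \int[volume]_(p in strip D zeta delta) energy_density chi p)%:E)%E.
  apply: le_trans le1 _; rewrite [leRHS]EFinM lee_pmul2l //; last by rewrite lte_fin exprn_gt0.
  rewrite fineK; last exact: integrable_fin_num.
  apply: ge0_le_integral => //.
  - by move=> p _; rewrite lee_fin sqr_ge0.
  - apply/measurable_EFinP; apply: continuous_measurable_fun3; first exact: open_strip.
    move=> p [Dp _]; case: Cchi => _ Cchi.
    by apply: continuous_mulr_at; exact: (Cchi ez).
  - exact: measurable_int ei.
  move=> p _; rewrite lee_fin; apply: le_trans (grad_le_energy _ _).
  by rewrite /dot3 /= expr2 lerDr /dot2 -!expr2 addr_ge0 // sqr_ge0.
have I0 : (0 <= I)%E by apply: integral_ge0 => p _; rewrite lee_fin sqr_ge0.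
have Ifin : (I < +oo)%E by apply: le_lt_trans le2 _; rewrite ltry.
split; last by rewrite -lee_fin fineK // ge0_fin_numE.
apply/integrableP; split.
  apply/measurable_EFinP; apply: continuous_measurable_fun3; first exact: open_strip.
  move=> p [Dp _]; suff c : {for p, continuous (fun p => chi p - hat zeta chi p.1)}.
    exact: continuous_mulr_at.
  apply: continuous_subr_at; first exact: Ck_continuous Cchi Dp.
  by apply: continuous_horizontal => //; exact: continuous_hat cz (CkW Cchi) Dp.
apply: le_lt_trans Ifin; rewrite le_eqVlt; apply/orP; left; apply/eqP.
by apply: eq_integral => p _ /=; rewrite ger0_norm // sqr_ge0.
Qed.

End green.

(** * Conormal, and admissibility of functions cut off near the surface *)

Section green_formula.
Context {R : realType}.
Local Notation mu := (@lebesgue_measure R).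
Implicit Types (D K : set (R * R)) (zeta : R * R -> R) (chi : R * R * R -> R).

Lemma continuous_oppr_at {T : topologicalType} (f : T -> R) x :
  {for x, continuous f} -> {for x, continuous (fun y => - f y)}.
Proof. by move=> cf; exact: (cvgN cf). Qed.

Lemma dot3Dr (a b c : R * R * R) : dot3 a (b + c) = dot3 a b + dot3 a c.
Proof. by rewrite /dot3 /dot2 /=; ring. Qed.

Lemma dot3Zr (k : R) (a b : R * R * R) : dot3 a (k *: b) = k * dot3 a b.
Proof. by rewrite /dot3 /dot2 /= /GRing.scale /=; ring. Qed.

Lemma dot3ZZ (k : R) (a : R * R * R) : dot3 (k *: a) (k *: a) = k ^+ 2 * dot3 a a.
Proof. by rewrite /dot3 /dot2 /= /GRing.scale /=; ring. Qed.

(** By Lagrange's identity, the difference of the two sides is the squared length of the cross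
    product. *)
Lemma dot3_CauchySchwarz (a b : R * R * R) : dot3 a b ^+ 2 <= dot3 a a * dot3 b b.
Proof.
case: a b => [[a1 a2] a3] [[b1 b2] b3]; rewrite /dot3 /dot2 /=.
have := sqr_ge0 (a1 * b2 - a2 * b1); have := sqr_ge0 (a1 * b3 - a3 * b1).
by have := sqr_ge0 (a2 * b3 - a3 * b2); rewrite !expr2 => *; lra.
Qed.

(* The upward, not normalised, normal of the surface is the opposite. *)
Definition conormal zeta (r : R * R) : R * R * R := (grad2 zeta r, -1).

(** The coefficient in the surface equation is the upward flux of [v] through the surface per unit
    of horizontal area, which is what Green's formula produces. *)
Lemma zeta_noiseE (v : R * R * R -> R * R * R) zeta r :
  zeta_noise v zeta r = - dot3 (hat zeta v r) (conormal zeta r).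
Proof. by rewrite /zeta_noise /dot3 /= mulrN1 opprB. Qed.

Lemma dot3_conormal zeta r : dot3 (conormal zeta r) (conormal zeta r) =
  dot2 (grad2 zeta r) (grad2 zeta r) + 1.
Proof. by rewrite /dot3 /= mulrNN mulr1. Qed.

Lemma continuous_dot3_conormal D zeta (v : R * R * R -> R * R * R) p :
  Ck 1 D zeta -> Ck_field 0 (column D) v -> column D p ->
  {for p, continuous (fun q => dot3 (v q) (conormal zeta q.1))}.
Proof.
move=> [_ Cz] [v1 v2 v3] Dp.
apply: continuous_dot3; [exact: v1|exact: v2|exact: v3| | |exact: continuous_cst_at].
  exact: (@continuous_horizontal _ D _ p (Cz (1, 0) _ Dp)).
exact: (@continuous_horizontal _ D _ p (Cz (0, 1) _ Dp)).
Qed.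

Lemma grad_layerM D zeta delta chi p : Ck 1 D zeta -> Ck 1 (column D) chi -> column D p ->
  grad (fun q => layer zeta delta q * chi q) p = layer zeta delta p *: grad chi p +
    (chi p * (dcutoff ((zeta p.1 - p.2) / delta) / delta)) *: conormal zeta p.1.
Proof.
move=> Cz Cchi Dp; have dchi := Ck_differentiable Cchi Dp.
have E v : 'D_v (fun q => layer zeta delta q * chi q) p = layer zeta delta p * 'D_v chi p
    + chi p * (dcutoff ((zeta p.1 - p.2) / delta) / delta) * ('D_(v.1) zeta p.1 - v.2).
  have [d1 d2] := derive_layer delta v Cz Dp.
  have e1 : derivable (layer zeta delta) p v by exact: diff_derivable.
  have e2 : derivable chi p v by exact: diff_derivable.
  have := deriveM e1 e2; rewrite d2 => ->.
  by rewrite /GRing.scale /=; ring.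
rewrite /grad /gradr /dz (E ex) (E ey) (E ez) /ex /ey /ez /= !subr0 derive0 sub0r.
by [].
Qed.

Section fixed_surface.
Variables (D K : set (R * R)) (zeta : R * R -> R) (M : R) (chi : R * R * R -> R).
Hypotheses (oD : open D) (Cz : Ck 1 D zeta).
Hypothesis slope : forall r, D r -> dot2 (grad2 zeta r) (grad2 zeta r) <= M.
Hypotheses (Cchi : Ck 1 (column D) chi) (fe : finite_energy D zeta chi).
Hypotheses (cK : compact K) (KD : K `<=` D).
Hypothesis chi0 : forall r, D r -> ~ K r -> hat zeta chi r = 0.

Let cz r : D r -> {for r, continuous zeta}.
Proof. exact: Ck_continuous Cz. Qed.

Let mF : measurable3 (fluid D zeta).
Proof. by apply: open_measurable3; exact: open_fluid. Qed.

Let mS delta : measurable3 (strip D zeta delta).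
Proof. by apply: open_measurable3; exact: open_strip. Qed.

Lemma layer_outside_strip delta p : 0 < delta -> D p.1 -> ~ strip D zeta (2 * delta) p ->
  dcutoff ((zeta p.1 - p.2) / delta) = 0.
Proof.
move=> d0 Dp nS; have [h|h] := leP (zeta p.1) p.2.
  by apply: (cutoff_le1 _).2; rewrite ler_pdivrMr //; lra.
apply: (cutoff_ge2 _).2; rewrite ler_pdivlMr // leNgt; apply/negP => h2.
by apply: nS; split => //; apply/andP; split; lra.
Qed.

Lemma layer_below_strip delta p : 0 < delta -> fluid D zeta p ->
  ~ strip D zeta (2 * delta) p -> layer zeta delta p = 1.
Proof.
move=> d0 [Dp zp] nS; apply: (cutoff_ge2 _).1; rewrite ler_pdivlMr // leNgt.
by apply/negP => h; apply: nS; split => //; apply/andP; split; lra.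
Qed.

(** The gradient of the product contains [chi] times a factor of size [1 / delta] in the strip, so
    [chi] must be square integrable there. Over [K] the strip is bounded, so the weighted term of
    the energy controls [chi]; off [K] the trace vanishes, and [chi] is its own deviation from the
    surface value, controlled by Poincaré. *)
Lemma finite_energy_layerM delta : 0 < delta ->
  finite_energy D zeta (fun q => layer zeta delta q * chi q).
Proof.
move=> d0; have d20 : 0 < 2 * delta by lra.
have [B1 B10 B1P] := @compact_bounded_fun _ K fst cK (fun r _ => cvg_fst).
have [B2 B20 B2P] := @compact_bounded_fun _ K snd cK (fun r _ => cvg_snd).
have [B3 B30 B3P] := @compact_bounded_fun _ K zeta cK (fun r Kr => cz (KD Kr)).
(* A bound for [1 + dot3 p p] on the part of the strip that lies over [K]. *)
pose C := 1 + B1 ^+ 2 + B2 ^+ 2 + (B3 + 2 * delta) ^+ 2.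
have C0 : 0 <= C by rewrite /C !addr_ge0 ?sqr_ge0.
have [di _] := poincare_strip_Rintegral oD cz Cchi fe d20.
(* The factor 16 is 2 from the square of a sum, 2 from the bound [chile] on [chi p ^+ 2], and 4 from
   [dcutoff <= 2]. *)
pose h p := 16 * (M + 1) / delta ^+ 2 *
  (C * energy_density chi p + (chi p - hat zeta chi p.1) ^+ 2).
have hi : volume.-integrable (strip D zeta (2 * delta)) (EFin \o h).
  apply: integrableZ_EFin => //; apply: integrableD_EFin => //.
  apply: integrableZ_EFin => //.
  exact: (integrableS mF (mS _) (@strip_fluid _ D zeta _) fe).
have gi : volume.-integrable (fluid D zeta)
    (EFin \o (fun p => 2 * energy_density chi p + (h \_ (strip D zeta (2 * delta))) p)).
  apply: integrableD_EFin => //; first exact: integrableZ_EFin.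
  apply: (integrable_subset mF (mS (2 * delta)) (@strip_fluid _ D zeta _)).
    by move=> p _ nS; rewrite patchE ifF //; apply/negbTE/negP; rewrite inE.
  apply: eq_integrable_EFin hi => // p Sp; rewrite patchE ifT // inE //.
have CL : Ck 1 (column D) (fun q => layer zeta delta q * chi q).
  exact: (Ck1_mul (open_column oD) (Ck_layer delta oD Cz) Cchi).
apply: (integrable_le mF _ _ gi).
  apply: continuous_measurable_fun3; first exact: open_fluid.
  by move=> p [Dp _]; exact: continuous_energy_density CL Dp.
move=> p [Dp zp]; rewrite ger0_norm ?energy_density_ge0 //.
have /andP[w0 w1] := cutoff_bounds ((zeta p.1 - p.2) / delta).
have w2 : layer zeta delta p ^+ 2 <= 1 by rewrite expr_le1.
have gradle : dot3 (grad (fun q => layer zeta delta q * chi q) p)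
    (grad (fun q => layer zeta delta q * chi q) p) <=
  2 * dot3 (grad chi p) (grad chi p) + 2 * (chi p ^+ 2 *
    (dcutoff ((zeta p.1 - p.2) / delta) / delta) ^+ 2 * (M + 1)).
  rewrite (grad_layerM _ Cz Cchi Dp); apply: le_trans (dot3D_le _ _) _.
  apply: lerD; rewrite ler_pM2l // dot3ZZ.
    by rewrite ler_piMl // dot3_ge0.
  rewrite exprMn; apply: ler_wpM2l; first by rewrite mulr_ge0 // sqr_ge0.
  by rewrite dot3_conormal lerD2r; exact: slope.
have wle : (layer zeta delta p * chi p) ^+ 2 / (1 + dot3 p p) <= chi p ^+ 2 / (1 + dot3 p p).
  rewrite ler_wpM2r //; first by rewrite invr_ge0 addr_ge0 // dot3_ge0.
  by rewrite exprMn ler_piMl // sqr_ge0.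
have e0 : 0 <= chi p ^+ 2 / (1 + dot3 p p).
  by rewrite divr_ge0 ?sqr_ge0 // addr_ge0 // dot3_ge0.
have M1 : 0 <= M + 1.
  apply: (@le_trans _ _ (dot3 (conormal zeta p.1) (conormal zeta p.1))).
    exact: dot3_ge0.
  by rewrite dot3_conormal lerD2r; exact: slope.
rewrite {1}/energy_density.
apply: (@le_trans _ _ (2 * energy_density chi p + 2 * (chi p ^+ 2 *
    (dcutoff ((zeta p.1 - p.2) / delta) / delta) ^+ 2 * (M + 1)))).
  by rewrite /energy_density; lra.
rewrite lerD2l patchE; case: ifPn => [|/negP]; rewrite inE => Sp; last first.
  by rewrite layer_outside_strip // mul0r expr0n /= mulr0 mul0r mulr0.
have chile : chi p ^+ 2 <= 2 * (C * energy_density chi p + (chi p - hat zeta chi p.1) ^+ 2).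
  have [Kp|nK] := pselect (K p.1); last first.
    rewrite chi0 // subr0.
    have := mulr_ge0 C0 (energy_density_ge0 chi p); have := sqr_ge0 (chi p); lra.
  have CP : 1 + dot3 p p <= C.
    have := B1P _ Kp; rewrite ler_norml => /andP[a1 a2].
    have := B2P _ Kp; rewrite ler_norml => /andP[b1 b2].
    have := B3P _ Kp; rewrite ler_norml => /andP[c1 c2].
    case: Sp => _ /andP[s1 s2].
    rewrite /C /dot3 /dot2 !addrA -!expr2 !lerD //.
    + by rewrite -(@ler_sqrt _ _ (B1 ^+ 2)) ?sqr_ge0 // !sqrtr_sqr (ger0_norm B10); exact: B1P.
    + by rewrite -(@ler_sqrt _ _ (B2 ^+ 2)) ?sqr_ge0 // !sqrtr_sqr (ger0_norm B20); exact: B2P.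
    + have B3d : 0 <= B3 + 2 * delta by lra.
      rewrite -(@ler_sqrt _ _ ((B3 + 2 * delta) ^+ 2)) ?sqr_ge0 // !sqrtr_sqr (ger0_norm B3d).
      by rewrite ler_norml; apply/andP; split; lra.
  have : chi p ^+ 2 <= C * energy_density chi p.
    apply: (@le_trans _ _ ((1 + dot3 p p) * energy_density chi p)); last first.
      by rewrite ler_wpM2r // energy_density_ge0.
    have D0 : 0 < 1 + dot3 p p by rewrite ltr_wpDr // dot3_ge0.
    rewrite /energy_density mulrDr (mulrC _ (chi p ^+ 2 / _)) divfK ?gt_eqF //.
    by rewrite lerDr mulr_ge0 ?dot3_ge0 // ltW.
  have := sqr_ge0 (chi p - hat zeta chi p.1); have := sqr_ge0 (chi p); lra.
have /andP[dc0 dc2] := dcutoff_bounds ((zeta p.1 - p.2) / delta).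
have dc4 : (dcutoff ((zeta p.1 - p.2) / delta) / delta) ^+ 2 <= 4 / delta ^+ 2.
  rewrite exprMn exprVn ler_wpM2r ?invr_ge0 ?sqr_ge0 //; nra.
rewrite /h.
have hC : 0 <= C * energy_density chi p + (chi p - hat zeta chi p.1) ^+ 2.
  by rewrite addr_ge0 ?sqr_ge0 // mulr_ge0 // energy_density_ge0.
apply: (@le_trans _ _ (2 * (2 * (C * energy_density chi p + (chi p - hat zeta chi p.1) ^+ 2) *
    (4 / delta ^+ 2) * (M + 1)))).
  by rewrite ler_pM2l // ler_wpM2r // ler_pM ?sqr_ge0.
by rewrite le_eqVlt; apply/orP; left; apply/eqP; field; rewrite gt_eqF.
Qed.


End fixed_surface.
End green_formula.

(** * Green's formula with a surface term *)

Section green_formula_proof.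
Context {R : realType}.
Local Notation mu := (@lebesgue_measure R).

Variables (D K : set (R * R)) (zeta : R * R -> R) (M : R) (chi : R * R * R -> R).
Hypotheses (oD : open D) (Cz : Ck 1 D zeta).
Hypothesis slope : forall r, D r -> dot2 (grad2 zeta r) (grad2 zeta r) <= M.
Hypotheses (Cchi : Ck 1 (column D) chi) (fe : finite_energy D zeta chi).
Hypotheses (cK : compact K) (KD : K `<=` D).
Hypothesis chi0 : forall r, D r -> ~ K r -> hat zeta chi r = 0.

Let cz r : D r -> {for r, continuous zeta}.
Proof. exact: Ck_continuous Cz. Qed.

Let mF : measurable3 (fluid D zeta).
Proof. by apply: open_measurable3; exact: open_fluid. Qed.

Let mS delta : measurable3 (strip D zeta delta).
Proof. by apply: open_measurable3; exact: open_strip. Qed.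

Variable v : R * R * R -> R * R * R.
Hypothesis Cv : Ck_field 0 (column D) v.
Hypothesis div0 : forall p, fluid D zeta p -> div v p = 0.
Hypothesis vi : square_integrable D zeta v.
Hypothesis nf : no_flux D zeta v.

Lemma integrable_dot3_grad (psi : R * R * R -> R) : Ck 1 (column D) psi ->
  finite_energy D zeta psi ->
  volume.-integrable (fluid D zeta) (EFin \o (fun p => dot3 (v p) (grad psi p))).
Proof.
move=> Cpsi fpsi; apply: (integrable_le mF _ _ (integrableD_EFin mF vi fpsi)).
  apply: continuous_measurable_fun3; first exact: open_fluid.
  by move=> p [Dp _]; exact: continuous_dot3_grad Cv Cpsi Dp.
move=> p _; apply: le_trans (normr_dot3 _ _) _.
by rewrite lerD2l; exact: grad_le_energy.
Qed.

Lemma zeta_noise_continuous r : D r -> {for r, continuous (zeta_noise v zeta)}.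
Proof.
move=> Dr.
have c : {for r, continuous (fun r => dot3 (v (r, zeta r)) (conormal zeta r))}.
  apply: (@continuous_comp _ _ _ (fun r => (r, zeta r))
    (fun q : R * R * R => dot3 (v q) (conormal zeta q.1))).
    by apply: continuous_pair_at; [exact: cvg_id|exact: cz].
  exact: continuous_dot3_conormal Cz Cv _.
rewrite (_ : zeta_noise v zeta = fun r => - dot3 (v (r, zeta r)) (conormal zeta r)).
  exact: continuous_oppr_at.
by apply/funext => r'; rewrite zeta_noiseE.
Qed.

Let E p := dot3 (v p) (v p) + energy_density chi p.

Let E0 p : 0 <= E p.
Proof. by rewrite /E addr_ge0 ?dot3_ge0 // energy_density_ge0. Qed.

Let Ei : volume.-integrable (fluid D zeta) (EFin \o E).
Proof. exact: integrableD_EFin. Qed.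

Let m p := - dot3 (v p) (conormal zeta p.1).

(** Testing [no_flux] with [layer * chi] gives zero. What separates this from the integral of
    [dot3 (v p) (grad chi p)] is a kernel that concentrates on the surface and tends to the flux
    term, plus an error carried by the strip of depth [2 * delta]. *)
Lemma green_layer (delta eps A B : R) : 0 < delta -> 0 <= A -> 0 <= eps ->
  (forall r, K r -> `|hat zeta chi r| <= A) ->
  (forall r, K r -> `|zeta_noise v zeta r| <= B) ->
  (forall r z, K r -> `|z - zeta r| < 2 * delta ->
    `|m (r, z) - zeta_noise v zeta r| <= eps) ->
  `|\int[volume]_(p in fluid D zeta) dot3 (v p) (grad chi p)
    - \int[area]_(r in D) (hat zeta chi r * zeta_noise v zeta r)| <=
  (6 + M) * \int[volume]_(p in strip D zeta (2 * delta)) E p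
    + eps * (A * fine (area K)).
Proof.
move=> d0 A0 eps0 hA hB hm; have d20 : 0 < 2 * delta by lra.
have mC := measurable_column oD.
have FC : fluid D zeta `<=` column D by move=> p [].
(* Minus the vertical derivative of [layer]; the whole gradient of [layer] is [c] times the
   conormal. *)
pose c (p : R * R * R) := dcutoff ((zeta p.1 - p.2) / delta) / delta.
have c0 p : 0 <= c p by rewrite divr_ge0 ?(ltW d0) //; case/andP: (dcutoff_bounds ((zeta p.1 - p.2) / delta)).
have c2 p : c p <= 2 / delta.
  by rewrite ler_wpM2r ?invr_ge0 ?(ltW d0) //; case/andP: (dcutoff_bounds ((zeta p.1 - p.2) / delta)).
have cS p : D p.1 -> ~ strip D zeta (2 * delta) p -> c p = 0.
  by move=> Dp nS; rewrite /c (layer_outside_strip d0 Dp nS) mul0r.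
have cc p : column D p -> {for p, continuous c}.
  move=> Dp; apply: continuous_mulr_at; last exact: continuous_cst_at.
  apply: (@continuous_comp _ _ _ (fun q : R * R * R => (zeta q.1 - q.2) / delta) dcutoff).
    apply: continuous_mulr_at; last exact: continuous_cst_at.
    exact: continuous_depth Dp.
  exact: continuous_dcutoff.
have ckap r : D r -> {for r, continuous (hat zeta chi)}.
  by move=> Dr; exact: continuous_hat cz (CkW Cchi) Dr.
have cm p : column D p -> {for p, continuous m}.
  by move=> Dp; exact: continuous_oppr_at (continuous_dot3_conormal Cz Cv Dp).
have [] := @kernel_estimate R D K m (fun p => hat zeta chi p.1 * c p)
  (zeta_noise v zeta) (hat zeta chi) A B eps oD (compact_measurable2 cK) KD (compact_area_fin cK).
- by apply: continuous_measurable_fun3; [exact: open_column|exact: cm].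
- apply: continuous_measurable_fun3; first exact: open_column.
  move=> p Dp; apply: continuous_mulr_at; last exact: cc.
  by apply: continuous_horizontal => //; exact: ckap.
- by apply: continuous_measurable_fun2 => // r; exact: zeta_noise_continuous.
- exact: continuous_measurable_fun2.
- exact: A0.
- exact: eps0.
- move=> p Dp k0.
  have Kp : K p.1.
    by apply: contrapT => nK; move: k0; rewrite chi0 // mul0r eqxx.
  have Sp : strip D zeta (2 * delta) p.
    by apply: contrapT => nS; move: k0; rewrite cS // mulr0 eqxx.
  split => //; have := hm p.1 p.2 Kp; rewrite -surjective_pairing; apply.
  by case: Sp => _ /andP[? ?]; rewrite ltr_norml; apply/andP; split; lra.
- exact: hB.
- exact: hA.
- move=> r Kr /=.
  have -> : (\int[mu]_z `|hat zeta chi r * c (r, z)|%:E =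
      \int[mu]_z (`|hat zeta chi r|%:E * (c (r, z))%:E))%E.
    by apply: eq_integral => z _; rewrite -EFinM normrM (ger0_norm (c0 _)).
  rewrite ge0_integralZl //.
  + rewrite /c /= integral_dcutoff // mule1 lee_fin; exact: hA.
  + apply/measurable_EFinP; apply: continuous_measurable_fun => z.
    apply: (@continuous_comp _ _ _ (fun z => (r, z)) c).
      by apply: continuous_pair_at; [exact: cvg_cst|exact: cvg_id].
    by apply: cc; exact: KD.
  + by move=> z _; rewrite lee_fin.
- move=> r Kr /=.
  have cri : mu.-integrable setT (EFin \o (fun z => c (r, z))).
    apply/integrableP; split.
      apply/measurable_EFinP; apply: continuous_measurable_fun => z.
      apply: (@continuous_comp _ _ _ (fun z => (r, z)) c).
        by apply: continuous_pair_at; [exact: cvg_cst|exact: cvg_id].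
      by apply: cc; exact: KD.
    have -> : (\int[mu]_z `|(c (r, z))%:E| = 1)%E.
      rewrite -(integral_dcutoff (zeta r) d0); apply: eq_integral => z _ /=.
      by rewrite (ger0_norm (c0 _)).
    exact: ltry.
  have -> : (\int[mu]_z (hat zeta chi r * c (r, z))%:E =
      \int[mu]_z ((hat zeta chi r)%:E * (EFin \o (fun z => c (r, z))) z))%E.
    by apply: eq_integral => z _ /=; rewrite -EFinM.
  rewrite integralZl // /c /= integral_dcutoff // mule1 //.
- exact: chi0.
set k := fun p => _ => ki _ kle.
have kF : \int[volume]_(p in column D) (k p) = \int[volume]_(p in fluid D zeta) (k p).
  apply: Rintegral_subset => // p Dp nF.
  by rewrite /k cS ?mulr0 ?mul0r // => /strip_fluid.
rewrite kF in kle.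
have kiF := integrableS mC mF FC ki.
pose psi q := layer zeta delta q * chi q.
have Cpsi : Ck 1 (column D) psi.
  exact: (Ck1_mul (open_column oD) (Ck_layer delta oD Cz) Cchi).
have fpsi : finite_energy D zeta psi by exact: (finite_energy_layerM oD Cz slope Cchi fe cK KD chi0 d0).
have Fi := integrable_dot3_grad Cchi fe.
have Pi := integrable_dot3_grad Cpsi fpsi.
have P0 : \int[volume]_(p in fluid D zeta) dot3 (v p) (grad psi p) = 0.
  rewrite -(nf Cpsi fpsi); last first.
    exists delta => // p Dp zp; rewrite /psi /layer (cutoff_le1 _).1 ?mul0r //.
    by rewrite ler_pdivrMr // mul1r; move: zp; rewrite ltrBlDr -ltrBlDl => /ltW.
  by apply: eq_Rintegral => p; rewrite inE => Fp; rewrite div0 // mulr0 addr0.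
(* The error density: the part of the gradient removed by the cutoff, and the cost of replacing
   [chi] by its trace in the term with [c]. Both vanish below the strip. *)
pose G p := (1 - layer zeta delta p) * dot3 (v p) (grad chi p) +
  (chi p - hat zeta chi p.1) * m p * c p.
have GE p : fluid D zeta p -> G p = dot3 (v p) (grad chi p) - dot3 (v p) (grad psi p) - k p.
  move=> [Dp _]; rewrite /psi (grad_layerM _ Cz Cchi Dp) dot3Dr !dot3Zr /G /k /m /c; ring.
have GEi : volume.-integrable (fluid D zeta) (EFin \o G).
  apply: eq_integrable_EFin (integrableB_EFin mF (integrableB_EFin mF Fi Pi) kiF) => //.
  by move=> p /GE ->.
have FG : \int[volume]_(p in fluid D zeta) dot3 (v p) (grad chi p) =
    \int[volume]_(p in fluid D zeta) G p + \int[volume]_(p in fluid D zeta) k p.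
  have -> : \int[volume]_(p in fluid D zeta) G p = \int[volume]_(p in fluid D zeta)
      (dot3 (v p) (grad chi p) - dot3 (v p) (grad psi p) - k p).
    by apply: eq_Rintegral => p; rewrite inE => /GE.
  rewrite RintegralB //; last exact: integrableB_EFin.
  by rewrite RintegralB // P0 subr0 subrK.
have GS : \int[volume]_(p in fluid D zeta) G p = \int[volume]_(p in strip D zeta (2 * delta)) G p.
  apply: Rintegral_subset; first exact: strip_fluid.
  by move=> p Fp nS; rewrite /G (layer_below_strip d0 Fp nS) (cS _ Fp.1 nS) subrr mul0r mulr0 addr0.
have [di dle] := poincare_strip_Rintegral oD cz Cchi fe d20.
have EiS := integrableS mF (mS _) (@strip_fluid _ D zeta (2 * delta)) Ei.
have feS := integrableS mF (mS _) (@strip_fluid _ D zeta (2 * delta)) fe.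
(* The constant is [1 + (1 + M) + 4]: the first part of [G], then [m p ^+ 2] through the slope
   bound, then Poincaré in depth [2 * delta] against the factor [delta ^- 2]. The product in the
   second part is split by completing a square, using [c p <= 2 / delta]. *)
have Gle : `|\int[volume]_(p in strip D zeta (2 * delta)) G p| <=
    (6 + M) * \int[volume]_(p in strip D zeta (2 * delta)) E p.
  have hi1 := integrableZ_EFin (2 + M) (mS _) EiS.
  have hi2 := integrableZ_EFin (delta ^- 2) (mS _) di.
  apply: le_trans (le_norm_Rintegral (mS _) _ _ (integrableD_EFin (mS _) hi1 hi2)) _.
  - apply: measurable_funS mF (@strip_fluid _ D zeta _) _.
    exact: integrable_measurable GEi.
  - move=> p Sp; have Dp := Sp.1.
    have /andP[w0 w1] := cutoff_bounds ((zeta p.1 - p.2) / delta).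
    have h1 : `|(1 - layer zeta delta p) * dot3 (v p) (grad chi p)| <= E p.
      rewrite normrM -[leRHS]mul1r ler_pM //.
        by rewrite ger0_norm ?subr_ge0 // gerBl.
      apply: le_trans (normr_dot3 _ _) _; rewrite lerD2l; exact: grad_le_energy.
    have m2 : m p ^+ 2 <= (1 + M) * E p.
      rewrite /m sqrrN; apply: le_trans (dot3_CauchySchwarz _ _) _.
      rewrite mulrC ler_pM ?dot3_ge0 //.
        by rewrite dot3_conormal addrC lerD2l slope.
      by rewrite /E lerDl energy_density_ge0.
    pose a := chi p - hat zeta chi p.1.
    have h2 : `|a * m p * c p| <= delta ^- 2 * a ^+ 2 + (1 + M) * E p.
      rewrite normrM (ger0_norm (c0 p)).
      apply: (@le_trans _ _ (`|a * m p| * (2 / delta))); first by rewrite ler_wpM2l.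
      apply: (@le_trans _ _ (delta ^- 2 * a ^+ 2 + m p ^+ 2)); last by rewrite lerD2l.
      rewrite normrM -(real_normK (num_real a)) -(real_normK (num_real (m p))).
      have := sqr_ge0 (`|a| / delta - `|m p|); rewrite -subr_ge0 => h.
      rewrite -subr_ge0; apply: le_trans h _; rewrite subr0 le_eqVlt; apply/orP; left; apply/eqP.
      by field; rewrite gt_eqF.
    apply: le_trans (ler_normD _ _) _.
    apply: le_trans (lerD h1 h2) _.
    by rewrite [leLHS](_ : _ = (2 + M) * E p + delta ^- 2 * a ^+ 2) //; ring.
  rewrite RintegralD // !RintegralZl //.
  have I1 : \int[volume]_(p in strip D zeta (2 * delta)) energy_density chi p <=
      \int[volume]_(p in strip D zeta (2 * delta)) E p.
    by apply: le_Rintegral => // p _; rewrite /E lerDr dot3_ge0.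
  have I2 : delta ^- 2 * \int[volume]_(p in strip D zeta (2 * delta))
      ((chi p - hat zeta chi p.1) ^+ 2) <= 4 * \int[volume]_(p in strip D zeta (2 * delta)) E p.
    apply: (@le_trans _ _ (delta ^- 2 * ((2 * delta) ^+ 2 * \int[volume]_(p in strip D zeta (2 * delta)) energy_density chi p))).
      by rewrite ler_wpM2l // invr_ge0 sqr_ge0.
    rewrite mulrA (_ : delta ^- 2 * _ = 4); last by field; rewrite gt_eqF.
    by rewrite ler_pM2l.
  apply: le_trans (lerD (lexx _) I2) _; rewrite -mulrDl.
  by rewrite (_ : 2 + M + 4 = 6 + M) //; ring.
rewrite FG GS -addrA; apply: le_trans (ler_normD _ _) _.
exact: lerD.
Qed.

(** Let [delta] tend to 0 in [green_layer]: the energy in the strip vanishes, and [m] becomes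
    uniformly close over [K] to its surface value. *)
Lemma green : \int[volume]_(p in fluid D zeta) dot3 (v p) (grad chi p) =
  \int[area]_(r in D) (hat zeta chi r * zeta_noise v zeta r).
Proof.
apply/eqP; rewrite -subr_eq0 -normr_le0; apply/ler_addgt0Pr => e e0; rewrite add0r.
have [A A0 AP] := @compact_bounded_fun _ K (hat zeta chi) cK
  (fun r Kr => continuous_hat cz (CkW Cchi) (KD Kr)).
have [B _ BP] := @compact_bounded_fun _ K (zeta_noise v zeta) cK
  (fun r Kr => zeta_noise_continuous (KD Kr)).
(* Half of the tolerance goes to the surface term; the [+ 1] keeps the denominator positive when [A]
   or the area of [K] is zero. *)
pose eps := e / 2 / (A * fine (area K) + 1).
have aK0 : 0 <= A * fine (area K) by rewrite mulr_ge0 // fine_ge0.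
have eps0 : 0 < eps by rewrite !divr_gt0 // ltr_wpDl.
have epsA : eps * (A * fine (area K)) <= e / 2.
  rewrite /eps -mulrA ler_piMr ?divr_ge0 // ?(ltW e0) //.
  by rewrite mulrC ler_pdivrMr ?mul1r ?lerDl // ltr_wpDl.
have cm r : D r -> {for (0 : R, (r, zeta r)), continuous (fun q : R * (R * R * R) => m q.2)}.
  move=> Dr; have cmr : {for (r, zeta r), continuous m}.
    apply: continuous_oppr_at.
    exact: (@continuous_dot3_conormal _ D zeta v (r, zeta r) Cz Cv Dr).
  by apply: (@continuous_comp _ _ _ snd m); [exact: cvg_snd|exact: cmr].
have [rho rho0 rhoP] := compact_uniform_trace KD cK cz cm eps0.
(* Here [delta] is the inverse of [n + 1]. Every point of the fluid has positive depth, hence leaves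
   these strips eventually. *)
pose S n := strip D zeta (2 * (n%:R + 1)^-1 : R).
have SL : (fun n => \int[volume]_(p in S n) E p) @ \oo --> (0 : R).
  apply: (shrinking_integral_cvg0 mF (fun n => mS _)) => //.
    by move=> n; exact: strip_fluid.
  move=> p [Dp zp]; have zp0 : 0 < (zeta p.1 - p.2) / 2 by lra.
  have := near_infty_natSinv_lt (PosNum zp0); apply: filterS => n /=.
  rewrite -natr1 => h [_ /andP[h1 _]]; lra.
have M0 : 0 < `|6 + M| + 1 by rewrite ltr_wpDl.
have near1 : \forall n \near \oo, 2 * (n%:R + 1)^-1 < rho.
  have r20 : 0 < rho / 2 by rewrite divr_gt0.
  have := near_infty_natSinv_lt (PosNum r20); apply: filterS => n /=.
  by rewrite -natr1 ltr_pdivlMr // mulrC.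
have near2 : \forall n \near \oo,
    `|\int[volume]_(p in S n) E p| <= e / 2 / (`|6 + M| + 1).
  by move/cvgr0_norm_le: SL; apply; rewrite !divr_gt0.
have [n [dr IE]] : exists n, 2 * (n%:R + 1)^-1 < rho /\
    `|\int[volume]_(p in S n) E p| <= e / 2 / (`|6 + M| + 1).
  by near \oo => n; exists n; split; near: n.
pose delta : R := (n%:R + 1)^-1.
have d0 : 0 < delta by rewrite invr_gt0 ltr_wpDl.
apply: le_trans (green_layer d0 A0 (ltW eps0) AP BP _) _.
  move=> r z Kr zr; rewrite zeta_noiseE.
  by apply: (rhoP 0 r z _ Kr); [rewrite normr0|exact: lt_trans zr dr].
rewrite [leRHS]splitr lerD //.
apply: le_trans (ler_norm _) _; rewrite normrM.
apply: (@le_trans _ _ ((`|6 + M| + 1) * (e / 2 / (`|6 + M| + 1)))).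
  by rewrite ler_pM // lerDl.
by rewrite mulrC divfK // gt_eqF.
Unshelve. all: by end_near. Qed.

End green_formula_proof.

(** * Nonnegative functions with zero integral *)

Section positivity.
Context d (T : measurableType d) {R : realType}.
Variable mu : {measure set T -> \bar R}.

Lemma Rintegral_eq0_null (A U : set T) (f : T -> R) : measurable A -> measurable U ->
  U `<=` A -> mu.-integrable A (EFin \o f) -> (forall x, A x -> 0 <= f x) ->
  \int[mu]_(x in A) f x = 0 -> (forall x, U x -> 0 < f x) -> mu U = 0%E.
Proof.
move=> mA mU UA fi f0 If fU.
have mf := measurable_int _ fi.
have : (\int[mu]_(x in A) `|(EFin \o f) x| = 0)%E.
  transitivity (\int[mu]_(x in A) (f x)%:E)%E.
    by apply: eq_integral => x; rewrite inE => Ax /=; rewrite ger0_norm // f0.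
  by rewrite -(fineK (integrable_fin_num mA fi)); congr EFin.
move=> /(ae_eq_integral_abs mu mA mf).1 [N [mN N0 NP]].
apply/eqP; rewrite eq_le measure_ge0 andbT -N0; apply: le_measure; rewrite ?inE //.
move=> x Ux; apply: NP => /(_ (UA _ Ux)) /= [] fx.
by have := fU _ Ux; rewrite fx ltxx.
Qed.

End positivity.

(** * Uniqueness of the gradient of the potential *)

Section uniqueness.
Context {R : realType}.
Implicit Types (D : set (R * R)) (zeta f : R * R -> R) (psi : R * R * R -> R).

Lemma dot3_eq0 (a : R * R * R) : dot3 a a = 0 -> a = 0.
Proof.
case: a => [[a1 a2] a3]; rewrite /dot3 /dot2 /= -!expr2 => h.
have E (x y z : R) : x ^+ 2 + y ^+ 2 + z ^+ 2 = 0 -> x = 0.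
  move=> e; apply/eqP; rewrite -sqrf_eq0 eq_le sqr_ge0 andbT.
  by have := sqr_ge0 y; have := sqr_ge0 z; lra.
have e2 : a2 ^+ 2 + a1 ^+ 2 + a3 ^+ 2 = 0 by rewrite -h; ring.
have e3 : a3 ^+ 2 + a1 ^+ 2 + a2 ^+ 2 = 0 by rewrite -h; ring.
by rewrite (E _ _ _ h) (E _ _ _ e2) (E _ _ _ e3).
Qed.

Lemma gradient_zero D zeta psi : open D -> (forall r, D r -> {for r, continuous zeta}) ->
  Ck 1 (column D) psi -> finite_energy D zeta psi ->
  \int[volume]_(p in fluid D zeta) dot3 (grad psi p) (grad psi p) = 0 ->
  forall p, D p.1 -> p.2 <= zeta p.1 -> grad psi p = 0.
Proof.
move=> oD cz Cpsi fe I0.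
pose h p := dot3 (grad psi p) (grad psi p).
have ch p : column D p -> {for p, continuous h}.
  by move=> Dp; exact: continuous_dot3_grad (Ck_field_grad Cpsi) Cpsi Dp.
have oF := open_fluid oD cz; have mF := open_measurable3 oF.
have chF p : fluid D zeta p -> {for p, continuous h} by move=> [Dp _]; exact: ch.
have hi : volume.-integrable (fluid D zeta) (EFin \o h).
  apply: (integrable_le mF _ _ fe); first exact: continuous_measurable_fun3.
  by move=> p _; rewrite ger0_norm ?dot3_ge0 // grad_le_energy.
have hF p : fluid D zeta p -> h p = 0.
  move=> Fp; apply/eqP; rewrite eq_le dot3_ge0 andbT leNgt; apply/negP => hp.
  have oU : open (fluid D zeta `&` h @^-1` [set x | 0 < x]).
    exact: (open_setI_preimage oF chF (@open_gt _ 0)).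
  have /(open_volume_gt0 oU) : (fluid D zeta `&` h @^-1` [set x | 0 < x]) p by split.
  have -> : volume (fluid D zeta `&` h @^-1` [set x | 0 < x]) = 0%E.
    exact: (Rintegral_eq0_null mF (open_measurable3 oU) (@subIsetl _ _ _) hi
      (fun q _ => dot3_ge0 _) I0 (fun q Uq => Uq.2)).
  by rewrite ltxx.
move=> p Dp pz; apply: dot3_eq0; rewrite -/(h p).
apply/eqP; rewrite eq_le dot3_ge0 andbT leNgt; apply/negP => hp.
have oU : open (column D `&` h @^-1` [set x | 0 < x]).
  exact: (open_setI_preimage (open_column oD) ch (@open_gt _ 0)).
have /open_nbhs_nbhs : open_nbhs p (column D `&` h @^-1` [set x | 0 < x]) by split.
move=> /nbhs_ballP[e /= e0 eP].
(* A point of the surface is outside the open fluid. Moving it down by [e / 2] enters the fluid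
   while staying where [h] is positive. *)
have [] := eP (p.1, p.2 - e / 2).
  split; rewrite /= -ball_normE /ball_ /= ?subrr ?normr0 //.
  by rewrite opprB addrC subrK ger0_norm ?divr_ge0 ?ltW // ltr_pdivrMr // ltr_pMr // ltr1n.
move=> _ /=; rewrite hF ?ltxx //; split => //=.
by apply: lt_le_trans pz; rewrite ltrBlDr ltrDl divr_gt0.
Qed.

Lemma derive_gradB psi1 psi2 D p : Ck 1 (column D) psi1 -> Ck 1 (column D) psi2 -> column D p ->
  grad (fun q => psi1 q - psi2 q) p = grad psi1 p - grad psi2 p.
Proof.
move=> C1 C2 Dp.
have E v : 'D_v (fun q => psi1 q - psi2 q) p = 'D_v psi1 p - 'D_v psi2 p.
  have d1 : derivable psi1 p v by apply: diff_derivable; exact: Ck_differentiable C1 Dp.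
  have d2 : derivable psi2 p v by apply: diff_derivable; exact: Ck_differentiable C2 Dp.
  exact: deriveB d1 d2.
by rewrite /grad /gradr /dz !E.
Qed.

Lemma Ck1_sub {V : normedModType R} (U : set V) (g h : V -> R) : open U ->
  Ck 1 U g -> Ck 1 U h -> Ck 1 U (fun x => g x - h x).
Proof.
move=> oU Cg Ch; have dg x := Ck_differentiable Cg (x := x).
have dh x := Ck_differentiable Ch (x := x).
split => [x Ux|v x Ux]; first exact: differentiableB (dg x Ux) (dh x Ux).
apply: (@continuous_at_congr _ _ _ _ (fun x => 'D_v g x - 'D_v h x) _ oU Ux).
  by move=> y Uy; apply: deriveB; apply: diff_derivable; auto.
case: (Cg) => _ /(_ v) cg; case: (Ch) => _ /(_ v) ch.
by apply: continuous_subr_at; [exact: cg|exact: ch].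
Qed.

Lemma dot3Bl (a b c : R * R * R) : dot3 (a - b) c = dot3 a c - dot3 b c.
Proof. by rewrite /dot3 /dot2 /=; ring. Qed.

Lemma addB3 (a1 a2 a3 b1 b2 b3 : R) :
  (a1 - b1) + (a2 - b2) + (a3 - b3) = a1 + a2 + a3 - (b1 + b2 + b3).
Proof. ring. Qed.

Lemma sqrB_le (a b : R) : (a - b) ^+ 2 <= 2 * a ^+ 2 + 2 * b ^+ 2.
Proof.
rewrite -subr_ge0 (_ : _ - _ = (a + b) ^+ 2) ?sqr_ge0 //; ring.
Qed.

Lemma energy_densityB_le D psi1 psi2 p : Ck 1 (column D) psi1 -> Ck 1 (column D) psi2 ->
  column D p -> energy_density (fun q => psi1 q - psi2 q) p <=
    2 * energy_density psi1 p + 2 * energy_density psi2 p.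
Proof.
move=> C1 C2 Dp; rewrite /energy_density (derive_gradB C1 C2 Dp).
have h1 := dot3D_le (grad psi1 p) (- grad psi2 p).
have h2 : dot3 (- grad psi2 p) (- grad psi2 p) = dot3 (grad psi2 p) (grad psi2 p).
  by rewrite -scaleN1r dot3ZZ sqrrN expr1n mul1r.
rewrite h2 in h1.
have h3 : (psi1 p - psi2 p) ^+ 2 / (1 + dot3 p p) <=
    (2 * psi1 p ^+ 2 + 2 * psi2 p ^+ 2) / (1 + dot3 p p).
  apply: ler_wpM2r; last exact: sqrB_le.
  by rewrite invr_ge0 addr_ge0 // dot3_ge0.
apply: le_trans (lerD h1 h3) _; rewrite le_eqVlt; apply/orP; left; apply/eqP; ring.
Qed.

Lemma finite_energyB D zeta psi1 psi2 : open D -> (forall r, D r -> {for r, continuous zeta}) ->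
  Ck 1 (column D) psi1 -> Ck 1 (column D) psi2 ->
  finite_energy D zeta psi1 -> finite_energy D zeta psi2 ->
  finite_energy D zeta (fun q => psi1 q - psi2 q).
Proof.
move=> oD cz C1 C2 f1 f2; have oF := open_fluid oD cz; have mF := open_measurable3 oF.
have CB := Ck1_sub (open_column oD) C1 C2.
apply: (integrable_le mF _ _ (integrableD_EFin mF (integrableZ_EFin 2 mF f1) (integrableZ_EFin 2 mF f2))).
  by apply: continuous_measurable_fun3 => // p [Dp _]; exact: continuous_energy_density CB Dp.
move=> p [Dp _]; rewrite ger0_norm ?energy_density_ge0 //.
exact: energy_densityB_le C1 C2 Dp.
Qed.

Lemma square_integrable_grad D zeta psi : open D -> (forall r, D r -> {for r, continuous zeta}) ->
  Ck 1 (column D) psi -> finite_energy D zeta psi -> square_integrable D zeta (grad psi).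
Proof.
move=> oD cz C1 f1; have oF := open_fluid oD cz; have mF := open_measurable3 oF.
apply: (integrable_le mF _ _ f1).
  apply: continuous_measurable_fun3 => // p [Dp _].
  exact: continuous_dot3_grad (Ck_field_grad C1) C1 Dp.
by move=> p _; rewrite ger0_norm ?dot3_ge0 // grad_le_energy.
Qed.

(** The difference of two potentials has zero trace and a solenoidal gradient without flux, so
    Green's formula applied to it makes its Dirichlet integral vanish. *)
Lemma potential_gradient_unique D zeta M f psi1 psi2 : open D -> Ck 1 D zeta ->
  (forall r, D r -> dot2 (grad2 zeta r) (grad2 zeta r) <= M) ->
  is_potential D zeta f psi1 -> is_potential D zeta f psi2 ->
  forall p, D p.1 -> p.2 <= zeta p.1 -> grad psi1 p = grad psi2 p.
Proof.
move=> oD Cz slope [C1 lap1 tr1 fe1 nf1] [C2 lap2 tr2 fe2 nf2].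
have cz r : D r -> {for r, continuous zeta} by exact: Ck_continuous Cz.
have oF := open_fluid oD cz; have mF := open_measurable3 oF.
have W1 := CkW C1; have W2 := CkW C2.
pose psi q := psi1 q - psi2 q; pose v q := grad psi1 q - grad psi2 q.
have Cpsi : Ck 1 (column D) psi by exact: Ck1_sub (open_column oD) W1 W2.
have fpsi : finite_energy D zeta psi by exact: finite_energyB.
have gv p : column D p -> grad psi p = v p by move=> Dp; exact: derive_gradB W1 W2 Dp.
have [a1 a2 a3] := Ck_field_grad C1; have [b1 b2 b3] := Ck_field_grad C2.
have Cv : Ck_field 1 (column D) v.
  split; [exact: (Ck1_sub (open_column oD) a1 b1)|exact: (Ck1_sub (open_column oD) a2 b2)|
    exact: (Ck1_sub (open_column oD) a3 b3)].
have dv p : column D p -> div v p = laplacian psi1 p - laplacian psi2 p.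
  move=> Dp; rewrite /laplacian /div.
  have E (w : R * R * R) (g h : R * R * R -> R) : Ck 1 (column D) g -> Ck 1 (column D) h ->
      'D_w (fun q => g q - h q) p = 'D_w g p - 'D_w h p.
    move=> Cg Ch; have d1 : derivable g p w by apply: diff_derivable; exact: Ck_differentiable Cg Dp.
    have d2 : derivable h p w by apply: diff_derivable; exact: Ck_differentiable Ch Dp.
    exact: deriveB d1 d2.
  have e1 := E ex _ _ a1 b1; have e2 := E ey _ _ a2 b2; have e3 := E ez _ _ a3 b3.
  exact: (etrans (congr2 +%R (congr2 +%R e1 e2) e3) (addB3 _ _ _ _ _ _)).
have vi : square_integrable D zeta v.
  apply: eq_integrable_EFin (square_integrable_grad oD cz Cpsi fpsi) => // p [Dp _].
  by rewrite gv.
have nfv : no_flux D zeta v.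
  move=> chi Cchi fchi chi0.
  (* Integrability of each part is what allows the two flux identities to be subtracted. *)
  have i1 := integrable_dot3_grad oD Cz (Ck_field_grad W1) (square_integrable_grad oD cz W1 fe1) Cchi fchi.
  have i2 := integrable_dot3_grad oD Cz (Ck_field_grad W2) (square_integrable_grad oD cz W2 fe2) Cchi fchi.
  have z1 := nf1 _ Cchi fchi chi0; have z2 := nf2 _ Cchi fchi chi0.
  rewrite -[RHS](subrr (\int[volume]_(p in fluid D zeta) dot3 (grad psi1 p) (grad chi p))).
  have {}z1 : \int[volume]_(p in fluid D zeta) dot3 (grad psi1 p) (grad chi p) = 0.
    rewrite -z1; apply: eq_Rintegral => p; rewrite inE => Fp.
    by have := lap1 _ Fp; rewrite /laplacian => ->; rewrite mulr0 addr0.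
  have {}z2 : \int[volume]_(p in fluid D zeta) dot3 (grad psi2 p) (grad chi p) = 0.
    rewrite -z2; apply: eq_Rintegral => p; rewrite inE => Fp.
    by have := lap2 _ Fp; rewrite /laplacian => ->; rewrite mulr0 addr0.
  rewrite [X in _ - X]z1 -[X in _ - X]z2 -RintegralB //.
  apply: eq_Rintegral => p; rewrite inE => Fp.
  rewrite dv ?lap1 ?lap2 //; last by case: Fp.
  by rewrite subrr mulr0 addr0 /v dot3Bl.
(* The trace of [psi] vanishes on all of [D], so its support can be taken empty. *)
have := @green R D set0 zeta M psi oD Cz slope Cpsi fpsi compact0 (@sub0set _ D) _ v (CkW_field Cv) _ vi nfv.
move=> gr p Dp pz; apply/subr0_eq; rewrite -/(v p) -gv //.
apply: (gradient_zero oD cz Cpsi fpsi _ Dp pz).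
transitivity (\int[volume]_(p in fluid D zeta) dot3 (v p) (grad psi p)).
  by apply: eq_Rintegral => q; rewrite inE => -[Dq _]; rewrite -gv.
have tr0 r : D r -> hat zeta psi r = 0.
  by move=> Dr; rewrite /hat /psi; have := tr1 _ Dr; have := tr2 _ Dr; rewrite /hat => -> ->; rewrite subrr.
rewrite gr.
- rewrite /Rintegral integral0_eq // => r Dr; by rewrite tr0 // mul0r.
- by move=> r Dr _; exact: tr0.
- by move=> q Fq; rewrite dv ?lap1 ?lap2 ?subrr //; case: Fq.
Qed.

(** [psi] shows that a potential exists, so [xget] does return one and not its default value. *)
Lemma potential_gradient D zeta M f psi : open D -> Ck 1 D zeta ->
  (forall r, D r -> dot2 (grad2 zeta r) (grad2 zeta r) <= M) ->
  is_potential D zeta f psi ->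
  forall p, D p.1 -> p.2 <= zeta p.1 -> grad (potential D zeta f) p = grad psi p.
Proof.
move=> oD Cz slope psiP.
apply: (potential_gradient_unique oD Cz slope _ psiP).
exact: (@xgetPex _ (cst 0) _ (ex_intro _ psi psiP)).
Qed.

End uniqueness.

(** * Symmetry of second derivatives *)

Section mixed_derivatives.
Context {R : realType} {V : normedModType R}.
Implicit Types (f : V -> R) (U : set V).

Lemma mean_value_path f (gam : R -> V) (u : V) (s : R) : 0 < s ->
  (forall h t, gam (h + t) = h *: u + gam t) ->
  (forall t, 0 <= t <= s -> differentiable f (gam t)) ->
  exists2 t, 0 < t < s & f (gam s) - f (gam 0) = s * 'D_u f (gam t).
Proof.
move=> s0 gamE df.
have dP t : 0 <= t <= s -> is_derive t (1 : R) (f \o gam) ('D_u f (gam t)).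
  move=> ts; apply: is_derive_path => [h|]; first exact: gamE.
  by apply: diff_derivable; exact: df.
have dP' t : t \in `]0, s[ -> is_derive t (1 : R) (f \o gam) ('D_u f (gam t)).
  by rewrite in_itv /= => /andP[t0 ts]; apply: dP; rewrite !ltW.
have cP : {within `[0, s], continuous (f \o gam)}.
  apply: derivable_within_continuous => t; rewrite in_itv /= => ts.
  by case: (dP t ts).
have [t] := MVT s0 dP' cP.
by rewrite in_itv /= => tP E; exists t => //; rewrite [LHS]E subr0 mulrC.
Qed.

(** The mean value theorem is used twice: along [u] for the increment of [f] by [s *: w], then along
    [w] for ['D_u f]. *)
Lemma second_difference U f (x u w : V) (s : R) : 0 < s -> Ck 2 U f ->
  (forall a b, 0 <= a <= s -> 0 <= b <= s -> U (x + a *: u + b *: w)) ->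
  exists a b, [/\ 0 < a < s, 0 < b < s &
    f (x + s *: u + s *: w) - f (x + s *: u) - f (x + s *: w) + f x =
      s * s * 'D_w ('D_u f) (x + a *: u + b *: w)].
Proof.
move=> s0 Cf US.
have s1 : 0 <= s <= s by apply/andP; split => //; exact: ltW.
have z1 : 0 <= (0 : R) <= s by apply/andP; split => //; exact: ltW.
have Cu : Ck 1 U ('D_u f) by case: Cf => _ /(_ u).
pose g y := f (y + s *: w) - f y.
have dsh t : 0 <= t <= s -> differentiable (fun y => f (y + s *: w)) (x + t *: u).
  move=> ts; apply: (@differentiable_comp _ _ _ _ (fun y => y + s *: w) f).
    by apply: differentiableD => //.
  exact: (Ck_differentiable Cf (US _ _ ts s1)).
have df t : 0 <= t <= s -> differentiable f (x + t *: u).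
  by move=> ts; have := US _ _ ts z1; rewrite scale0r addr0; exact: Ck_differentiable Cf.
have line y (v : V) h t : y + (h + t) *: v = h *: v + (y + t *: v).
  by rewrite scalerDl addrCA.
have [a /andP[a0 as_] E1] := @mean_value_path g (fun t => x + t *: u) u s s0
  (line x u) (fun t ts => differentiableB (dsh t ts) (df t ts)).
have as1 : 0 <= a <= s by rewrite !ltW.
have gu : 'D_u g (x + a *: u) = 'D_u f (x + a *: u + s *: w) - 'D_u f (x + a *: u).
  have d1 : derivable (fun y => f (y + s *: w)) (x + a *: u) u.
    by apply: diff_derivable; exact: dsh.
  have d2 : derivable f (x + a *: u) u by apply: diff_derivable; exact: df.
  transitivity ('D_u (fun y => f (y + s *: w)) (x + a *: u) - 'D_u f (x + a *: u)).
    exact: deriveB d1 d2.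
  congr (_ - _); rewrite /derive /=.
  have E : (fun h : R => h^-1 *: (f (h *: u + (x + a *: u) + s *: w) - f (x + a *: u + s *: w))) =
    (fun h => h^-1 *: (f (h *: u + (x + a *: u + s *: w)) - f (x + a *: u + s *: w))).
    by apply/funext => h; rewrite -!addrA.
  by rewrite E.
have [b /andP[b0 bs] E2] := @mean_value_path ('D_u f) (fun t => x + a *: u + t *: w) w s s0
  (line _ w)
  (fun t ts => Ck_differentiable Cu (US _ _ as1 ts)).
exists a, b; split; [by rewrite a0|by rewrite b0|].
move: E1 E2; rewrite /g gu !scale0r !addr0 => E1 E2.
by rewrite -mulrA -E2 -E1; ring.
Qed.

Lemma dist_split (A B X e : R) : `|A - X| <= e / 2 -> `|B - X| <= e / 2 -> `|A - B| <= e.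
Proof.
move=> h1 h2; have := ler_distD X A B; move/le_trans; apply.
by rewrite [leRHS]splitr lerD // distrC.
Qed.

(** The second difference is symmetric in [u] and [w], so both mixed derivatives take a common value
    at points close to [x], and continuity concludes. This lets a bound on the gradient of an
    [e]-derivative control the [e]-derivative of the gradient. *)
Lemma mixed_derivatives_eq U f (x u w : V) : open U -> U x -> Ck 2 U f ->
  'D_u ('D_w f) x = 'D_w ('D_u f) x.
Proof.
move=> oU Ux Cf; apply/eqP; rewrite -subr_eq0 -normr_le0; apply/ler_addgt0Pr => e e0.
rewrite add0r.
have e20 : 0 < e / 2 by rewrite divr_gt0.
have c1 : {for x, continuous ('D_u ('D_w f))}.
  by case: Cf => _ /(_ w) [_ /(_ u)] /(_ _ Ux).
have c2 : {for x, continuous ('D_w ('D_u f))}.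
  by case: Cf => _ /(_ u) [_ /(_ w)] /(_ _ Ux).
have /cvgr_dist_le /(_ _ e20) n1 := c1.
have /cvgr_dist_le /(_ _ e20) n2 := c2.
have n3 : nbhs x (U `&` ((fun y => `|'D_u ('D_w f) x - 'D_u ('D_w f) y| <= e / 2) `&`
    (fun y => `|'D_w ('D_u f) x - 'D_w ('D_u f) y| <= e / 2))).
  exact: (filterI (open_nbhs_nbhs (conj oU Ux)) (filterI n1 n2)).
move: n3 => /nbhs_ballP[rho /= rho0 rhoP].
pose N := `|u| + `|w| + 1.
have N0 : 0 < N by rewrite ltr_wpDl // addr_ge0.
(* Chosen so that the parallelogram of sides [s *: u] and [s *: w] lies within [rho / 2] of [x]. *)
pose s := rho / 2 / N.
have s0 : 0 < s by rewrite !divr_gt0.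
have inball a b : 0 <= a <= s -> 0 <= b <= s -> ball x rho (x + a *: u + b *: w).
  move=> /andP[a0 a1] /andP[b0 b1]; rewrite -ball_normE /ball_ /= -addrA opprD addNKr normrN.
  apply: le_lt_trans (ler_normD _ _) _; rewrite !normrZ (ger0_norm a0) (ger0_norm b0).
  apply: (@le_lt_trans _ _ (s * N)); last first.
    by rewrite divfK ?gt_eqF // ltr_pdivrMr // ltr_pMr // ltr1n.
  rewrite /N mulrDr mulr1 mulrDr.
  apply: (@le_trans _ _ (s * `|u| + s * `|w|)); last by rewrite lerDl ltW.
  by rewrite lerD // ler_wpM2r.
have [a [b [/andP[a0 a1] /andP[b0 b1] E1]]] := second_difference s0 Cf
  (fun a b ha hb => (rhoP _ (inball a b ha hb)).1).
have inball' c d : 0 <= c <= s -> 0 <= d <= s -> U (x + c *: w + d *: u).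
  by move=> hc hd; rewrite addrAC; exact: (rhoP _ (inball d c hd hc)).1.
(* The same second difference with [u] and [w] exchanged; the intermediate points differ, but both
   lie in the ball. *)
have [c [d [/andP[c0 c1'] /andP[d0 d1] E2]]] := second_difference s0 Cf inball'.
have EE : 'D_w ('D_u f) (x + a *: u + b *: w) = 'D_u ('D_w f) (x + d *: u + c *: w).
  apply: (@mulfI _ (s * s)); first by rewrite mulf_neq0 // gt_eqF.
  rewrite (addrAC x (d *: u)); apply: etrans (esym E1) (etrans _ E2).
  rewrite (addrAC x (s *: u) (s *: w)).
  by rewrite (addrAC (f (x + s *: w + s *: u)) (- f (x + s *: u)) (- f (x + s *: w))).
have cl t : 0 < t -> t < s -> 0 <= t <= s by move=> ? ?; rewrite !ltW.
have h1 := (rhoP _ (inball a b (cl _ a0 a1) (cl _ b0 b1))).2.2.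
have h2 := (rhoP _ (inball d c (cl _ d0 d1) (cl _ c0 c1'))).2.1.
rewrite EE in h1.
exact: (dist_split h2 h1).
Qed.

End mixed_derivatives.

(** * Integrals with compact support and differences of half-lines *)

Section compact_support.
Context {R : realType}.
Local Notation mu := (@lebesgue_measure R).
Implicit Types (D K : set (R * R)) (f : R * R -> R).

Lemma integrable_compact_support D K f : open D -> compact K -> K `<=` D ->
  (forall r, D r -> {for r, continuous f}) -> (forall r, D r -> ~ K r -> f r = 0) ->
  area.-integrable D (EFin \o f).
Proof.
move=> oD cK KD cf f0.
have mD := open_measurable2 oD; have mK := compact_measurable2 cK.
have [B B0 BP] := compact_bounded_fun cK (fun r Kr => cf r (KD r Kr)).
apply: (integrable_subset mD mK KD f0).
apply: (measurable_bounded_integrable mK (compact_area_fin cK)).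
  by apply: measurable_funS mD KD _; exact: continuous_measurable_fun2.
exists B; split; first exact: num_real.
by move=> x Bx r Kr /=; exact: le_trans (BP _ Kr) (ltW Bx).
Qed.

Lemma Rintegral_compact_support_le D K f (C : R) : open D -> compact K -> K `<=` D ->
  (forall r, D r -> {for r, continuous f}) -> (forall r, D r -> ~ K r -> f r = 0) ->
  (forall r, K r -> `|f r| <= C) ->
  `|\int[area]_(r in D) f r| <= C * fine (area K).
Proof.
move=> oD cK KD cf f0 fC.
have mD := open_measurable2 oD; have mK := compact_measurable2 cK.
have fi := integrable_compact_support oD cK KD cf f0.
rewrite (Rintegral_subset area KD f0) -(Rintegral_cst area mK).
apply: (le_norm_Rintegral mK _ fC).
  by apply: measurable_funS mD KD _; exact: continuous_measurable_fun2.
apply: (measurable_bounded_integrable mK (compact_area_fin cK)); first exact: measurable_cst.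
exists `|C|; split; first exact: num_real.
by move=> x Bx r Kr /=; exact: ltW.
Qed.

(** The vertical slice of the difference between the indicators of two fluids when the surface moves
    from height [a] to [a + t]. Being signed, it covers rising and falling surfaces alike. *)
Definition jump (a t z : R) : R := (z < a + t)%R%:R - (z < a)%R%:R.

Lemma jump_pos a t z : 0 <= t -> jump a t z = \1_(`[a, a + t[%classic) z.
Proof.
move=> t0; rewrite /jump indicE mem_setE in_itv /=.
have [za|za] := ltP z a; last by rewrite subr0.
by rewrite (lt_le_trans za) ?lerDl // subrr.
Qed.

Lemma jump_neg a t z : t <= 0 -> jump a t z = - \1_(`[a + t, a[%classic) z.
Proof.
move=> t0; rewrite /jump indicE mem_setE in_itv /=.
have [za|za] := ltP z (a + t); last by rewrite sub0r.
by rewrite (lt_le_trans za) ?gerDl // subrr oppr0.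
Qed.

Lemma integral_jump (a t : R) : (\int[mu]_z (jump a t z)%:E = t%:E)%E /\
  (\int[mu]_z `|jump a t z|%:E = `|t|%:E)%E.
Proof.
have I (x y : R) : x <= y -> (\int[mu]_z (\1_(`[x, y[%classic) z)%:E = (y - x)%:E)%E.
  move=> xy; rewrite integral_indic // setIT.
  have := lebesgue_measure_itv `[x, y[; rewrite /= lte_fin => ->.
  by case: ltP => [_|yx]; [rewrite EFinB|rewrite (le_anti (introT andP (conj xy yx))) subrr].
have [t0|/ltW t0] := leP 0 t.
  have J : (\int[mu]_z (jump a t z)%:E = t%:E)%E.
    rewrite (eq_integral (fun z : measurableTypeR R => (\1_(`[a, (a + t)%R[%classic) z)%:E)); last first.
      by move=> z _; rewrite jump_pos.
    by rewrite I ?lerDl // addrC addKr.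
  split => //; rewrite ger0_norm // -J; apply: eq_integral => z _.
  by rewrite jump_pos // ger0_norm // indicE.
have J : (\int[mu]_z `|jump a t z|%:E = `|t|%:E)%E.
  rewrite (eq_integral (fun z : measurableTypeR R => (\1_(`[(a + t)%R, a[%classic) z)%:E)); last first.
    by move=> z _; rewrite jump_neg // normrN ger0_norm // indicE.
  by rewrite I ?gerDl // ler0_norm // opprD addrA subrr sub0r.
split => //; rewrite (eq_integral (fun z : measurableTypeR R => - `|jump a t z|%:E)%E); last first.
  by move=> z _; rewrite jump_neg // normrN ger0_norm ?indicE // EFinN.
by rewrite integral_ge0N // J -EFinN ler0_norm // opprK.
Qed.

End compact_support.

(** * Integrals over a fluid whose surface moves *)

Section moving_surface.
Context {R : realType}.
Local Notation mu := (@lebesgue_measure R).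
Variables (D K : set (R * R)) (zeta eta : R * R -> R) (e0 : R) (G : R * (R * R * R) -> R).
Hypotheses (oD : open D) (cz : forall r, D r -> {for r, continuous zeta}).
Hypotheses (ceta : forall r, D r -> {for r, continuous eta}).
Hypotheses (cK : compact K) (KD : K `<=` D) (eta0 : forall r, ~ K r -> eta r = 0).
Hypotheses (e00 : 0 < e0).
Hypothesis cG : forall e p, `|e| < e0 -> column D p -> {for (e, p), continuous G}.
Hypothesis Gi : forall e, `|e| < e0 ->
  volume.-integrable (fluid D zeta) (EFin \o (fun p => G (e, p))).

Let zeta_ e r := zeta r + e * eta r.

Lemma continuous_perturbed e r : D r -> {for r, continuous (zeta_ e)}.
Proof.
move=> Dr; apply: continuous_addr_at; first exact: cz.
by apply: continuous_mulr_at; [exact: continuous_cst_at|exact: ceta].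
Qed.

(** The difference of the two indicators is a kernel within [|e| * B] of the old surface, with
    vertical integral [e * eta]. Its mass being of order [e], [kernel_estimate] gives an error that
    is small compared with [e]. *)
Lemma moving_surface (eps : R) : 0 < eps -> exists2 rho, 0 < rho & forall e, `|e| < rho ->
  volume.-integrable (fluid D (zeta_ e)) (EFin \o (fun p => G (e, p))) /\
  `|\int[volume]_(p in fluid D (zeta_ e)) G (e, p) - \int[volume]_(p in fluid D zeta) G (e, p)
    - e * \int[area]_(r in D) (eta r * G (0, (r, zeta r)))| <= eps * `|e|.
Proof.
move=> eps0; have mK := compact_measurable2 cK; have Kfin := compact_area_fin cK.
have [B B0 BP] := compact_bounded_fun cK (fun r Kr => ceta (KD Kr)).
pose Fh r := G (0, (r, zeta r)).
have cG0 r : D r -> {for (0, (r, zeta r)), continuous G}.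
  by move=> Dr; apply: cG; rewrite ?normr0.
have cFh r : D r -> {for r, continuous Fh}.
  move=> Dr; apply: (@continuous_comp _ _ _ (fun r => (0 : R, (r, zeta r))) G); last exact: cG0.
  apply: continuous_pair_at; first exact: continuous_cst_at.
  by apply: continuous_pair_at; [exact: cvg_id|exact: cz].
have [C C0 CP] := compact_bounded_fun cK (fun r Kr => cFh r (KD Kr)).
have BK0 : 0 <= B * fine (area K) by rewrite mulr_ge0 // fine_ge0.
have BK1 : 0 < B * fine (area K) + 1 by rewrite ltr_wpDl.
pose eps' := eps / (B * fine (area K) + 1).
have eps'0 : 0 < eps' by rewrite divr_gt0.
have [rho1 rho10 rho1P] := compact_uniform_trace KD cK cz cG0 eps'0.
have B1 : 0 < B + 1 by rewrite ltr_wpDl.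
(* The radius [rho1] has to dominate both [e] itself and the displacement of the surface, at most
   [|e| * B]. *)
exists (Num.min e0 (Num.min rho1 (rho1 / (B + 1)))).
  by rewrite !lt_min e00 rho10 divr_gt0.
move=> e; rewrite !lt_min => /and3P[ee0 erho1 erhoB].
have eB : `|e| * B < rho1.
  apply: le_lt_trans (_ : `|e| * (B + 1) < _); first by rewrite ler_wpM2l // lerDl.
  by rewrite -ltr_pdivlMr.
have mC := measurable_column oD.
have oF := open_fluid oD cz; have mF := open_measurable3 oF.
have oFe := open_fluid oD (@continuous_perturbed e); have mFe := open_measurable3 oFe.
have FC : fluid D zeta `<=` column D by move=> p [].
have FeC : fluid D (zeta_ e) `<=` column D by move=> p [].
have cGe p : column D p -> {for p, continuous (fun p => G (e, p))}.
  move=> Dp; apply: (@continuous_comp _ _ _ (fun p => (e, p)) G); last exact: cG.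
  by apply: continuous_pair_at; [exact: continuous_cst_at|exact: cvg_id].
pose k (p : R * R * R) : R := \1_(fluid D (zeta_ e)) p - \1_(fluid D zeta) p.
have kE r z : D r -> k (r, z) = jump (zeta r) (e * eta r) z.
  move=> Dr; have mE (h : R * R -> R) : ((r, z) \in fluid D h) = (z < h r).
    by apply/idP/idP => [|zh]; rewrite inE; [case|split].
  by rewrite /k /jump !indicE !mE.
have kK p : D p.1 -> k p != 0 -> K p.1 /\ `|p.2 - zeta p.1| <= `|e * eta p.1|.
  case: p => r z /= Dr; rewrite kE //.
  have [Kr|nK] := pselect (K r); last first.
    by rewrite /jump eta0 // mulr0 addr0 subrr eqxx.
  move=> h; split => //; move: h.
  have [t0|/ltW t0] := leP 0 (e * eta r).
    rewrite jump_pos // indicE mem_setE in_itv /=.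
    case: (boolP (_ && _)) => [/andP[h1 h2] _|_]; last by rewrite eqxx.
    by rewrite !ger0_norm ?subr_ge0 // lerBlDl ltW.
  rewrite jump_neg // indicE mem_setE in_itv /=.
  case: (boolP (_ && _)) => [/andP[h1 h2] _|_]; last by rewrite oppr0 eqxx.
  rewrite !ler0_norm ?subr_le0 //; last exact: ltW.
  by rewrite lerN2 lerBrDl.
have [] := @kernel_estimate R D K (fun p => G (e, p)) k Fh (fun r => e * eta r)
  (`|e| * B) C eps' oD mK KD Kfin.
- by apply: continuous_measurable_fun3 => //; exact: open_column.
- by apply: measurable_funB; apply: measurable_funTS; exact: measurable_indic.
- exact: continuous_measurable_fun2.
- apply: continuous_measurable_fun2 => // r Dr.
  by apply: continuous_mulr_at; [exact: continuous_cst_at|exact: ceta].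
- by rewrite mulr_ge0.
- exact: ltW.
- move=> [r z] Dr /(kK _ Dr) [/= Kr zr]; split => //.
  apply: rho1P => //; apply: le_lt_trans zr _; apply: le_lt_trans eB.
  by rewrite normrM ler_wpM2l // BP.
- exact: CP.
- by move=> r Kr; rewrite normrM ler_wpM2l // BP.
- move=> r Kr; have Dr := KD Kr.
  rewrite (eq_integral (fun z : measurableTypeR R => `|jump (zeta r) (e * eta r) z|%:E)); last first.
    by move=> z _; rewrite kE.
  by rewrite (integral_jump _ _).2 lee_fin normrM ler_wpM2l // BP.
- move=> r Kr; have Dr := KD Kr.
  rewrite (eq_integral (fun z : measurableTypeR R => (jump (zeta r) (e * eta r) z)%:E)); last first.
    by move=> z _; rewrite kE.
  by rewrite (integral_jump _ _).1.
- by move=> r _ nK; rewrite eta0 // mulr0.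
move=> kGi efi kle.
(* Integrability over the displaced fluid is obtained here: on the column, [h1] is the kernel term
   plus [h0], both of which are integrable. *)
pose h0 p := \1_(fluid D zeta) p * G (e, p).
pose h1 p := \1_(fluid D (zeta_ e)) p * G (e, p).
have h0F p : fluid D zeta p -> G (e, p) = h0 p by move=> Fp; rewrite /h0 indicE mem_set // mul1r.
have h1F p : fluid D (zeta_ e) p -> h1 p = G (e, p) by move=> Fp; rewrite /h1 indicE mem_set // mul1r.
have h00 p : column D p -> ~ fluid D zeta p -> h0 p = 0.
  by move=> _ nF; rewrite /h0 indicE memNset // mul0r.
have h10 p : column D p -> ~ fluid D (zeta_ e) p -> h1 p = 0.
  by move=> _ nF; rewrite /h1 indicE memNset // mul0r.
have h0i : volume.-integrable (column D) (EFin \o h0).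
  by apply: (integrable_subset mC mF FC h00); exact: eq_integrable_EFin (Gi ee0).
have h1i : volume.-integrable (column D) (EFin \o h1).
  apply: eq_integrable_EFin (integrableD_EFin mC kGi h0i) => // p _.
  by rewrite /k /h0 /h1 -mulrDl subrK.
split.
  by apply: eq_integrable_EFin (integrableS mC mFe FeC h1i).
have E1 : \int[volume]_(p in fluid D (zeta_ e)) G (e, p) = \int[volume]_(p in column D) h1 p.
  rewrite (Rintegral_subset volume FeC h10); apply: eq_Rintegral => p.
  by rewrite inE => /h1F.
have E0 : \int[volume]_(p in fluid D zeta) G (e, p) = \int[volume]_(p in column D) h0 p.
  by rewrite (Rintegral_subset volume FC h00); apply: eq_Rintegral => p; rewrite inE => /h0F.
have E2 : \int[volume]_(p in column D) (k p * G (e, p)) =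
    \int[volume]_(p in column D) h1 p - \int[volume]_(p in column D) h0 p.
  rewrite -RintegralB //; apply: eq_Rintegral => p _.
  by rewrite /k /h0 /h1 mulrBl.
have E3 : \int[area]_(r in D) (e * eta r * Fh r) = e * \int[area]_(r in D) (eta r * Fh r).
  rewrite -RintegralZl; first by apply: eq_Rintegral => r _; rewrite mulrA.
    exact: open_measurable2.
  apply: (integrable_compact_support oD cK KD) => r Dr.
    by apply: continuous_mulr_at; [exact: ceta|exact: cFh].
  by move=> nK; rewrite eta0 // mul0r.
rewrite E1 E0 -E2 -E3; apply: le_trans kle _.
rewrite /eps' -mulrA [X in _ * X](_ : _ = `|e| * ((B * fine (area K)) / (B * fine (area K) + 1))); last first.
  by rewrite mulrC -!mulrA.
rewrite ler_wpM2l ?(ltW eps0) // ler_piMr // ler_pdivrMr // mul1r lerDl //.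
Qed.

End moving_surface.

(** * Slices at a fixed value of the parameter [e] *)

Section slices.
Context {R : realType} {V : normedModType R}.
Implicit Types (F : R * V -> R) (U : set (R * V)).

Lemma derive_slice F (e : R) (p w : V) :
  'D_w (fun q => F (e, q)) p = 'D_((0 : R), w) F (e, p).
Proof.
rewrite /derive.
have E : (fun h : R => h^-1 *: (((fun q => F (e, q)) \o shift p) (h *: w) - F (e, p))) =
    (fun h => h^-1 *: ((F \o shift (e, p)) (h *: ((0 : R), w)) - F (e, p))).
  apply/funext => h /=; congr (_ *: (F _ - _)); congr (_, _) => /=.
  by rewrite scaler0 add0r.
by rewrite E.
Qed.

Lemma derive_scale {W : normedModType R} (h : W -> R) (x w : W) (a : R) :
  differentiable h x -> 'D_(a *: w) h x = a * 'D_w h x.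
Proof. by move=> dh; rewrite !deriveE // linearZ. Qed.

(** The path [t * e] with [t] in [[0, 1]] treats both signs of [e] at once. *)
Lemma slice_mean_value U F (e : R) (p : V) : Ck 1 U F ->
  (forall t, `|t| <= `|e| -> U (t, p)) ->
  exists t, `|t| <= `|e| /\ F (e, p) - F (0, p) = e * 'D_((1 : R), (0 : V)) F (t, p).
Proof.
move=> CF HU.
have te t : 0 <= t <= 1 -> `|t * e| <= `|e|.
  by move=> /andP[t0 t1]; rewrite normrM (ger0_norm t0) ler_piMl.
have pathE h t : ((h + t) * e, p) = h *: (e *: ((1 : R), (0 : V))) + (t * e, p).
  by congr (_, _) => /=; rewrite ?scaler0 ?add0r // mulrDl; congr (_ + _); rewrite /GRing.scale /= mulr1.
have [t /andP[t0 t1] E] := mean_value_path ltr01 pathE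
  (fun t ht => Ck_differentiable CF (HU _ (te _ ht))).
have t01 : 0 <= t <= 1 by rewrite !ltW.
exists (t * e); split; first exact: te.
rewrite mul1r mul0r mul1r in E; rewrite E.
by rewrite derive_scale //; exact: (Ck_differentiable CF (HU _ (te _ t01))).
Qed.

End slices.

(** * Change of the potential on the fixed fluid *)

Section surface_variation.
Context {R : realType}.
Local Notation mu := (@lebesgue_measure R).
Variables (D K : set (R * R)) (zeta eta kappa f : R * R -> R) (M e0 : R).
Variables (Phi : R * (R * R * R) -> R) (b : R * R * R -> R).
Hypotheses (oD : open D) (Cz : Ck 1 D zeta).
Hypothesis slope : forall r, D r -> dot2 (grad2 zeta r) (grad2 zeta r) <= M.
Hypotheses (ceta : forall r, D r -> {for r, continuous eta}).
Hypotheses (ckappa : forall r, D r -> {for r, continuous kappa}).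
Hypotheses (cK : compact K) (KD : K `<=` D).
Hypotheses (eta0 : forall r, ~ K r -> eta r = 0) (kappa0 : forall r, ~ K r -> kappa r = 0).
Hypothesis e00 : 0 < e0.
Hypothesis CPhi : Ck 2 [set q | `|q.1| < e0 /\ column D q.2] Phi.
Hypothesis pot : forall e, `|e| < e0 ->
  is_potential D (fun r => zeta r + e * eta r) (fun r => f r + e * kappa r)
    (fun p => Phi (e, p)).
Hypothesis bi : volume.-integrable (fluid D zeta) (EFin \o b).
Hypothesis bP : forall e p, `|e| < e0 -> fluid D zeta p ->
  energy_density (fun q => 'D_((1 : R), (0 : R * R * R)) Phi (e, q)) p <= b p.

Let U0 : set (R * (R * R * R)) := [set q | `|q.1| < e0 /\ column D q.2].
Let P e p := Phi (e, p).
Let chi e p := P e p - P 0 p.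

Let cz r : D r -> {for r, continuous zeta}.
Proof. exact: Ck_continuous Cz. Qed.

Let oF : open (fluid D zeta). Proof. exact: open_fluid. Qed.
Let mF : measurable3 (fluid D zeta). Proof. exact: open_measurable3. Qed.

Let oU0 : open U0.
Proof.
have -> : U0 = (fst @^-1` [set t : R | `|t| < e0]) `&` (snd @^-1` column D).
  by apply/seteqP; split => q [].
apply: openI.
  apply: open_comp => [q _|]; first exact: cvg_fst.
  have -> : [set t : R | `|t| < e0] = ball (0 : R) e0.
    by rewrite -ball_normE; apply/seteqP; split => t; rewrite /ball_ /= sub0r normrN.
  exact: ball_open.
by apply: open_comp => [q _|]; [exact: cvg_snd|exact: open_column].
Qed.

Let zero_lt : `|0 : R| < e0. Proof. by rewrite normr0. Qed.

Let potential0 : is_potential D zeta f (P 0).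
Proof.
have := pot zero_lt; congr is_potential; apply/funext => r; by rewrite mul0r addr0.
Qed.

Let CP e : `|e| < e0 -> Ck 2 (column D) (P e). Proof. by move=> /pot[]. Qed.

Let Cchi e : `|e| < e0 -> Ck 1 (column D) (chi e).
Proof. by move=> ee0; exact: (Ck1_sub (open_column oD) (CkW (CP ee0)) (CkW (CP zero_lt))). Qed.

Lemma dot3_sqr (a : R * R * R) : dot3 a a = a.1.1 ^+ 2 + a.1.2 ^+ 2 + a.2 ^+ 2.
Proof. by rewrite /dot3 /dot2 -!expr2. Qed.

(** The mean value theorem in [e] gives a different intermediate parameter for each of the three
    partial derivatives and for the value. Each of the four terms of the energy density is therefore
    bounded separately by [e ^+ 2 * b p], whence the factor 4. *)
Lemma energy_variation_le e p : `|e| < e0 -> fluid D zeta p ->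
  energy_density (chi e) p <= 4 * e ^+ 2 * b p.
Proof.
move=> ee0 Fp; have Dp := Fp.1.
have HU t : `|t| <= `|e| -> U0 (t, p) by move=> te; split => //; exact: le_lt_trans te ee0.
have slopeE w : exists t, `|t| < e0 /\ 'D_w (chi e) p =
    e * 'D_w (fun q => 'D_((1 : R), (0 : R * R * R)) Phi (t, q)) p.
  have Cw : Ck 1 U0 ('D_((0 : R), w) Phi) by case: CPhi => _; apply.
  have [t [te E]] := slice_mean_value Cw HU; exists t; split; first exact: le_lt_trans te ee0.
  have d1 : derivable (P e) p w by apply: diff_derivable; exact: Ck_differentiable (CP ee0) Dp.
  have d2 : derivable (P 0) p w by apply: diff_derivable; exact: Ck_differentiable (CP zero_lt) Dp.
  transitivity ('D_w (P e) p - 'D_w (P 0) p); first exact: deriveB d1 d2.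
  (* [bP] bounds spatial derivatives of the [e]-derivative, whereas the mean value theorem yields
     them in the other order. *)
  have Esym : 'D_((0 : R), w) ('D_((1 : R), (0 : R * R * R)) Phi) (t, p) =
      'D_((1 : R), (0 : R * R * R)) ('D_((0 : R), w) Phi) (t, p).
    exact: (mixed_derivatives_eq _ _ oU0 (HU _ te) CPhi).
  have Es := derive_slice (fun x => 'D_((1 : R), (0 : R * R * R)) Phi x) t p w.
  rewrite [in RHS]Es Esym.
  by rewrite /P (derive_slice Phi e) (derive_slice Phi 0).
have sq_le w : (exists t, `|t| < e0 /\ 'D_w (chi e) p =
    e * 'D_w (fun q => 'D_((1 : R), (0 : R * R * R)) Phi (t, q)) p) ->
    (forall h : R * R * R -> R, ('D_w h p) ^+ 2 <= dot3 (grad h p) (grad h p)) ->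
    ('D_w (chi e) p) ^+ 2 <= e ^+ 2 * b p.
  move=> [t [te ->]] hw; rewrite exprMn ler_wpM2l ?sqr_ge0 //.
  by apply: le_trans (hw _) (le_trans (grad_le_energy _ _) (bP te Fp)).
have hx := sq_le ex (slopeE ex); have hy := sq_le ey (slopeE ey); have hz := sq_le ez (slopeE ez).
have dotE (h : R * R * R -> R) : dot3 (grad h p) (grad h p) =
    ('D_ex h p) ^+ 2 + ('D_ey h p) ^+ 2 + ('D_ez h p) ^+ 2 by exact: dot3_sqr.
have {}hx : ('D_ex (chi e) p) ^+ 2 <= e ^+ 2 * b p.
  by apply: hx => h; rewrite dotE -addrA lerDl addr_ge0 ?sqr_ge0.
have {}hy : ('D_ey (chi e) p) ^+ 2 <= e ^+ 2 * b p.
  by apply: hy => h; rewrite dotE addrAC lerDr addr_ge0 ?sqr_ge0.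
have {}hz : ('D_ez (chi e) p) ^+ 2 <= e ^+ 2 * b p.
  by apply: hz => h; rewrite dotE lerDr addr_ge0 ?sqr_ge0.
have h0 : chi e p ^+ 2 / (1 + dot3 p p) <= e ^+ 2 * b p.
  have [t [te E]] := slice_mean_value (CkW CPhi) HU.
  rewrite /chi /P E exprMn -mulrA ler_wpM2l ?sqr_ge0 //.
  apply: le_trans (bP (le_lt_trans te ee0) Fp).
  by rewrite /energy_density lerDr dot3_ge0.
rewrite /energy_density dotE.
apply: le_trans (lerD (lerD (lerD hx hy) hz) h0) _.
by rewrite le_eqVlt; apply/orP; left; apply/eqP; ring.
Qed.

Lemma variation_finite_energy e : `|e| < e0 -> finite_energy D zeta (chi e).
Proof.
move=> ee0; apply: (integrable_le mF _ _ (integrableZ_EFin (4 * e ^+ 2) mF bi)).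
  apply: continuous_measurable_fun3 => // p [Dp _].
  exact: continuous_energy_density (Cchi ee0) Dp.
by move=> p Fp; rewrite ger0_norm ?energy_density_ge0 //; exact: energy_variation_le.
Qed.

Let trace e r : `|e| < e0 -> D r ->
  P e (r, zeta r + e * eta r) = f r + e * kappa r.
Proof. by move=> /pot[_ _ tr _ _] Dr; exact: (tr r Dr). Qed.

Lemma trace_variation_outside e r : `|e| < e0 -> D r -> ~ K r -> hat zeta (chi e) r = 0.
Proof.
move=> ee0 Dr nK; have := trace ee0 Dr; have := trace zero_lt Dr.
rewrite /hat /chi eta0 // kappa0 // !mulr0 !addr0 => -> ->; exact: subrr.
Qed.

(** The trace of [P e] is prescribed at height [zeta r + e * eta r]. Coming back to [zeta r] along
    the vertical costs [e * eta r] times a vertical derivative of [P e] in between, uniformly close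
    over [K] to that of [P 0] at the surface. *)
Lemma trace_variation eps : 0 < eps -> exists2 rho, 0 < rho & forall e r, `|e| < rho -> K r ->
  `|hat zeta (chi e) r - e * (kappa r - eta r * dz (P 0) (r, zeta r))| <= eps * `|e|.
Proof.
move=> eps0.
have [B B0 BP] := compact_bounded_fun cK (fun r Kr => ceta (KD Kr)).
have B1 : 0 < B + 1 by rewrite ltr_wpDl.
have C3 : Ck 1 U0 ('D_((0 : R), ez) Phi) by case: CPhi => _; apply.
have [rho1 rho10 rho1P] := compact_uniform_trace KD cK cz
  (fun r Dr => Ck_continuous C3 (conj zero_lt Dr : U0 (0, (r, zeta r)))) (divr_gt0 eps0 B1).
exists (Num.min e0 (Num.min rho1 (rho1 / (B + 1)))).
  by rewrite !lt_min e00 rho10 divr_gt0.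
move=> e r; rewrite !lt_min => /and3P[ee0 erho1 erhoB] Kr; have Dr := KD Kr.
have eB : `|e| * B < rho1.
  apply: le_lt_trans (_ : `|e| * (B + 1) < _); first by rewrite ler_wpM2l // lerDl.
  by rewrite -ltr_pdivlMr.
pose a := e * eta r.
have aB : `|a| <= `|e| * B by rewrite normrM ler_wpM2l // BP.
have pathE h t : (r, zeta r + (h + t) * a) = h *: (a *: (ez : R * R * R)) + (r, zeta r + t * a).
  rewrite /ez; congr (_, _) => /=; first by rewrite !scaler0 add0r.
  by rewrite /GRing.scale /= mulr1; ring.
have [t /andP[t0 t1] E] := mean_value_path ltr01 pathE
  (fun t _ => Ck_differentiable (CP ee0) (x := (r, zeta r + t * a)) Dr).
have dP : differentiable (P e) (r, zeta r + t * a).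
  exact: (Ck_differentiable (CP ee0) (x := (r, zeta r + t * a)) Dr).
rewrite mul1r mul0r addr0 mul1r (derive_scale _ _ dP) /P (derive_slice Phi e) in E.
have Eh : hat zeta (chi e) r = e * kappa r - a * 'D_((0 : R), ez) Phi (e, (r, zeta r + t * a)).
  rewrite -E; have := trace ee0 Dr; have := trace zero_lt Dr.
  rewrite /hat /chi /P !mul0r !addr0 -/a => -> ->; ring.
have -> : hat zeta (chi e) r - e * (kappa r - eta r * dz (P 0) (r, zeta r)) =
    - (a * ('D_((0 : R), ez) Phi (e, (r, zeta r + t * a)) - 'D_((0 : R), ez) Phi (0, (r, zeta r)))).
  by rewrite Eh /dz /P (derive_slice Phi 0) /a; ring.
rewrite normrN normrM.
have ta : `|zeta r + t * a - zeta r| < rho1.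
  rewrite addrC addKr normrM (ger0_norm (ltW t0)).
  by apply: le_lt_trans (le_trans _ aB) eB; rewrite ler_piMl // ltW.
apply: le_trans (ler_pM (normr_ge0 _) (normr_ge0 _) aB (rho1P _ _ _ erho1 Kr ta)) _.
rewrite mulrC -!mulrA ler_wpM2l ?(ltW eps0) // mulrCA ler_piMr //.
by rewrite mulrC ler_pdivrMr // mul1r lerDl.
Qed.

Variable v : R * R * R -> R * R * R.
Hypothesis Cv : Ck_field 0 (column D) v.
Hypothesis div0 : forall p, fluid D zeta p -> div v p = 0.
Hypothesis vi : square_integrable D zeta v.
Hypothesis nf : no_flux D zeta v.

Let w r := (kappa r - eta r * dz (P 0) (r, zeta r)) * zeta_noise v zeta r.

Lemma continuous_boundary_weight r : D r ->
  {for r, continuous (fun r => kappa r - eta r * dz (P 0) (r, zeta r))}.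
Proof.
move=> Dr; apply: continuous_subr_at; first exact: ckappa.
apply: continuous_mulr_at; first exact: ceta.
have C1 : Ck 0 (column D) (dz (P 0)) by case: (CkW (CP zero_lt)) => _ /(_ ez).
exact: continuous_hat cz C1 Dr.
Qed.

(** Green's formula replaces the unknown change of potential in the interior by its trace, whose
    first-order part is given by [trace_variation]. *)
Lemma bulk_variation eps : 0 < eps -> exists2 rho, 0 < rho & forall e, `|e| < rho ->
  `|\int[volume]_(p in fluid D zeta) dot3 (v p) (grad (chi e) p)
    - e * \int[area]_(r in D) w r| <= eps * `|e|.
Proof.
move=> eps0.
have cm r : D r -> {for r, continuous (zeta_noise v zeta)} by exact: zeta_noise_continuous.
have [B B0 BP] := compact_bounded_fun cK (fun r Kr => cm r (KD Kr)).
have BK0 : 0 <= B * fine (area K) by rewrite mulr_ge0 // fine_ge0.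
have BK1 : 0 < B * fine (area K) + 1 by rewrite ltr_wpDl.
have [rho rho0 rhoP] := trace_variation (divr_gt0 eps0 BK1).
exists (Num.min e0 rho); first by rewrite lt_min e00.
move=> e; rewrite lt_min => /andP[ee0 erho].
have mD := open_measurable2 oD.
have cw r : D r -> {for r, continuous w}.
  by move=> Dr; apply: continuous_mulr_at; [exact: continuous_boundary_weight|exact: cm].
have w0 r : D r -> ~ K r -> w r = 0.
  by move=> _ nK; rewrite /w kappa0 // eta0 // mul0r subrr mul0r.
have wi := integrable_compact_support oD cK KD cw w0.
pose h r := hat zeta (chi e) r * zeta_noise v zeta r.
have ch r : D r -> {for r, continuous h}.
  move=> Dr; apply: continuous_mulr_at; last exact: cm.
  exact: continuous_hat cz (CkW (Cchi ee0)) Dr.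
have h0 r : D r -> ~ K r -> h r = 0.
  by move=> Dr nK; rewrite /h trace_variation_outside // mul0r.
have hi := integrable_compact_support oD cK KD ch h0.
rewrite (green oD Cz slope (Cchi ee0) (variation_finite_energy ee0) cK KD _ Cv div0 vi nf);
  last by move=> r Dr nK; exact: trace_variation_outside.
rewrite -RintegralZl // -RintegralB //; last exact: integrableZ_EFin.
apply: (@le_trans _ _ (eps / (B * fine (area K) + 1) * `|e| * B * fine (area K))).
  apply: (Rintegral_compact_support_le oD cK KD) => r Dr.
  - by apply: continuous_subr_at; [exact: ch|apply: continuous_mulr_at; [exact: continuous_cst_at|exact: cw]].
  - by move=> nK; rewrite w0 // mulr0 subr0; exact: h0.
  rewrite /w mulrA -mulrBl normrM ler_pM //; last exact: BP.
  exact: rhoP.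
rewrite -!mulrA ler_wpM2l ?(ltW eps0) // mulrCA ler_piMr //.
by rewrite mulrC ler_pdivrMr // mul1r lerDl.
Qed.

End surface_variation.

(** * First variations of the two volume integrals *)

Section functional_variation.
Context {R : realType}.
Local Notation mu := (@lebesgue_measure R).
Variables (D K : set (R * R)) (zeta eta kappa f : R * R -> R) (M e0 : R).
Variables (Phi : R * (R * R * R) -> R) (b : R * R * R -> R).
Hypotheses (oD : open D) (Cz : Ck 1 D zeta).
Hypothesis slope : forall r, D r -> dot2 (grad2 zeta r) (grad2 zeta r) <= M.
Hypotheses (ceta : forall r, D r -> {for r, continuous eta}).
Hypotheses (ckappa : forall r, D r -> {for r, continuous kappa}).
Hypotheses (cK : compact K) (KD : K `<=` D).
Hypotheses (eta0 : forall r, ~ K r -> eta r = 0) (kappa0 : forall r, ~ K r -> kappa r = 0).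
Hypothesis e00 : 0 < e0.
Hypothesis CPhi : Ck 2 [set q | `|q.1| < e0 /\ column D q.2] Phi.
Hypothesis pot : forall e, `|e| < e0 ->
  is_potential D (fun r => zeta r + e * eta r) (fun r => f r + e * kappa r)
    (fun p => Phi (e, p)).
Hypothesis bi : volume.-integrable (fluid D zeta) (EFin \o b).
Hypothesis bP : forall e p, `|e| < e0 -> fluid D zeta p ->
  energy_density (fun q => 'D_((1 : R), (0 : R * R * R)) Phi (e, q)) p <= b p.

Let P e p := Phi (e, p).
Let chi e p := P e p - P 0 p.

Let cz r : D r -> {for r, continuous zeta}.
Proof. exact: Ck_continuous Cz. Qed.

Let mF : measurable3 (fluid D zeta).
Proof. by apply: open_measurable3; exact: open_fluid. Qed.

Let zero_lt : `|0 : R| < e0. Proof. by rewrite normr0. Qed.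

Let CP e : `|e| < e0 -> Ck 2 (column D) (P e). Proof. by move=> /pot[]. Qed.

Lemma potential_at0 : is_potential D zeta f (P 0).
Proof.
by have := pot zero_lt; congr is_potential; apply/funext => r; rewrite mul0r addr0.
Qed.

Let grad_chi e p : `|e| < e0 -> column D p -> grad (P e) p = grad (P 0) p + grad (chi e) p.
Proof.
move=> ee0 Dp; rewrite (derive_gradB (CkW (CP ee0)) (CkW (CP zero_lt)) Dp).
by rewrite addrC subrK.
Qed.

Let chi_energy e : `|e| < e0 -> finite_energy D zeta (chi e).
Proof. exact: (variation_finite_energy oD Cz e00 CPhi pot bi bP). Qed.

Let Cchi e : `|e| < e0 -> Ck 1 (column D) (chi e).
Proof. by move=> ee0; exact: (Ck1_sub (open_column oD) (CkW (CP ee0)) (CkW (CP zero_lt))). Qed.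

(** The spatial gradient, written with derivatives of the joint function [Phi], so that it is
    continuous in [e] and the position together. *)
Let jgrad (q : R * (R * R * R)) : R * R * R :=
  (('D_((0 : R), (ex : R * R * R)) Phi q, 'D_((0 : R), (ey : R * R * R)) Phi q),
   'D_((0 : R), (ez : R * R * R)) Phi q).

Let jgradE e p : jgrad (e, p) = grad (P e) p.
Proof. by rewrite /grad /gradr /dz /P !(derive_slice Phi e). Qed.

Let cjgrad (u : R * R * R) e p : `|e| < e0 -> column D p ->
  {for (e, p), continuous ('D_((0 : R), u) Phi)}.
Proof.
move=> ee0 Dp.
have C1 : Ck 1 [set q | `|q.1| < e0 /\ column D q.2] ('D_((0 : R), u) Phi).
  by case: CPhi => _; apply.
exact: (Ck_continuous C1 (conj ee0 Dp : [set q | `|q.1| < e0 /\ column D q.2] (e, p))).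
Qed.

Let zeta0 : (fun r => zeta r + 0 * eta r) = zeta.
Proof. by apply/funext => r; rewrite mul0r addr0. Qed.

Lemma norm_split2 (x y A : R) : `|x| <= A / 2 -> `|y| <= A / 2 -> `|x + y| <= A.
Proof. by move=> h1 h2; apply: le_trans (ler_normD _ _) _; rewrite [leRHS]splitr lerD. Qed.

Let w (v : R * R * R -> R * R * R) r :=
  (kappa r - eta r * dz (P 0) (r, zeta r)) * zeta_noise v zeta r.

(** [N] stands for the integral at the perturbed state, [I0] for the unperturbed one, and [S1] for
    the term linear in the change of potential; [combine3] adds the quadratic term [S2]. *)
Lemma combine2 (e eps N I0 S1 A C : R) :
  `|N - (I0 + S1) - e * A| <= eps / 2 * `|e| -> `|S1 - e * C| <= eps / 2 * `|e| ->
  `|N - I0 - e * (A + C)| <= eps * `|e|.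
Proof.
move=> h1 h2.
rewrite (_ : N - I0 - e * (A + C) = (N - (I0 + S1) - e * A) + (S1 - e * C)); last by ring.
have E : eps * `|e| / 2 = eps / 2 * `|e| by ring.
by rewrite -E in h1 h2; exact: norm_split2 h1 h2.
Qed.

Lemma combine3 (e eps N I0 S1 S2 A C : R) :
  `|N - (I0 + S1 + S2) - e * A| <= eps / 2 * `|e| -> `|S1 - e * C| <= eps / 2 / 2 * `|e| ->
  `|S2| <= eps * `|e| / 2 / 2 -> `|N - I0 - e * (A + C)| <= eps * `|e|.
Proof.
move=> h1 h2 h3.
rewrite (_ : N - I0 - e * (A + C) = (N - (I0 + S1 + S2) - e * A) + ((S1 - e * C) + S2)); last by ring.
have E : eps * `|e| / 2 = eps / 2 * `|e| by ring.
have E' : eps * `|e| / 2 / 2 = eps / 2 / 2 * `|e| by ring.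
by rewrite -E in h1; rewrite -E' in h2; exact: (norm_split2 h1 (norm_split2 h2 h3)).
Qed.

Lemma boundary_weight_integrable v : Ck_field 0 (column D) v ->
  area.-integrable D (EFin \o w v).
Proof.
move=> Cv; apply: (integrable_compact_support oD cK KD) => r Dr.
  apply: continuous_mulr_at; last exact: (zeta_noise_continuous Cz Cv Dr).
  exact: (continuous_boundary_weight Cz ceta ckappa e00 pot).
by move=> nK; rewrite /w kappa0 // eta0 // mul0r subrr mul0r.
Qed.

Lemma surface_integrable (h : R * R * R -> R) : Ck 0 (column D) h ->
  area.-integrable D (EFin \o (fun r => eta r * h (r, zeta r))).
Proof.
move=> Ch; apply: (integrable_compact_support oD cK KD) => r Dr.
  by apply: continuous_mulr_at; [exact: ceta|exact: continuous_hat cz Ch Dr].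
by move=> nK; rewrite eta0 // mul0r.
Qed.

(** The integrand is linear in the potential, so on the fixed fluid it splits exactly. The term with
    [eta] is the displacement of the domain, and [w v] comes from the change of trace. *)
Lemma noise_variation v : Ck_field 0 (column D) v ->
  (forall p, fluid D zeta p -> div v p = 0) -> square_integrable D zeta v ->
  no_flux D zeta v ->
  is_derive (0 : R) (1 : R) (fun e => \int[volume]_(p in fluid D (fun r => zeta r + e * eta r))
      dot3 (v p) (grad (P e) p))
    (\int[area]_(r in D) (eta r * dot3 (v (r, zeta r)) (grad (P 0) (r, zeta r)) + w v r)).
Proof.
move=> Cv div0 vi nf; have [v1 v2 v3] := Cv.
pose G (q : R * (R * R * R)) := dot3 (v q.2) (jgrad q).
have cG e p : `|e| < e0 -> column D p -> {for (e, p), continuous G}.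
  move=> ee0 Dp; apply: continuous_dot3; try exact: cjgrad.
  - by apply: (@continuous_comp _ _ _ snd (fun p => (v p).1.1)); [exact: cvg_snd|exact: v1].
  - by apply: (@continuous_comp _ _ _ snd (fun p => (v p).1.2)); [exact: cvg_snd|exact: v2].
  - by apply: (@continuous_comp _ _ _ snd (fun p => (v p).2)); [exact: cvg_snd|exact: v3].
have [C0 _ _ fe0 _] := potential_at0.
have GE e p : G (e, p) = dot3 (v p) (grad (P e) p) by rewrite /G jgradE.
have i0 := integrable_dot3_grad oD Cz Cv vi (CkW C0) fe0.
have i1 e (ee0 : `|e| < e0) := integrable_dot3_grad oD Cz Cv vi (Cchi ee0) (chi_energy ee0).
have Gsum e p : `|e| < e0 -> fluid D zeta p ->
    dot3 (v p) (grad (P 0) p) + dot3 (v p) (grad (chi e) p) = G (e, p).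
  by move=> ee0 [Dp _]; rewrite GE (grad_chi ee0 Dp) dot3Dr.
have Gi e : `|e| < e0 -> volume.-integrable (fluid D zeta) (EFin \o (fun p => G (e, p))).
  move=> ee0; apply: eq_integrable_EFin (integrableD_EFin mF i0 (i1 _ ee0)) => // p.
  exact: Gsum.
apply: is_derive_estimate => eps eps0; have eps20 : 0 < eps / 2 by rewrite divr_gt0.
have [r1 r10 r1P] := moving_surface oD cz ceta cK KD eta0 e00 cG Gi eps20.
have [r2 r20 r2P] := bulk_variation oD Cz slope ceta ckappa cK KD eta0 kappa0 e00 CPhi pot bi bP
  Cv div0 vi nf eps20.
exists (Num.min e0 (Num.min r1 r2)); first by rewrite !lt_min e00 r10.
move=> e; rewrite !lt_min => /and3P[ee0 er1 er2]; rewrite addr0 zeta0.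
have [_ h1] := r1P _ er1; have h2 := r2P _ er2.
have EN : \int[volume]_(p in fluid D (fun r => zeta r + e * eta r)) dot3 (v p) (grad (P e) p) =
    \int[volume]_(p in fluid D (fun r => zeta r + e * eta r)) G (e, p).
  by apply: eq_Rintegral => p _; rewrite GE.
have Es : \int[volume]_(p in fluid D zeta) G (e, p) =
    \int[volume]_(p in fluid D zeta) dot3 (v p) (grad (P 0) p) +
    \int[volume]_(p in fluid D zeta) dot3 (v p) (grad (chi e) p).
  apply: etrans (RintegralD mF i0 (i1 _ ee0)).
  by apply: eq_Rintegral => p /set_mem Fp; exact: esym (Gsum _ _ ee0 Fp).
have EL : \int[area]_(r in D) (eta r * dot3 (v (r, zeta r)) (grad (P 0) (r, zeta r)) + w v r) =
    \int[area]_(r in D) (eta r * G (0, (r, zeta r))) + \int[area]_(r in D) w v r.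
  have -> : \int[area]_(r in D) (eta r * G (0, (r, zeta r))) =
      \int[area]_(r in D) (eta r * dot3 (v (r, zeta r)) (grad (P 0) (r, zeta r))).
    by apply: eq_Rintegral => r _; rewrite GE.
  have si := surface_integrable (h := fun p => dot3 (v p) (grad (P 0) p))
    (fun p Dp => continuous_dot3_grad Cv (CkW C0) Dp).
  exact: (RintegralD (open_measurable2 oD) si (boundary_weight_integrable Cv)).
rewrite Es in h1; rewrite EN EL; exact: (combine2 h1 h2).
Qed.

(** The cross term of the expanded square is the linear case with [v] the unperturbed gradient,
    which is solenoidal because the potential is harmonic. The remaining square is of second order
    in [e]. *)
Lemma kinetic_variation :
  is_derive (0 : R) (1 : R) (fun e => \int[volume]_(p in fluid D (fun r => zeta r + e * eta r))
      (2^-1 * dot3 (grad (P e) p) (grad (P e) p)))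
    (\int[area]_(r in D) (eta r * (2^-1 * dot3 (grad (P 0) (r, zeta r)) (grad (P 0) (r, zeta r)))
      + w (grad (P 0)) r)).
Proof.
pose G (q : R * (R * R * R)) := 2^-1 * dot3 (jgrad q) (jgrad q).
have cG e p : `|e| < e0 -> column D p -> {for (e, p), continuous G}.
  move=> ee0 Dp; apply: continuous_mulr_at; first exact: continuous_cst_at.
  by apply: continuous_dot3; exact: cjgrad.
have [C0 lap0 _ fe0 nf0] := potential_at0.
have Cv := Ck_field_grad (CkW C0).
have vi := square_integrable_grad oD cz (CkW C0) fe0.
have GE e p : G (e, p) = 2^-1 * dot3 (grad (P e) p) (grad (P e) p) by rewrite /G jgradE.
have i0 := integrableZ_EFin 2^-1 mF vi.
have i1 e (ee0 : `|e| < e0) := integrable_dot3_grad oD Cz Cv vi (Cchi ee0) (chi_energy ee0).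
have i2 e (ee0 : `|e| < e0) := integrableZ_EFin 2^-1 mF
  (square_integrable_grad oD cz (Cchi ee0) (chi_energy ee0)).
have square_sum (x y : R * R * R) : 2^-1 * dot3 x x + dot3 x y + 2^-1 * dot3 y y =
    2^-1 * dot3 (x + y) (x + y).
  by rewrite /dot3 /dot2 /=; field.
have Gsum e p : `|e| < e0 -> fluid D zeta p ->
    2^-1 * dot3 (grad (P 0) p) (grad (P 0) p) + dot3 (grad (P 0) p) (grad (chi e) p)
      + 2^-1 * dot3 (grad (chi e) p) (grad (chi e) p) = G (e, p).
  by move=> ee0 [Dp _]; rewrite GE (grad_chi ee0 Dp) square_sum.
have Gi e : `|e| < e0 -> volume.-integrable (fluid D zeta) (EFin \o (fun p => G (e, p))).
  move=> ee0; apply: eq_integrable_EFin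
    (integrableD_EFin mF (integrableD_EFin mF i0 (i1 _ ee0)) (i2 _ ee0)) => // p.
  exact: Gsum.
pose B := \int[volume]_(p in fluid D zeta) b p.
(* Half of the bound in [energy_variation_le], integrated; the absolute value of [B] saves proving
   its sign. *)
have quad e : `|e| < e0 ->
    `|\int[volume]_(p in fluid D zeta) (2^-1 * dot3 (grad (chi e) p) (grad (chi e) p))| <=
    2 * e ^+ 2 * `|B|.
  move=> ee0; apply: (@le_trans _ _ (2 * e ^+ 2 * B)); last first.
    by apply: ler_wpM2l; [rewrite mulr_ge0 ?sqr_ge0|exact: ler_norm].
  rewrite /B -RintegralZl //.
  apply: (le_norm_Rintegral mF _ _ (integrableZ_EFin (2 * e ^+ 2) mF bi)).
    exact: integrable_measurable (i2 _ ee0).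
  move=> p Fp; rewrite ger0_norm ?mulr_ge0 ?dot3_ge0 //.
  have h1 := grad_le_energy (chi e) p.
  have h2 := energy_variation_le oD e00 CPhi pot bP ee0 Fp.
  rewrite (_ : 2 * e ^+ 2 * b p = 2^-1 * (4 * e ^+ 2 * b p)); last by field.
  by rewrite ler_pM2l ?invr_gt0 //; exact: le_trans h1 h2.
apply: is_derive_estimate => eps eps0; have eps20 : 0 < eps / 2 by rewrite divr_gt0.
have eps40 : 0 < eps / 2 / 2 by rewrite divr_gt0.
have [r1 r10 r1P] := moving_surface oD cz ceta cK KD eta0 e00 cG Gi eps20.
have [r2 r20 r2P] := bulk_variation oD Cz slope ceta ckappa cK KD eta0 kappa0 e00 CPhi pot bi bP
  Cv lap0 vi nf0 eps40.
have B1 : 0 < 2 * `|B| + 1 by rewrite ltr_wpDl // mulr_ge0.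
(* A quarter of the tolerance is left for the quadratic term, and for [|e| < r3] that term stays
   within it. *)
pose r3 := eps / 2 / 2 / (2 * `|B| + 1).
have r30 : 0 < r3 by rewrite divr_gt0.
exists (Num.min e0 (Num.min r1 (Num.min r2 r3))); first by rewrite !lt_min e00 r10 r20.
move=> e; rewrite !lt_min => /and4P[ee0 er1 er2 er3]; rewrite addr0 zeta0.
have [_ h1] := r1P _ er1; have h2 := r2P _ er2.
have h3 : `|\int[volume]_(p in fluid D zeta) (2^-1 * dot3 (grad (chi e) p) (grad (chi e) p))| <=
    eps * `|e| / 2 / 2.
  apply: le_trans (quad _ ee0) _.
  rewrite -(real_normK (num_real e)) expr2.
  apply: (@le_trans _ _ (`|e| * (r3 * (2 * `|B| + 1)))).
    rewrite (_ : 2 * _ * _ = `|e| * (`|e| * (2 * `|B|))); last by ring.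
    rewrite ler_wpM2l // ler_pM ?mulr_ge0 ?(ltW er3) // lerDl //.
  rewrite /r3 divfK ?gt_eqF //.
  by rewrite (_ : `|e| * (eps / 2 / 2) = eps * `|e| / 2 / 2) //; ring.
have EN : \int[volume]_(p in fluid D (fun r => zeta r + e * eta r))
      (2^-1 * dot3 (grad (P e) p) (grad (P e) p)) =
    \int[volume]_(p in fluid D (fun r => zeta r + e * eta r)) G (e, p).
  by apply: eq_Rintegral => p _; rewrite GE.
have Es : \int[volume]_(p in fluid D zeta) G (e, p) =
    \int[volume]_(p in fluid D zeta) (2^-1 * dot3 (grad (P 0) p) (grad (P 0) p)) +
    \int[volume]_(p in fluid D zeta) dot3 (grad (P 0) p) (grad (chi e) p) +
    \int[volume]_(p in fluid D zeta) (2^-1 * dot3 (grad (chi e) p) (grad (chi e) p)).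
  apply: etrans (etrans (RintegralD mF (integrableD_EFin mF i0 (i1 _ ee0)) (i2 _ ee0)) _).
    by apply: eq_Rintegral => p /set_mem Fp; exact: esym (Gsum _ _ ee0 Fp).
  by congr (_ + _); exact: (RintegralD mF i0 (i1 _ ee0)).
have EL : \int[area]_(r in D) (eta r * (2^-1 * dot3 (grad (P 0) (r, zeta r)) (grad (P 0) (r, zeta r)))
      + w (grad (P 0)) r) =
    \int[area]_(r in D) (eta r * G (0, (r, zeta r))) + \int[area]_(r in D) w (grad (P 0)) r.
  have -> : \int[area]_(r in D) (eta r * G (0, (r, zeta r))) =
      \int[area]_(r in D) (eta r * (2^-1 * dot3 (grad (P 0) (r, zeta r)) (grad (P 0) (r, zeta r)))).
    by apply: eq_Rintegral => r _; rewrite GE.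
  have si := surface_integrable (h := fun p => 2^-1 * dot3 (grad (P 0) p) (grad (P 0) p))
    (fun p Dp => continuous_mulr_at (continuous_cst_at (c := 2^-1) (x := p))
      (continuous_dot3_grad Cv (CkW C0) Dp)).
  exact: (RintegralD (open_measurable2 oD) si (boundary_weight_integrable Cv)).
rewrite Es in h1; rewrite EN EL; exact: (combine3 h1 h2 h3).
Qed.

End functional_variation.

(** * The flat function built from [exp(-1/x)] *)

Section flat_exponential.
Context {R : realType}.
Implicit Types p : {poly R}.

(** For each monomial of degree [n > 0], raising [y / n <= 1 + y / n <= expR (y / n)] to the power
    [n] gives the constant [n ^+ n]. *)
Lemma horner_le_expR p : exists2 C : R, 0 <= C & forall y, 0 <= y -> `|p.[y]| <= C * expR y.
Proof.
exists (\sum_(i < size p) `|p`_i| * (i%:R ^+ i)).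
  by apply: sumr_ge0 => i _; rewrite mulr_ge0 // exprn_ge0.
move=> y y0; rewrite horner_coef mulr_suml; apply: le_trans (ler_norm_sum _ _ _) _.
apply: ler_sum => i _; rewrite normrM -mulrA ler_wpM2l // ger0_norm ?exprn_ge0 //.
case: (nat_of_ord i) => [|n]; first by rewrite !expr0 mul1r -expR0 ler_expR.
have n0 : (0 : R) < n.+1%:R by rewrite ltr0n.
have -> : expR y = expR (y / n.+1%:R) ^+ n.+1.
  by rewrite -expRM_natl; congr expR; rewrite mulrC divfK // gt_eqF.
rewrite -exprMn lerXn2r ?nnegrE ?mulr_ge0 ?expR_ge0 ?(ltW n0) //.
rewrite -ler_pdivrMl // mulrC; apply: le_trans (expR_ge1Dx _).
by rewrite lerDr.
Qed.

(* Derivatives of exp(-1/x) are of the same form, with another polynomial. *)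
Definition flat_exp p (x : R) : R := if 0 < x then p.[x^-1] * expR (- x^-1) else 0.

Lemma is_derive_flat_exp p x :
  is_derive x (1 : R) (flat_exp p) (flat_exp ('X^2 * (p - p^`())) x).
Proof.
have [x0|x0|x0] := ltgtP x 0.
- apply: (@near_eq_is_derive _ _ _ (cst 0)).
    near=> y; rewrite /flat_exp ifF //; apply/negbTE; rewrite -leNgt ltW //.
    by near: y; exact: lt_nbhsl.
  by rewrite /flat_exp ifF; [exact: is_derive_cst|apply/negbTE; rewrite -leNgt ltW].
- apply: (@near_eq_is_derive _ R R (fun y : R => p.[y^-1] * expR (- y^-1))).
    near=> y; rewrite /flat_exp ifT //.
    by near: y; exact: lt_nbhsr.
  have xn0 : x != 0 by rewrite gt_eqF.
  have dV : is_derive x (1 : R) (fun y : R => y^-1) (- x ^- 2).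
    have := is_deriveV xn0 (is_derive_id x 1); rewrite /GRing.scale /= mulr1; exact.
  have dp : is_derive x^-1 (1 : R) (horner p) (p^`()).[x^-1].
    by split; [exact: derivable_horner|rewrite derivE derive1E].
  have d1 := @is_derive1_comp _ (horner p) (fun y => y^-1) x _ _ dp dV.
  have d2 := @is_derive1_comp _ expR (fun y => - y^-1) x _ _ (is_derive_expR _) (is_deriveN dV).
  apply: (is_derive_eq (is_deriveM d1 d2)).
  rewrite /flat_exp x0 !hornerE /GRing.scale /=; field; exact: xn0.
rewrite x0; apply: is_derive_estimate => eps eps0.
(* The extra ['X^2] turns the exponential bound at [h^-1] into a value of at most [C * h ^+ 2], so
   the derivative at 0 is zero. *)
have [C C0 CP] := horner_le_expR (p * 'X^2).
have C1 : 0 < C + 1 by rewrite ltr_wpDl.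
exists (eps / (C + 1)); first exact: divr_gt0.
move=> h hlt; rewrite addr0 /flat_exp ltxx mulr0 !subr0.
case: ifPn => h0; last by rewrite normr0 mulr_ge0 // ltW.
have hV0 : 0 <= h^-1 by rewrite invr_ge0 ltW.
rewrite (gtr0_norm h0) in hlt *.
have := CP _ hV0; rewrite hornerM hornerXn normrM (ger0_norm (exprn_ge0 2 hV0)) => hC.
rewrite normrM (ger0_norm (expR_ge0 _)) expRN ler_pdivrMr ?expR_gt0 //.
rewrite -ler_pdivlMr ?exprn_gt0 ?invr_gt0 // in hC.
apply: le_trans hC _; rewrite exprVn invrK.
rewrite (_ : C * _ * _ = C * h * h * expR h^-1); last by ring.
rewrite ler_wpM2r ?expR_ge0 // ler_wpM2r ?(ltW h0) //.
apply: (@le_trans _ _ ((C + 1) * (eps / (C + 1)))); last by rewrite mulrC divfK // gt_eqF.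
by rewrite ler_pM ?(ltW h0) ?lerDl // ltW.
Unshelve. all: by end_near. Qed.

Lemma flat_exp_gt0 x : 0 < x -> 0 < flat_exp 1 x.
Proof. by move=> x0; rewrite /flat_exp x0 hornerC mul1r expR_gt0. Qed.

Lemma flat_exp_ge0 x : 0 <= flat_exp 1 x.
Proof. by rewrite /flat_exp; case: ifP => // _; rewrite hornerC mul1r expR_ge0. Qed.

Lemma flat_exp_le0 x : x <= 0 -> flat_exp 1 x = 0.
Proof. by move=> x0; rewrite /flat_exp ifF //; apply/negbTE; rewrite -leNgt. Qed.

End flat_exponential.

(** * Test functions and the fundamental lemma of the calculus of variations *)

Section test_functions.
Context {R : realType}.
Implicit Types (D : set (R * R)) (g h G : R * R -> R).

Lemma CkT_add k g h : Ck k setT g -> Ck k setT h -> Ck k setT (fun r => g r + h r).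
Proof.
elim: k g h => [|k IH] g h Cg Ch.
  by move=> r _; apply: continuous_addr_at; [exact: Cg|exact: Ch].
have dg r := Ck_differentiable Cg (x := r) I; have dh r := Ck_differentiable Ch (x := r) I.
split=> [r _|v]; first exact: differentiableD (dg r) (dh r).
have -> : 'D_v (fun r => g r + h r) = (fun r => 'D_v g r + 'D_v h r).
  by apply/funext => r; apply: deriveD; exact: diff_derivable.
by apply: IH; [case: Cg => _; exact|case: Ch => _; exact].
Qed.

Lemma CkT_mul k g h : Ck k setT g -> Ck k setT h -> Ck k setT (fun r => g r * h r).
Proof.
elim: k g h => [|k IH] g h Cg Ch.
  by move=> r _; apply: continuous_mulr_at; [exact: Cg|exact: Ch].
have dg r := Ck_differentiable Cg (x := r) I; have dh r := Ck_differentiable Ch (x := r) I.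
split=> [r _|v]; first exact: differentiableM (dg r) (dh r).
have -> : 'D_v (fun r => g r * h r) = (fun r => g r * 'D_v h r + h r * 'D_v g r).
  by apply/funext => r; apply: deriveM; exact: diff_derivable.
apply: CkT_add; apply: IH; [exact: CkW| |exact: CkW|].
  by case: Ch => _; exact.
by case: Cg => _; exact.
Qed.

Lemma CkT_cst k (c : R) : Ck k setT (fun _ : R * R => c).
Proof.
elim: k c => [|k IH] c; first by move=> r _; exact: continuous_cst_at.
split=> [r _|v]; first exact: differentiable_cst.
have -> : 'D_v (fun _ : R * R => c) = (fun=> 0).
  by apply/funext => r; exact: derive_cst.
exact: IH.
Qed.

(** For [s] with constant directional derivatives, differentiation only changes [p] and multiplies
    by a constant; hence the induction on [k] for all [p] at once. *)
Lemma Ck_flat_exp k p (s : R * R -> R) :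
  (forall r, differentiable s r) -> (forall v, exists c, forall r, 'D_v s r = c) ->
  Ck k setT (fun r => flat_exp p (s r)).
Proof.
move=> ds cs; elim: k p => [|k IH] p.
  move=> r _; apply: (@continuous_comp _ _ _ s (flat_exp p)).
    exact: differentiable_continuous.
  apply: differentiable_continuous; apply/derivable1_diffP.
  by case: (is_derive_flat_exp p (s r)).
have D1 r v := @derive_comp1 _ _ (flat_exp p) s r v (ds r)
  (@ex_derive _ _ _ _ _ _ _ (is_derive_flat_exp p (s r))).
split=> [r _|v]; first by case: (D1 r 0).
have [c cP] := cs v.
have -> : 'D_v (fun r => flat_exp p (s r)) =
    (fun r => c * flat_exp ('X^2 * (p - p^`())) (s r)).
  apply/funext => r; have [_ E] := D1 r v; rewrite [LHS]E cP; congr (_ * _).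
  by case: (is_derive_flat_exp p (s r)).
by apply: CkT_mul; [exact: CkT_cst|exact: IH].
Qed.

Lemma differentiable_coordinates (r : R * R) :
  differentiable (fst : R * R -> R) r /\ differentiable (snd : R * R -> R) r.
Proof.
by split; [apply: (@linear_differentiable _ _ _ fst) => q; exact: cvg_fst|
  apply: (@linear_differentiable _ _ _ snd) => q; exact: cvg_snd].
Qed.

(** Positive exactly on the open square of half-side [rho] around [a], which is the ball of the
    product norm. *)
Definition bump (a : R * R) (rho : R) (r : R * R) : R :=
  (flat_exp 1 (r.1 - (a.1 - rho)) * flat_exp 1 (a.1 + rho - r.1)) *
  (flat_exp 1 (r.2 - (a.2 - rho)) * flat_exp 1 (a.2 + rho - r.2)).

Lemma bump_test_function D a rho : 0 < rho ->
  (`[a.1 - rho, a.1 + rho] `*` `[a.2 - rho, a.2 + rho]) `<=` D ->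
  test_function D (bump a rho).
Proof.
move=> rho0 aD; split.
  move=> k; have P1 := fun r => (differentiable_coordinates r).1.
  have P2 := fun r => (differentiable_coordinates r).2.
  have E1 (v r : R * R) : 'D_v (fst : R * R -> R) r = v.1.
    by rewrite -[RHS](@derive_id _ _ r.1 v.1).
  have E2 (v r : R * R) : 'D_v (snd : R * R -> R) r = v.2.
    by rewrite -[RHS](@derive_id _ _ r.2 v.2).
  have A1 (s : R * R -> R) (c : R) : (forall r, differentiable s r) ->
      (forall v, exists c, forall r, 'D_v s r = c) ->
      Ck k setT (fun r => flat_exp 1 (s r - c)).
    move=> ds cs; apply: Ck_flat_exp => [r|v]; first exact: differentiableB.
    have [d dP] := cs v; exists d => r; rewrite -[RHS](dP r) -[RHS]subr0.
    rewrite -[X in _ = _ - X](derive_cst c r v); apply: deriveB => //.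
    exact: diff_derivable.
  have A2 (s : R * R -> R) (c : R) : (forall r, differentiable s r) ->
      (forall v, exists c, forall r, 'D_v s r = c) ->
      Ck k setT (fun r => flat_exp 1 (c - s r)).
    move=> ds cs; apply: Ck_flat_exp => [r|v]; first exact: differentiableB.
    have [d dP] := cs v; exists (- d) => r; rewrite -[in RHS](dP r) -[RHS]sub0r.
    rewrite -[X in _ = X - _](derive_cst c r v); apply: deriveB => //.
    exact: diff_derivable.
  apply: CkT_mul; apply: CkT_mul.
  - by apply: (A1 fst) => // v; exists v.1.
  - by apply: (A2 fst) => // v; exists v.1.
  - by apply: (A1 snd) => // v; exists v.2.
  - by apply: (A2 snd) => // v; exists v.2.
exists (`[a.1 - rho, a.1 + rho] `*` `[a.2 - rho, a.2 + rho]); split => //.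
  by apply: compact_setX; exact: segment_compact.
move=> r; rewrite /bump /= !in_itv /= => nK.
have [h1|h1] := leP r.1 (a.1 - rho); first by rewrite (flat_exp_le0 (x := r.1 - _)) ?subr_le0 // !mul0r.
have [h2|h2] := leP (a.1 + rho) r.1.
  by rewrite (flat_exp_le0 (x := a.1 + rho - _)) ?subr_le0 // mulr0 mul0r.
have [h3|h3] := leP r.2 (a.2 - rho).
  by rewrite (flat_exp_le0 (x := r.2 - _)) ?subr_le0 // mul0r mulr0.
have [h4|h4] := leP (a.2 + rho) r.2.
  by rewrite (flat_exp_le0 (x := a.2 + rho - _)) ?subr_le0 // !mulr0.
by exfalso; apply: nK; rewrite !ltW.
Qed.

Lemma bump_ge0 a rho r : 0 <= bump a rho r.
Proof. by rewrite !mulr_ge0 ?flat_exp_ge0. Qed.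

Lemma bump_gt0 a rho r : ball a rho r -> 0 < bump a rho r.
Proof.
move=> [/= h1 h2]; move: h1 h2; rewrite -!ball_normE /ball_ /= !ltr_distlC.
move=> /andP[h1 h2] /andP[h3 h4]; rewrite !mulr_gt0 // flat_exp_gt0 // subr_gt0 //.
Qed.

Lemma test_function_continuous D eta r : test_function D eta -> {for r, continuous eta}.
Proof. by case=> /(_ 0%N) + _; apply. Qed.

(** If [G] were positive at a point, a bump supported where [G] stays positive would have a positive
    integral against it. The same applies to [- G]. *)
Lemma fundamental_lemma D G : open D -> (forall r, D r -> {for r, continuous G}) ->
  (forall eta, test_function D eta -> \int[area]_(r in D) (G r * eta r) = 0) ->
  forall r, D r -> G r = 0.
Proof.
move=> oD; have le0 (H : R * R -> R) : (forall r, D r -> {for r, continuous H}) ->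
    (forall eta, test_function D eta -> \int[area]_(r in D) (H r * eta r) = 0) ->
    forall r, D r -> H r <= 0.
  move=> cH H0 r Dr; rewrite leNgt; apply/negP => Hr.
  have oU : open (D `&` H @^-1` [set x | 0 < x]).
    exact: (open_setI_preimage oD cH (@open_gt _ 0)).
  have : nbhs r (D `&` H @^-1` [set x | 0 < x]) by exact: open_nbhs_nbhs.
  move=> /nbhs_ballP[e /= e0 eP].
  have rho0 : 0 < e / 2 by rewrite divr_gt0.
  have small : e / 2 < e by rewrite ltr_pdivrMr // ltr_pMr // ltr1n.
  have boxball : (`[r.1 - e / 2, r.1 + e / 2] `*` `[r.2 - e / 2, r.2 + e / 2]) `<=` ball r e.
    move=> q [/=]; rewrite !in_itv /= => /andP[a1 a2] /andP[b1 b2].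
    split; rewrite -ball_normE /ball_ /=; apply: le_lt_trans small;
      by rewrite ler_distlC; apply/andP.
  have tb : test_function D (bump r (e / 2)).
    by apply: bump_test_function => // q /boxball /eP[].
  have [_ [K [cK KD bK]]] := tb.
  have Hb0 q : D q -> 0 <= H q * bump r (e / 2) q.
    move=> Dq; have [hq|hq] := leP 0 (H q); first by rewrite mulr_ge0 ?bump_ge0.
    have [/boxball /eP[_ /= hq']|nb] := pselect ((`[r.1 - e / 2, r.1 + e / 2] `*` `[r.2 - e / 2, r.2 + e / 2]) q).
      by rewrite mulr_ge0 ?bump_ge0 // ltW.
    have [b0|b0] := leP (bump r (e / 2) q) 0.
      by rewrite (_ : bump r (e / 2) q = 0) ?mulr0 //; apply/eqP; rewrite eq_le b0 bump_ge0.
    exfalso; apply: nb; move: b0; rewrite /bump /= !in_itv /=.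
    have [h1|h1] := leP q.1 (r.1 - e / 2); first by rewrite (flat_exp_le0 (x := q.1 - _)) ?subr_le0 // !mul0r ltxx.
    have [h2|h2] := leP (r.1 + e / 2) q.1.
      by rewrite (flat_exp_le0 (x := r.1 + e / 2 - _)) ?subr_le0 // mulr0 mul0r ltxx.
    have [h3|h3] := leP q.2 (r.2 - e / 2).
      by rewrite (flat_exp_le0 (x := q.2 - _)) ?subr_le0 // mul0r mulr0 ltxx.
    have [h4|h4] := leP (r.2 + e / 2) q.2.
      by rewrite (flat_exp_le0 (x := r.2 + e / 2 - _)) ?subr_le0 // !mulr0 ltxx.
    by rewrite !ltW.
  have cHb q : D q -> {for q, continuous (fun q => H q * bump r (e / 2) q)}.
    move=> Dq; apply: continuous_mulr_at; first exact: cH.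
    exact: test_function_continuous tb.
  have Hbi : area.-integrable D (EFin \o (fun q => H q * bump r (e / 2) q)).
    apply: (integrable_compact_support oD cK KD cHb) => q _ nK.
    by rewrite bK // mulr0.
  have oB : open (ball r (e / 2)) by exact: ball_open.
  have BD : ball r (e / 2) `<=` D `&` H @^-1` [set x | 0 < x].
    by move=> q rq; apply: eP; apply: le_ball rq; exact: ltW.
  have := open_area_gt0 oB (ballxx r rho0).
  have BD' q (rq : ball r (e / 2) q) : D q := (BD q rq).1.
  have Hpos q (rq : ball r (e / 2) q) : 0 < H q * bump r (e / 2) q.
    by rewrite mulr_gt0 ?bump_gt0 //; case: (BD _ rq).
  have null := Rintegral_eq0_null (open_measurable2 oD) (open_measurable2 oB) BD' Hbi Hb0
    (H0 _ tb) Hpos.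
  move=> apos; move: (apos); have -> : area (ball r (e / 2)) = 0%E by exact: null.
  by rewrite ltxx.
move=> cG G0 r Dr; apply/eqP; rewrite eq_le (le0 _ cG G0 _ Dr) /=.
rewrite -oppr_le0; apply: (le0 (fun r => - G r)) => // [q Dq|eta te].
  exact: continuous_oppr_at (cG _ Dq).
have [_ [K [cK KD eK]]] := te.
transitivity (\int[area]_(r in D) (-1 * (G r * eta r))).
  by apply: eq_Rintegral => q _; rewrite mulN1r mulNr.
rewrite RintegralZl ?G0 ?mulr0 //; first exact: open_measurable2.
apply: (integrable_compact_support oD cK KD) => q Dq.
  by apply: continuous_mulr_at; [exact: cG|exact: test_function_continuous te].
by move=> nK; rewrite eK // mulr0.
Qed.

End test_functions.

(** * Variation of the Hamiltonians at a regular state *)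

Section state_variation.
Context {R : realType}.
Implicit Types (D K : set (R * R)) (zeta eta kappa : R * R -> R) (phi : R * R * R -> R).

Lemma CkS {V : normedModType R} k (U U' : set V) (h : V -> R) :
  U `<=` U' -> Ck k U' h -> Ck k U h.
Proof.
move=> UU'; elim: k h => [|k IH] h; first by move=> Ch x /UU'; exact: Ch.
by move=> [dh Ch]; split => [x /UU'|v]; [exact: dh|apply: IH; exact: Ch].
Qed.

Lemma Ck1_cst {V : normedModType R} (U : set V) (c : R) : Ck 1 U (fun=> c).
Proof.
split => [x _|v x Ux]; first exact: differentiable_cst.
have -> : 'D_v (fun _ : V => c) = (fun=> 0) by apply/funext => y; exact: derive_cst.
exact: continuous_cst_at.
Qed.

Lemma Ck1_perturbed D zeta eta e : open D -> Ck 1 D zeta -> test_function D eta ->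
  Ck 1 D (fun r => zeta r + e * eta r).
Proof.
move=> oD Cz [Ceta _].
exact: (Ck1_add oD Cz (Ck1_mul oD (Ck1_cst D e) (CkS (@subsetT _ D) (Ceta 1%N)))).
Qed.

(** Uniqueness of the gradient is also used on the perturbed surfaces, which therefore need a slope
    bound of their own. *)
Lemma perturbed_slope D zeta eta e M : open D -> Ck 1 D zeta -> test_function D eta ->
  (forall r, D r -> dot2 (grad2 zeta r) (grad2 zeta r) <= M) ->
  exists M', forall r, D r -> dot2 (grad2 (fun r => zeta r + e * eta r) r)
    (grad2 (fun r => zeta r + e * eta r) r) <= M'.
Proof.
move=> oD Cz [Ceta [K [cK KD eK]]] slope.
have bound (v : R * R) : exists2 B, 0 <= B & forall r, `|'D_v eta r| <= B.
  have [B B0 BP] := compact_bounded_fun cK (fun r _ => (Ceta 1%N).2 v r I).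
  exists B => // r; have [Kr|nK] := pselect (K r); first exact: BP.
  (* The complement of [K] is open and [eta] vanishes on it, so its derivatives vanish there too and
     a bound over [K] is global. *)
  have oKc : open (~` K) by apply: closed_openC; exact: compact_closed.
  have der : is_derive r v eta 0.
    have h0 : is_derive r v (fun=> 0 : R) 0.
      by apply: DeriveDef; [exact: derivable_cst|exact: derive_cst].
    apply: near_eq_is_derive h0.
    have : nbhs r (~` K) by exact: open_nbhs_nbhs.
    by apply: filterS => q nKq; rewrite eK.
  by rewrite derive_val normr0.
have [B1 B10 B1P] := bound (1, 0); have [B2 B20 B2P] := bound (0, 1).
exists (2 * M + 2 * (e ^+ 2 * (B1 ^+ 2 + B2 ^+ 2))) => r Dr.
have E v : 'D_v (fun r => zeta r + e * eta r) r = 'D_v zeta r + e * 'D_v eta r.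
  have d1 : derivable zeta r v by apply: diff_derivable; exact: Ck_differentiable Cz Dr.
  have d2 : derivable eta r v by apply: diff_derivable; exact: (Ck_differentiable (Ceta 1%N) I).
  transitivity ('D_v zeta r + 'D_v (e *: eta) r); first exact: deriveD d1 (derivableZ d2).
  by congr (_ + _); exact: deriveZ d2.
have sq (a c B : R) : 0 <= B -> `|c| <= B -> (a + e * c) ^+ 2 <= 2 * a ^+ 2 + 2 * (e ^+ 2 * B ^+ 2).
  move=> B0 cB; have := sqrB_le a (- (e * c)); rewrite opprK sqrrN exprMn => h.
  apply: le_trans h _; rewrite lerD2l ler_pM2l // ler_wpM2l ?sqr_ge0 //.
  by rewrite -(real_normK (num_real c)) lerXn2r ?nnegrE.
have h1 := sq ('D_(1, 0) zeta r) _ _ B10 (B1P r).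
have h2 := sq ('D_(0, 1) zeta r) _ _ B20 (B2P r).
have h3 := slope r Dr.
rewrite /grad2 !E /dot2 /= -!expr2; rewrite /dot2 /= -!expr2 in h3.
apply: le_trans (lerD h1 h2) _.
rewrite (_ : _ + _ = 2 * ('D_(1, 0) zeta r ^+ 2 + 'D_(0, 1) zeta r ^+ 2) +
  2 * (e ^+ 2 * (B1 ^+ 2 + B2 ^+ 2))); last by ring.
by rewrite lerD2r ler_pM2l.
Qed.

Lemma near0_norm_lt (e0 : R) : 0 < e0 -> \forall e \near (0 : R), `|e| < e0.
Proof.
move=> e00; apply/nbhs_ballP; exists e0 => //= e.
by rewrite -ball_normE /ball_ /= sub0r normrN.
Qed.

Lemma is_derive_quadratic (c0 c1 c2 : R) :
  is_derive (0 : R) (1 : R) (fun e => c0 + c1 * e + c2 * e ^+ 2) c1.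
Proof.
apply: is_derive_estimate => eps eps0.
have C1 : 0 < `|c2| + 1 by rewrite ltr_wpDl.
exists (eps / (`|c2| + 1)); first exact: divr_gt0.
move=> h hlt; rewrite addr0 (_ : _ - _ - _ = c2 * h * h); last by ring.
rewrite normrM ler_wpM2r // normrM.
apply: (@le_trans _ _ ((`|c2| + 1) * (eps / (`|c2| + 1)))).
  by rewrite ler_pM ?lerDl // ltW.
by rewrite mulrC divfK // gt_eqF.
Qed.

Lemma surface_gradient D zeta phi0 phi M : open D -> Ck 1 D zeta ->
  (forall r, D r -> dot2 (grad2 zeta r) (grad2 zeta r) <= M) ->
  is_potential D zeta (hat zeta phi) phi0 -> is_potential D zeta (hat zeta phi) phi ->
  forall r, D r -> grad phi0 (r, zeta r) = grad phi (r, zeta r).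
Proof.
move=> oD Cz slope p0 p1 r Dr.
exact: (potential_gradient_unique oD Cz slope p0 p1 (p := (r, zeta r)) Dr (lexx _)).
Qed.

(** The form in which the variation produces it: the first term is due to the displaced domain, the
    second to the potential changing so as to keep its surface trace. *)
Lemma phi_noiseE xi zeta phi r : phi_noise xi zeta phi r =
  hat zeta (fun p => dot3 (xi p) (grad phi p)) r -
  hat zeta (dz phi) r * zeta_noise xi zeta r.
Proof. by rewrite /phi_noise /zeta_noise /hat /dot3 /=; ring. Qed.

(** Same reading as for the noise: displaced domain, correction for the fixed trace, and the gravity
    term. *)
Lemma phi_driftE g zeta phi r : phi_drift g zeta phi r =
  2^-1 * hat zeta (fun p => dot3 (grad phi p) (grad phi p)) r -
  hat zeta (dz phi) r * zeta_drift zeta phi r + g * zeta r.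
Proof. by rewrite /phi_drift /zeta_drift /hat /dot3 /=; field. Qed.

Lemma continuous_phi_noise D zeta phi xi r : Ck 1 D zeta -> Ck 2 (column D) phi ->
  Ck_field 0 (column D) xi -> D r -> {for r, continuous (phi_noise xi zeta phi)}.
Proof.
move=> Cz Cphi Cxi Dr.
have cz q : D q -> {for q, continuous zeta} by exact: Ck_continuous Cz.
have [_ _ Cdz] := Ck_field_grad (CkW Cphi).
have -> : phi_noise xi zeta phi = fun r => hat zeta (fun p => dot3 (xi p) (grad phi p)) r -
    hat zeta (dz phi) r * zeta_noise xi zeta r by apply/funext => q; exact: phi_noiseE.
apply: continuous_subr_at.
  by apply: (continuous_hat cz _ Dr) => p; exact: continuous_dot3_grad Cxi (CkW Cphi).
apply: continuous_mulr_at; first exact: (continuous_hat cz Cdz Dr).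
exact: (zeta_noise_continuous Cz Cxi Dr).
Qed.

Lemma continuous_zeta_drift D zeta phi r : Ck 1 D zeta -> Ck 2 (column D) phi ->
  D r -> {for r, continuous (zeta_drift zeta phi)}.
Proof.
move=> Cz Cphi Dr.
(* [zeta_drift zeta phi] is convertible to [zeta_noise (grad phi) zeta]. *)
exact: (zeta_noise_continuous Cz (Ck_field_grad (CkW Cphi)) Dr).
Qed.

Lemma continuous_phi_drift D zeta phi g r : Ck 1 D zeta -> Ck 2 (column D) phi ->
  D r -> {for r, continuous (phi_drift g zeta phi)}.
Proof.
move=> Cz Cphi Dr.
have cz q : D q -> {for q, continuous zeta} by exact: Ck_continuous Cz.
have Cg := Ck_field_grad (CkW Cphi); have [_ _ Cdz] := Cg.
have -> : phi_drift g zeta phi = fun r =>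
    2^-1 * hat zeta (fun p => dot3 (grad phi p) (grad phi p)) r -
    hat zeta (dz phi) r * zeta_drift zeta phi r + g * zeta r.
  by apply/funext => q; exact: phi_driftE.
apply: continuous_addr_at; last first.
  by apply: continuous_mulr_at; [exact: continuous_cst_at|exact: cz].
apply: continuous_subr_at; apply: continuous_mulr_at.
- exact: continuous_cst_at.
- by apply: (continuous_hat cz _ Dr) => p; exact: continuous_dot3_grad Cg (CkW Cphi).
- exact: (continuous_hat cz Cdz Dr).
- exact: continuous_zeta_drift Cz Cphi Dr.
Qed.

Section state.
Variables (D : set (R * R)) (zeta eta kappa : R * R -> R) (phi : R * R * R -> R).
Hypotheses (oD : open D) (reg : regular_state D zeta phi).
Hypotheses (teta : test_function D eta) (tkappa : test_function D kappa).

Let zeta_ e r := zeta r + e * eta r.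
Let f_ e r := hat zeta phi r + e * kappa r.

Lemma common_support : exists K, [/\ compact K, K `<=` D,
  forall r, ~ K r -> eta r = 0 & forall r, ~ K r -> kappa r = 0].
Proof.
have [_ [K1 [cK1 KD1 e1]]] := teta; have [_ [K2 [cK2 KD2 e2]]] := tkappa.
exists (K1 `|` K2); split.
- exact: compactU.
- by move=> r [/KD1|/KD2].
- by move=> r nK; apply: e1 => h; apply: nK; left.
- by move=> r nK; apply: e2 => h; apply: nK; right.
Qed.

Lemma noise_state_variation (xi : R * R * R -> R * R * R) :
  Ck_field 1 (column D) xi -> (forall p, column D p -> div xi p = 0) ->
  square_integrable D zeta xi -> no_flux D zeta xi ->
  is_derive (0 : R) (1 : R) (fun e => noise_hamiltonian D xi (zeta_ e) (f_ e))
    (\int[area]_(r in D) (phi_noise xi zeta phi r * eta r + zeta_noise xi zeta r * kappa r)).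
Proof.
move=> Cxi divxi xii nfxi.
have [Cz [M slope] _ pphi sv] := reg.
have [e0 [Phi [b [e00 CPhi pot bi bP]]]] := sv _ _ teta tkappa.
have [K [cK KD eta0 kappa0]] := common_support.
have ceta r (_ : D r) := test_function_continuous (r := r) teta.
have ckappa r (_ : D r) := test_function_continuous (r := r) tkappa.
have nv := noise_variation oD Cz slope ceta ckappa cK KD eta0 kappa0 e00 CPhi pot bi bP
  (CkW_field Cxi) (fun p Fp => divxi p Fp.1) xii nfxi.
have p0 := potential_at0 e00 pot.
have sg := surface_gradient oD Cz slope p0 pphi.
(* For small [e] the chosen potential has the same gradient in the fluid as the smooth family [Phi],
   so the functional may be differentiated along [Phi]. *)
apply: (near_eq_is_derive (f := fun e => \int[volume]_(p in fluid D (zeta_ e))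
    dot3 (xi p) (grad (fun q => Phi (e, q)) p))).
  near=> e; have ee0 : `|e| < e0 by near: e; exact: near0_norm_lt.
  have [M' slope'] := perturbed_slope e oD Cz teta slope.
  apply: eq_Rintegral => p /set_mem [Dp zp].
  have E := potential_gradient oD (Ck1_perturbed e oD Cz teta) slope' (pot _ ee0) Dp (ltW zp).
  have E' := congr1 (dot3 (xi p)) (esym E).
  exact: E'.
apply: is_derive_eq nv _; apply: eq_Rintegral => r /set_mem Dr.
rewrite sg // /zeta_noise /phi_noise /hat.
have -> : dz (fun q => Phi (0, q)) (r, zeta r) = dz phi (r, zeta r).
  by have := sg r Dr => /(congr1 snd).
rewrite /dot3 /=; ring.
Unshelve. all: by end_near. Qed.

Lemma hamiltonian_state_variation g :
  is_derive (0 : R) (1 : R) (fun e => hamiltonian D g (zeta_ e) (f_ e))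
    (\int[area]_(r in D) (phi_drift g zeta phi r * eta r + zeta_drift zeta phi r * kappa r)).
Proof.
have [Cz [M slope] z2i pphi sv] := reg.
have [e0 [Phi [b [e00 CPhi pot bi bP]]]] := sv _ _ teta tkappa.
have [K [cK KD eta0 kappa0]] := common_support.
have ceta r (_ : D r) := test_function_continuous (r := r) teta.
have ckappa r (_ : D r) := test_function_continuous (r := r) tkappa.
have cz r : D r -> {for r, continuous zeta} by exact: Ck_continuous Cz.
have mD := open_measurable2 oD.
have kv := kinetic_variation oD Cz slope ceta ckappa cK KD eta0 kappa0 e00 CPhi pot bi bP.
have p0 := potential_at0 e00 pot.
have sg := surface_gradient oD Cz slope p0 pphi.
have zei : area.-integrable D (EFin \o (fun r => zeta r * eta r)).
  apply: (integrable_compact_support oD cK KD) => r Dr.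
    by apply: continuous_mulr_at; [exact: cz|exact: ceta].
  by move=> nK; rewrite eta0 // mulr0.
have e2i : area.-integrable D (EFin \o (fun r => eta r ^+ 2)).
  apply: (integrable_compact_support oD cK KD) => r Dr.
    by apply: continuous_mulr_at; exact: ceta.
  by move=> nK; rewrite eta0 // expr0n.
(* The gravitational energy is exactly a quadratic polynomial in [e], whose linear coefficient
   supplies the term with [g * zeta]. *)
have gravity e : 2^-1 * g * \int[area]_(r in D) (zeta_ e r ^+ 2) =
    2^-1 * g * \int[area]_(r in D) (zeta r ^+ 2) + g * \int[area]_(r in D) (zeta r * eta r) * e +
    2^-1 * g * \int[area]_(r in D) (eta r ^+ 2) * e ^+ 2.
  have i1 := integrableZ_EFin (2 * e) mD zei; have i2 := integrableZ_EFin (e ^+ 2) mD e2i.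
  have -> : \int[area]_(r in D) (zeta_ e r ^+ 2) =
      \int[area]_(r in D) (zeta r ^+ 2 + 2 * e * (zeta r * eta r) + e ^+ 2 * eta r ^+ 2).
    by apply: eq_Rintegral => r _; rewrite /zeta_; ring.
  have -> : \int[area]_(r in D) (zeta r ^+ 2 + 2 * e * (zeta r * eta r) + e ^+ 2 * eta r ^+ 2) =
      \int[area]_(r in D) (zeta r ^+ 2) + 2 * e * \int[area]_(r in D) (zeta r * eta r) +
      e ^+ 2 * \int[area]_(r in D) (eta r ^+ 2).
    apply: etrans (RintegralD mD (integrableD_EFin mD z2i i1) i2) _.
    congr (_ + _); last exact: RintegralZl.
    by apply: etrans (RintegralD mD z2i i1) _; congr (_ + _); exact: RintegralZl.
  by field.
have gd := is_derive_quadratic (2^-1 * g * \int[area]_(r in D) (zeta r ^+ 2))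
  (g * \int[area]_(r in D) (zeta r * eta r)) (2^-1 * g * \int[area]_(r in D) (eta r ^+ 2)).
apply: (near_eq_is_derive (f := fun e => \int[volume]_(p in fluid D (zeta_ e))
    (2^-1 * dot3 (grad (fun q => Phi (e, q)) p) (grad (fun q => Phi (e, q)) p)) +
    (2^-1 * g * \int[area]_(r in D) (zeta r ^+ 2) + g * \int[area]_(r in D) (zeta r * eta r) * e +
    2^-1 * g * \int[area]_(r in D) (eta r ^+ 2) * e ^+ 2))).
  near=> e; have ee0 : `|e| < e0 by near: e; exact: near0_norm_lt.
  have [M' slope'] := perturbed_slope e oD Cz teta slope.
  apply: (congr2 +%R _ (esym (gravity e))).
  apply: eq_Rintegral => p /set_mem [Dp zp].
  have E := potential_gradient oD (Ck1_perturbed e oD Cz teta) slope' (pot _ ee0) Dp (ltW zp).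
  have E' := congr1 (fun u => 2^-1 * dot3 u u) (esym E).
  exact: E'.
apply: is_derive_eq (is_deriveD kv gd) _.
have zgi := integrableZ_EFin g mD zei.
have [Cphi _ _ _ _] := pphi.
have di : area.-integrable D
    (EFin \o (fun r => phi_drift g zeta phi r * eta r + zeta_drift zeta phi r * kappa r)).
  apply: (integrable_compact_support oD cK KD) => r Dr.
    apply: continuous_addr_at; apply: continuous_mulr_at.
    - exact: continuous_phi_drift Cz Cphi Dr.
    - exact: ceta.
    - exact: continuous_zeta_drift Cz Cphi Dr.
    - exact: ckappa.
  by move=> nK; rewrite eta0 // kappa0 // !mulr0 addr0.
have gz : \int[area]_(r in D) (g * (zeta r * eta r)) = g * \int[area]_(r in D) (zeta r * eta r).
  exact: RintegralZl.
rewrite -gz.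
have -> : \int[area]_(r in D) (eta r * (2^-1 * dot3 (grad (fun q => Phi (0, q)) (r, zeta r))
      (grad (fun q => Phi (0, q)) (r, zeta r))) +
    (kappa r - eta r * dz (fun q => Phi (0, q)) (r, zeta r)) *
      zeta_noise (grad (fun q => Phi (0, q))) zeta r) =
  \int[area]_(r in D) (phi_drift g zeta phi r * eta r + zeta_drift zeta phi r * kappa r -
    g * (zeta r * eta r)).
  apply: eq_Rintegral => r /set_mem Dr.
  have E := sg r Dr; have Ez : dz (fun q => Phi (0, q)) (r, zeta r) = dz phi (r, zeta r).
    by have := E => /(congr1 snd).
  have En : zeta_noise (grad (fun q => Phi (0, q))) zeta r = zeta_drift zeta phi r.
    by rewrite /zeta_noise /hat E.
  rewrite E Ez En phi_driftE /hat; ring.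
rewrite (RintegralB mD di zgi); exact: subrK.
Unshelve. all: by end_near. Qed.

End state.
End state_variation.

(** * Replacing the coefficients of a stochastic equation by equal ones *)

Section congruence.
Context {d : measure_display} {Omega : measurableType d} {R : realType}.
Context (P : probability Omega R).

Lemma stratonovich_sum_congr (Y Y' W : R -> Omega -> R) (t : R) (s : seq R) w :
  itv_partition 0 t s -> (forall u, 0 <= u <= t -> Y u w = Y' u w) ->
  stratonovich_sum Y W s w = stratonovich_sum Y' W s w.
Proof.
move=> ps YY; apply: eq_bigr => k _.
have range m : (m <= size s)%N -> 0 <= nth 0 (0 :: s) m <= t.
  (* The bounds on partition points read the list with default [t]; as [m <= size s], the default is
     never reached. The right end of interval [k] is entry [k.+1] of [0 :: s]. *)
  move=> ms; rewrite (set_nth_default t) //.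
  by rewrite (itv_partition_nth_ge _ ps) // (itv_partition_nth_le _ ps).
have h1 := range k (ltnW (ltn_ord k)); have h2 := range k.+1 (ltn_ord k).
by rewrite (YY _ h1) (YY (nth 0 s k) h2).
Qed.

(** Trapezoidal sums and time integrals up to [t] sample the coefficients only in [[0, t]], so the
    same stochastic integrals and the same series serve for both equations. *)
Lemma solves_sde_congr (W : nat -> R -> {RV P >-> R}) (T : R) (X b b' : R -> Omega -> R)
  (sigma sigma' : nat -> R -> Omega -> R) :
  (forall t w, 0 <= t <= T -> b t w = b' t w) ->
  (forall i t w, 0 <= t <= T -> sigma i t w = sigma' i t w) ->
  solves_sde W T X b sigma -> solves_sde W T X b' sigma'.
Proof.
move=> bb ss H t /[dup] tT /andP[t0 t1]; have [I [S [hI hS hX]]] := H t tT.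
have sub u : 0 <= u <= t -> 0 <= u <= T.
  by move=> /andP[u0 ut]; rewrite u0 (le_trans ut).
exists I, S; split => //.
  move=> i e e0; have [delta d0 dP] := hI i e e0; exists delta => // s ps hs.
  have [A [mA PA AP]] := dP s ps hs; exists A; split => // w /=.
  rewrite -(@stratonovich_sum_congr (sigma i) (sigma' i) _ t) //; first exact: AP.
  by move=> u /sub; exact: ss.
apply: filterS hX => w [bi E].
have bbt u : `[0, t]%classic u -> b u w = b' u w.
  by rewrite /= in_itv /= => /sub; exact: bb.
split.
  apply: eq_integrable bi => //= u; rewrite inE => /bbt ->.
  by [].
rewrite E; congr (_ + _ + _); apply: eq_Rintegral => u /set_mem; exact: bbt.
Qed.

End congruence.

(** * Variational derivatives of the Hamiltonians *)

Section variational_derivative.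
Context {R : realType}.
Implicit Types (D : set (R * R)) (zeta f G : R * R -> R) (phi : R * R * R -> R).

Lemma test_function0 D : test_function D (fun=> 0).
Proof. by split => [k|]; [exact: CkT_cst|exists set0; split => //; exact: compact0]. Qed.

Lemma integrable_test D G eta : open D -> (forall r, D r -> {for r, continuous G}) ->
  test_function D eta -> area.-integrable D (EFin \o (fun r => G r * eta r)).
Proof.
move=> oD cG te; have [_ [K [cK KD e0]]] := te.
apply: (integrable_compact_support oD cK KD) => r Dr.
  by apply: continuous_mulr_at; [exact: cG|exact: test_function_continuous te].
by move=> nK; rewrite e0 // mulr0.
Qed.

Lemma is_vderiv_unique D F f G1 G2 : open D -> is_vderiv D F f G1 -> is_vderiv D F f G2 ->
  forall r, D r -> G1 r = G2 r.
Proof.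
move=> oD [c1 d1] [c2 d2] r Dr; apply/eqP; rewrite -subr_eq0; apply/eqP.
apply: (fundamental_lemma (G := fun r => G1 r - G2 r) oD _ _ Dr) => [q Dq|eta te].
  by apply: continuous_subr_at; [exact: c1|exact: c2].
have i1 := integrable_test oD c1 te; have i2 := integrable_test oD c2 te.
have [_ E1] := d1 _ te; have [_ E2] := d2 _ te.
transitivity (\int[area]_(r in D) (G1 r * eta r - G2 r * eta r)).
  by apply: eq_Rintegral => q _; rewrite mulrBl.
apply: etrans (RintegralB (open_measurable2 oD) i1 i2) _.
by apply/eqP; rewrite subr_eq0; apply/eqP; exact: etrans (esym E1) E2.
Qed.

(** [vderiv] is a choice, and its default is excluded once some derivative exists; the fundamental
    lemma then determines its values on [D]. *)
Lemma vderivE D F f G : open D -> is_vderiv D F f G ->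
  is_vderiv D F f (vderiv D F f) /\ forall r, D r -> vderiv D F f r = G r.
Proof.
move=> oD dG; have dV : is_vderiv D F f (vderiv D F f).
  exact: (@xgetPex _ (cst 0) [set G | is_vderiv D F f G] (ex_intro _ G dG)).
by split => //; exact: is_vderiv_unique oD dV dG.
Qed.

(** A joint variation of both arguments contains the two partial ones, obtained by taking the zero
    test function in the other argument. *)
Lemma is_vderiv_variation D (H : (R * R -> R) -> (R * R -> R) -> R) zeta f
    (A B : R * R -> R) :
  (forall r, D r -> {for r, continuous A}) -> (forall r, D r -> {for r, continuous B}) ->
  (forall eta kappa, test_function D eta -> test_function D kappa ->
    is_derive (0 : R) (1 : R) (fun e => H (fun r => zeta r + e * eta r) (fun r => f r + e * kappa r))
      (\int[area]_(r in D) (A r * eta r + B r * kappa r))) ->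
  is_vderiv D (fun z => H z f) zeta A /\ is_vderiv D (H zeta) f B.
Proof.
have still (h : R * R -> R) e : (fun r => h r + e * 0) = h.
  by apply/funext => r; rewrite mulr0 addr0.
move=> cA cB dH; split; split => // eta te.
- have d := dH _ _ te (test_function0 D).
  have E e : H (fun r => zeta r + e * eta r) (fun r => f r + e * 0) =
      H (fun r => zeta r + e * eta r) f by rewrite still.
  rewrite (funext E) in d; apply: (is_derive_eq d).
  by apply: eq_Rintegral => r _; rewrite mulr0 addr0.
- have d := dH _ _ (test_function0 D) te.
  have E e : H (fun r => zeta r + e * 0) (fun r => f r + e * eta r) =
      H zeta (fun r => f r + e * eta r) by rewrite still.
  rewrite (funext E) in d; apply: (is_derive_eq d).
  by apply: eq_Rintegral => r _; rewrite mulr0 add0r.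
Qed.

Lemma hamiltonian_vderiv D zeta phi g : open D -> regular_state D zeta phi ->
  is_vderiv D (fun z => hamiltonian D g z (hat zeta phi)) zeta (phi_drift g zeta phi) /\
  is_vderiv D (hamiltonian D g zeta) (hat zeta phi) (zeta_drift zeta phi).
Proof.
move=> oD reg; have [Cz _ _ [Cphi _ _ _ _] _] := reg.
apply: is_vderiv_variation => [r|r|eta kappa te tk].
- exact: continuous_phi_drift Cz Cphi.
- exact: continuous_zeta_drift Cz Cphi.
- exact: (hamiltonian_state_variation oD reg te tk g).
Qed.

Lemma noise_vderiv D zeta phi xi : open D -> regular_state D zeta phi ->
  Ck_field 1 (column D) xi -> (forall p, column D p -> div xi p = 0) ->
  square_integrable D zeta xi -> no_flux D zeta xi ->
  is_vderiv D (fun z => noise_hamiltonian D xi z (hat zeta phi)) zeta (phi_noise xi zeta phi) /\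
  is_vderiv D (noise_hamiltonian D xi zeta) (hat zeta phi) (zeta_noise xi zeta).
Proof.
move=> oD reg Cxi divxi xii nfxi; have [Cz _ _ [Cphi _ _ _ _] _] := reg.
apply: is_vderiv_variation => [r|r|eta kappa te tk].
- exact: continuous_phi_noise Cz Cphi (CkW_field Cxi).
- exact: (zeta_noise_continuous Cz (CkW_field Cxi)).
- exact: (noise_state_variation oD reg te tk Cxi divxi xii nfxi).
Qed.

End variational_derivative.

Theorem theorem1 (R : realType) (d : measure_display)
    (Omega : measurableType d) (P : probability Omega R)
    (W : nat -> R -> {RV P >-> R}) (T : R) (D : set (R * R)) (g : R)
    (xi : nat -> R * R * R -> R * R * R)
    (zeta : R -> Omega -> R * R -> R) (phi : R -> Omega -> R * R * R -> R)
    (hW : brownian_family W) (hT : 0 < T) (hD : open D)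
    (hxi : forall i, Ck_field 1 (column D) (xi i) /\
       forall p, column D p -> div (xi i) p = 0)
    (hstate : forall t w, 0 <= t <= T -> regular_state D (zeta t w) (phi t w))
    (hxi_boundary : forall i t w, 0 <= t <= T ->
       square_integrable D (zeta t w) (xi i) /\ no_flux D (zeta t w) (xi i)) :
  (forall t w, 0 <= t <= T ->
     has_vderivs D zeta phi (hamiltonian D g) t w /\
     forall i, has_vderivs D zeta phi (noise_hamiltonian D (xi i)) t w) /\
  (stochastic_water_waves W T D g xi zeta phi <->
   canonical_hamiltonian_form W T D g xi zeta phi).
Proof.
have dH t w (tT : 0 <= t <= T) := hamiltonian_vderiv g hD (hstate t w tT).
have dN t w (tT : 0 <= t <= T) i := noise_vderiv hD (hstate t w tT) (hxi i).1 (hxi i).2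
  (hxi_boundary i t w tT).1 (hxi_boundary i t w tT).2.
split=> [t w tT|].
  split=> [|i]; first by have [z f] := dH t w tT; split; [exact: (vderivE hD z).1|exact: (vderivE hD f).1].
  by have [z f] := dN t w tT i; split; [exact: (vderivE hD z).1|exact: (vderivE hD f).1].
have vHz r t w : D r -> 0 <= t <= T ->
    vderiv_zeta D zeta phi (hamiltonian D g) t w r = phi_drift g (zeta t w) (phi t w) r.
  by move=> Dr tT; exact: (vderivE hD (dH t w tT).1).2.
have vHf r t w : D r -> 0 <= t <= T ->
    vderiv_phihat D zeta phi (hamiltonian D g) t w r = zeta_drift (zeta t w) (phi t w) r.
  by move=> Dr tT; exact: (vderivE hD (dH t w tT).2).2.
have vNz r i t w : D r -> 0 <= t <= T ->
    vderiv_zeta D zeta phi (noise_hamiltonian D (xi i)) t w r = phi_noise (xi i) (zeta t w) (phi t w) r.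
  by move=> Dr tT; exact: (vderivE hD (dN t w tT i).1).2.
have vNf r i t w : D r -> 0 <= t <= T ->
    vderiv_phihat D zeta phi (noise_hamiltonian D (xi i)) t w r = zeta_noise (xi i) (zeta t w) r.
  by move=> Dr tT; exact: (vderivE hD (dN t w tT i).2).2.
(* At each point of [D] the coefficients of the two systems agree for every sample and every time in
   [[0, T]], so each implication is a substitution. *)
split=> E phihat r Dr; have [E1 E2] := E r Dr; split.
- apply: solves_sde_congr E1 => [t w tT|i t w tT]; [exact: esym (vHf _ _ _ Dr tT)|exact: esym (vNf _ _ _ _ Dr tT)].
- by apply: solves_sde_congr E2 => [t w tT|i t w tT]; congr (- _); [exact: esym (vHz _ _ _ Dr tT)|exact: esym (vNz _ _ _ _ Dr tT)].
- apply: solves_sde_congr E1 => [t w tT|i t w tT]; [exact: vHf|exact: vNf].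
- by apply: solves_sde_congr E2 => [t w tT|i t w tT]; congr (- _); [exact: vHz|exact: vNz].
Qed.
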